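(* Let $M$ be a compact smooth manifold of dimension $d$. For $g_0,g_1\in\operatorname{Met}(M)$ let $$\widetilde{\mathcal D}^{\mathrm{KL}\text{-}\mathrm{Met}}(g_0\|g_1):=\frac2d\,\mathcal D^{\mathrm{KL}}(\operatorname{vol}(g_0)\|\operatorname{vol}(g_1))+\mathcal D^{\mathrm{shape}}(g_0\|g_1),$$ where $\mathcal D^{\mathrm{KL}}$ is the standard KL divergence on $\operatorname{Dens}(M)$, $$\mathcal D^{\mathrm{KL}}(\rho_0\|\rho_1)=\int_M\log\Big(\frac{\rho_0}{\rho_1}\Big)\rho_0+\int_M\rho_1-\int_M\rho_0,$$ and $$\mathcal D^{\mathrm{shape}}(g_0\|g_1):=\frac12\int_M\Big(\operatorname{tr}(g_1^{-1}g_0)-d\Big(\frac{\operatorname{vol}(g_0)}{\operatorname{vol}(g_1)}\Big)^{2/d}\Big)\operatorname{vol}(g_1).$$ Then: (1) $\widetilde{\mathcal D}^{\mathrm{KL}\text{-}\mathrm{Met}}:\operatorname{Met}(M)\times\operatorname{Met}(M)\to\mathbb R$ is a divergence function in the sense of information geometry. (2) The Riemannian metric induced by $\widetilde{\mathcal D}^{\mathrm{KL}\text{-}\mathrm{Met}}$ is one half times the Ebin metric. (3) Under the volume map $g\mapsto\operatorname{vol}(g)$, $\widetilde{\mathcal D}^{\mathrm{KL}\text{-}\mathrm{Met}}$ descends to a (constant) multiple of the standard KL divergence on $\operatorname{Dens}(M)$.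
   Context: $\operatorname{Met}(M)$ is the space of smooth Riemannian metrics on $M$ with $T_g\operatorname{Met}(M)=\Gamma^\infty(\operatorname{Sym}^2T^*M)$; $\operatorname{Dens}(M)$ is the space of smooth positive densities; $\operatorname{vol}(g)$ is the volume density of $g$; metrics are regarded as maps $TM\to T^*M$. The Ebin metric is $G^{\mathrm E}_g(h,k)=\int_M\operatorname{tr}(g^{-1}hg^{-1}k)\operatorname{vol}(g)$. A divergence function (in the sense of information geometry) on a space $\mathcal X$ is a smooth function $\mathcal D(\cdot\|\cdot):\mathcal X\times\mathcal X\to\mathbb R$ which is nonnegative, vanishes if and only if its two arguments coincide, and whose first derivatives (in each argument) vanish on the diagonal. The Riemannian metric induced by a divergence $\mathcal D$ on $\operatorname{Met}(M)$ is $G_g(h,k)=-\frac{\partial^2}{\partial s\,\partial t}\mathcal D(g+sh\|g+tk)\big|_{s=t=0}$. The divergence to which $\mathcal D$ descends under the volume map is $$(\rho_0,\rho_1)\mapsto\inf\{\mathcal D(g_0\|g_1):g_0,g_1\in\operatorname{Met}(M),\ \operatorname{vol}(g_0)=\rho_0,\ \operatorname{vol}(g_1)=\rho_1\}.$$ *)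

(* Defs.v *)
From HB Require Import structures.
From mathcomp Require Import all_boot all_order all_algebra.
From mathcomp Require Import all_classical all_reals all_analysis.
Set Implicit Arguments.
Unset Strict Implicit.
Unset Printing Implicit Defensive.
Import Order.TTheory GRing.Theory Num.Theory.
Import numFieldNormedType.Exports.
Local Open Scope classical_set_scope.
Local Open Scope ring_scope.

Section Euclidean.
Context {R : realType}.

Fixpoint Ck_on {V W : normedModType R} (n : nat) (U : set V) (f : V -> W)
    : Prop :=
  match n with
  | 0%N => forall x, U x -> {for x, continuous f}
  | m.+1 => (forall x, U x -> differentiable f x) /\
            (forall v : V, Ck_on m U (fun x => 'D_v f x))
  end.

Definition smooth_on {V W : normedModType R} (U : set V) (f : V -> W) : Prop :=
  forall n, Ck_on n U f.

(* The partial derivative of [f] along the coordinates listed in [l]. *)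
Fixpoint partials {d : nat} {W : normedModType R} (l : seq 'I_d)
    (f : 'rV[R]_d -> W) : 'rV[R]_d -> W :=
  match l with
  | [::] => f
  | i :: l' => fun y => 'D_(delta_mx 0 i) (partials l' f) y
  end.

(* Iterated one-dimensional Lebesgue integral; it is only applied to          *)
(* continuous functions with compact support, for which it is the Lebesgue    *)
(* integral over R^d by Fubini's theorem.                                     *)
Fixpoint euclidean_integral (d : nat) : ('rV[R]_d -> R) -> R :=
  match d with
  | 0%N => fun f => f 0
  | e.+1 => fun f =>
      \int[@lebesgue_measure R]_x
        euclidean_integral
          (fun y : 'rV[R]_e => f (row_mx (x%:M : 'rV[R]_1) y : 'rV[R]_(1 + e)))
  end.

End Euclidean.

(* Manifolds have no boundary.  The index type is unconstrained, so that the  *)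
(* atlas may or may not be maximal.  [coord a] matters on [dom a] only and    *)
(* [param a], its inverse, on [coord a @` dom a] only.                        *)
Record smoothManifold (R : realType) (d : nat) := SmoothManifold {
  carrier :> topologicalType;
  manifold_hausdorff : hausdorff_space carrier;
  manifold_second_countable : @second_countable carrier;
  chart : Type;
  dom : chart -> set carrier;
  coord : chart -> carrier -> 'rV[R]_d;
  param : chart -> 'rV[R]_d -> carrier;
  dom_open : forall a, open (dom a);
  dom_cover : forall x, exists a, dom a x;
  image_open : forall a, open (coord a @` dom a);
  coordK : forall a x, dom a x -> param a (coord a x) = x;
  coord_continuous : forall a x, dom a x -> {for x, continuous (coord a)};
  param_continuous : forall a y, (coord a @` dom a) y ->
    {for y, continuous (param a)};
  transition_smooth : forall a b,
    smooth_on (coord a @` (dom a `&` dom b)) (coord b \o param a)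
}.

Section Manifold.
Context {R : realType} {d : nat}.
Variable M : smoothManifold R d.

Definition chart_image (a : chart M) : set 'rV[R]_d := coord a @` dom a.

(* Jacobian matrix at [x] of the change of coordinates from [a] to [b].  The  *)
(* library's convention is that of row vectors: if [v] is the component row   *)
(* of a tangent vector at [x] in the chart [a], then [v *m transition_jac]    *)
(* is its component row in the chart [b].                                     *)
Definition transition_jac (a b : chart M) (x : M) : 'M[R]_d :=
  'J (coord b \o param a) (coord a x).

(* Tensor fields and densities are given by their components in every chart,  *)
(* as functions of the coordinates.  Components are set to 0 outside the      *)
(* image of the chart, so that equality of fields is equality of functions.   *)
Definition tensor := chart M -> 'rV[R]_d -> 'M[R]_d.
Definition scalar_density := chart M -> 'rV[R]_d -> R.

(* The space Gamma^oo(Sym^2 T^*M). *)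
Definition sym2 : set tensor := [set h : tensor |
  [/\ forall a, smooth_on (chart_image a) (h a),
      forall a y, ~ chart_image a y -> h a y = 0,
      forall a y, (h a y)^T = h a y
    & forall a b x, dom a x -> dom b x ->
        h a (coord a x) =
        transition_jac a b x *m h b (coord b x) *m (transition_jac a b x)^T]].

Definition Met : set tensor := [set g : tensor | sym2 g /\
  forall a y, chart_image a y -> forall v : 'rV[R]_d, v != 0 ->
    0 < (v *m g a y *m v^T) 0 0].

Definition Dens : set scalar_density := [set rho : scalar_density |
  [/\ forall a, smooth_on (chart_image a) (rho a),
      forall a y, ~ chart_image a y -> rho a y = 0,
      forall a y, chart_image a y -> 0 < rho a y
    & forall a b x, dom a x -> dom b x ->
        rho a (coord a x) = `|\det (transition_jac a b x)| * rho b (coord b x)]].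

Definition vol (g : tensor) : scalar_density :=
  fun a y => Num.sqrt (\det (g a y)).

Record partition_of_unity := PartitionOfUnity {
  pou_size : nat;
  pou_chart : 'I_pou_size -> chart M;
  pou_fun : 'I_pou_size -> M -> R;
  pou_smooth : forall i a, smooth_on (chart_image a) (pou_fun i \o param a);
  pou_ge0 : forall i x, 0 <= pou_fun i x;
  pou_support : forall i,
    closure [set x | pou_fun i x != 0] `<=` dom (pou_chart i);
  pou_sum : forall x, \sum_i pou_fun i x = 1
}.

Definition pou_integral (P : partition_of_unity) (rho : scalar_density) : R :=
  \sum_(i < pou_size P) euclidean_integral
    ((fun y => pou_fun i (param (pou_chart i) y) * rho (pou_chart i) y)
       \_ (chart_image (pou_chart i))).

(* Integral of a density over a compact manifold, computed with a partition   *)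
(* of unity fixed once and for all.  One exists since [M] is compact, and the *)
(* integral of a continuous density does not depend on it, by the change of   *)
(* variables formula; the value 0 is never used when [M] is compact.          *)
Definition dens_integral (rho : scalar_density) : R :=
  match pselect $|partition_of_unity| with
  | left P => pou_integral (unsquash P) rho
  | right _ => 0
  end.

(* A finite family of seminorms of the Frechet space [sym2]: suprema over     *)
(* compact subsets of chart images of the partial derivatives of order at     *)
(* most [sn_order].                                                           *)
Record seminorms := Seminorms {
  sn_size : nat;
  sn_chart : 'I_sn_size -> chart M;
  sn_set : 'I_sn_size -> set 'rV[R]_d;
  sn_compact : forall i, compact (sn_set i);
  sn_sub : forall i, sn_set i `<=` chart_image (sn_chart i);
  sn_order : nat
}.

Definition smooth_close (p : seminorms) (e : R) (g h : tensor) : Prop :=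
  forall (i : 'I_(sn_size p)) (l : seq 'I_d) (y : 'rV[R]_d),
    (size l <= sn_order p)%N -> sn_set i y ->
    `|partials l (g (sn_chart i)) y - partials l (h (sn_chart i)) y| < e.

Definition smooth_close2 (p : seminorms) (e : R) (u v : tensor * tensor)
    : Prop :=
  smooth_close p e u.1 v.1 /\ smooth_close p e u.2 v.2.

(* Iterated directional derivative of [F] at [u] along the vectors [hs]. *)
Fixpoint dir_derive (F : tensor * tensor -> R) (hs : seq (tensor * tensor))
    (u : tensor * tensor) : R :=
  match hs with
  | [::] => F u
  | h :: hs' => derive1 (fun t : R => dir_derive F hs' (u + t *: h)) 0
  end.

(* Smoothness on the open subset [Met `*` Met] of the Frechet space           *)
(* [sym2 `*` sym2] in the sense of Michal-Bastiani (or Hamilton): all         *)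
(* iterated directional derivatives exist and, for every [k], the [k]-th one  *)
(* is jointly continuous in the base point and the [k] directions.            *)
Definition smooth_functional (F : tensor * tensor -> R) : Prop :=
  forall k (hs : k.-tuple (tensor * tensor)) (u : tensor * tensor),
    (forall i, (sym2 `*` sym2) (tnth hs i)) -> (Met `*` Met) u ->
    (forall h, (sym2 `*` sym2) h ->
       derivable (fun t : R => dir_derive F hs (u + t *: h)) 0 1) /\
    (forall e : R, 0 < e -> exists (p : seminorms) (r : R), 0 < r /\
       forall (hs' : k.-tuple (tensor * tensor)) (u' : tensor * tensor),
         (forall i, (sym2 `*` sym2) (tnth hs' i)) -> (Met `*` Met) u' ->
         smooth_close2 p r u u' ->
         (forall i, smooth_close2 p r (tnth hs i) (tnth hs' i)) ->
         `|dir_derive F hs u - dir_derive F hs' u'| < e).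

Record divergence (D : tensor -> tensor -> R) : Prop := Divergence {
  divergence_smooth : smooth_functional (fun u => D u.1 u.2);
  divergence_ge0 : forall g0 g1, Met g0 -> Met g1 -> 0 <= D g0 g1;
  divergence_eq0 : forall g0 g1, Met g0 -> Met g1 -> D g0 g1 = 0 <-> g0 = g1;
  divergence_derive_l : forall g h, Met g -> sym2 h ->
    is_derive (0 : R) 1 (fun t : R => D (g + t *: h) g) 0;
  divergence_derive_r : forall g h, Met g -> sym2 h ->
    is_derive (0 : R) 1 (fun t : R => D g (g + t *: h)) 0
}.

Definition induced_metric (D : tensor -> tensor -> R) (g h k : tensor) : R :=
  - derive1 (fun s : R => derive1 (fun t : R => D (g + s *: h) (g + t *: k)) 0) 0.

(* The values are extended reals so that the infimum of the empty set is +oo. *)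
Definition descended (D : tensor -> tensor -> R) (rho0 rho1 : scalar_density)
    : \bar R :=
  ereal_inf [set x | exists g0 g1 : tensor,
    [/\ Met g0, Met g1, vol g0 = rho0, vol g1 = rho1 & x = (D g0 g1)%:E]].

Definition Ebin (g h k : tensor) : R :=
  dens_integral (fun a y =>
    \tr (invmx (g a y) *m h a y *m invmx (g a y) *m k a y) * vol g a y).

Definition KL (rho0 rho1 : scalar_density) : R :=
  dens_integral (fun a y => ln (rho0 a y / rho1 a y) * rho0 a y)
  + dens_integral rho1 - dens_integral rho0.

Definition Dshape (g0 g1 : tensor) : R :=
  2^-1 * dens_integral (fun a y =>
    (\tr (invmx (g1 a y) *m g0 a y)
     - d%:R * (vol g0 a y / vol g1 a y) `^ (2 / d%:R)) * vol g1 a y).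

Definition KLMet (g0 g1 : tensor) : R :=
  2 / d%:R * KL (vol g0) (vol g1) + Dshape g0 g1.

End Manifold.

(* Main.v *)
Require Import Defs.
From HB Require Import structures.
From mathcomp Require Import all_boot all_order all_algebra.
From mathcomp Require Import all_classical all_reals all_analysis.
From mathcomp Require Import ring lra.
Set Implicit Arguments.
Unset Strict Implicit.
Unset Printing Implicit Defensive.
Import Order.TTheory GRing.Theory Num.Theory.
Import numFieldNormedType.Exports.
Local Open Scope classical_set_scope.
Local Open Scope ring_scope.

(* All integrals are taken in a fixed smooth partition of unity, so that each
   functional is a finite sum of integrals over compact subsets of charts of
   [chi (y) * F (g0 (y), g1 (y))] for one function [F] of two matrices of positive
   determinant.  [F] is a smooth expression in [ln det A], [ln det B] and
   [tr (B^-1 A)]; differentiation passes under the integral sign by the mean value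
   theorem and uniform continuity on compact sets.

   Pointwise, Cholesky factorization replaces [B^-1 A] by a positive definite [S],
   and [ln det S <= tr S - n], with equality only at the identity, follows by
   induction on Schur complements; rescaling [S] gives [tr S >= n (det S)^(1/n)].
   Hence both summands of [F] are nonnegative and vanish together only for
   [A = B].  The induced metric is the mixed second derivative of [F] on the
   diagonal.  Finally the shape term is nonnegative and vanishes on conformal
   pairs, and every density is the volume of a metric conformal to a fixed one,
   so the infimum over the fibres is attained and equals [2 / d * KL]. *)

(** * Calculus of functions of class C^k *)

(** The weight [2 / d] is what makes the induced metric a multiple of the Ebin metric. At [(G, G)]
    the Kullback-Leibler term contributes [- (2 d)^-1 tr (G^-1 H) tr (G^-1 K)] times the volume to
    the mixed second derivative; the power of the volume ratio in the shape term contributes the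
    opposite, and only [- 2^-1 tr (G^-1 H G^-1 K)] times the volume survives. The demanding clause
    is smoothness: every iterated derivative must be jointly continuous in the base point and the
    directions. Hence the central estimate is uniform over a compact set and allows arbitrary small
    perturbations of the pointwise values, not only those along a line. Square roots and powers of
    determinants are written as exponentials of multiples of [ln det], smooth wherever the
    determinants are positive. That condition is open on pairs of arbitrary matrices; positive
    definiteness, which includes symmetry, supplies the positive determinants, the signs and the
    equality case. *)

Section CkCalculus.
Context {R : realType}.
Implicit Types V W : normedModType R.

(** [g] is [f + z] with [z] vanishing near [x]; the zero map is a differential of [z] at [x], and
    differentiability is additive. *)
Lemma near_eq_differentiable V W (f g : V -> W) (x : V) :
  {near x, f =1 g} -> differentiable f x -> differentiable g x.
Proof.
move=> fg df.
pose z : V -> W := g - f.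
have gE : g = f + z by rewrite /z addrC subrK.
rewrite gE; apply: differentiableD => //.
have zx : z x = 0.
  by rewrite /z !fctE /=; have /= -> := nbhs_singleton fg; rewrite subrr.
have zo : z \o shift x = cst (z x) + (\0 : V -> W) +o_ (0 : V) id.
  apply/eqaddoP => _/posnumP[e].
  have fg0 : \forall y \near (0 : V), f (y + x) = g (y + x).
    by have := fg; rewrite /= (near_shift 0 x); apply: filterS => y /=; rewrite subr0.
  apply: filterS fg0 => y fgy /=.
  rewrite (_ : (_ - _) y = 0) ?normr0 ?mulr_ge0//.
  change (z (y + x) - (z x + 0) = 0).
  by rewrite zx addr0 subr0 /z !fctE /= fgy subrr.
have dz : 'd z x = \0 :> (V -> W).
  by apply: diff_unique zo => y; apply: cvg_cst.
apply/diff_locallyP; rewrite dz; split => //.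
by move=> y; apply: cvg_cst.
Qed.

Lemma Ck_onS V W n (U : set V) (f : V -> W) : Ck_on n.+1 U f -> Ck_on n U f.
Proof.
elim: n f => [f [df _] x Ux|n ih f [df Df]].
  exact/differentiable_continuous/df.
by split => // v; apply: ih; apply: Df.
Qed.

(** Regularity is local. The model [g] need be regular only at the point [x], because equality near
    [x] is equality near every point close to [x] and so passes to directional derivatives. This
    serves for functions defined by cases, such as bumps extended by zero. *)
Lemma Ck_on_near V W n (U : set V) (f : V -> W) :
  (forall x, U x -> exists2 g, {near x, f =1 g} & Ck_on n [set x] g) ->
  Ck_on n U f.
Proof.
elim: n f => [f H x Ux|n ih f H].
  have [g fg /(_ x erefl) cg] := H x Ux.
  rewrite /prop_for /continuous_at; have /= -> := nbhs_singleton fg.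
  apply: cvg_trans cg; apply: near_eq_cvg.
  by apply: filterS fg.
split=> [x Ux|v].
  have [g fg [/(_ x erefl) dg _]] := H x Ux.
  by apply: near_eq_differentiable dg; apply: filterS fg.
apply: ih => x Ux; have [g fg [_ Dg]] := H x Ux.
exists (fun y => 'D_v g y); last exact: Dg.
have := near_join fg; apply: filterS => y fgy; exact: near_eq_derive.
Qed.

Lemma Ck_on_subset V W n (U U' : set V) (f : V -> W) :
  U' `<=` U -> Ck_on n U f -> Ck_on n U' f.
Proof.
move=> UU; elim: n f => [f cf x /UU/cf//|n ih f [df Df]].
by split=> [x /UU/df//|v]; apply/ih/Df.
Qed.

Lemma Ck_on_ext V W n (U : set V) (f g : V -> W) : open U ->
  {in U, f =1 g} -> Ck_on n U f -> Ck_on n U g.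
Proof.
move=> oU fg Cf; apply: Ck_on_near => x Ux; exists f.
  have : \near x, U x by exact: open_nbhs_nbhs.
  by apply: filterS => y Uy; rewrite fg ?inE.
by apply: Ck_on_subset Cf => _ ->.
Qed.

Lemma Ck_on_cst V W n (U : set V) (w : W) : Ck_on n U (fun=> w).
Proof.
elim: n w => [w x _|n ih w]; first exact: cvg_cst.
split=> [x _|v]; first exact: differentiable_cst.
rewrite (_ : 'D_v _ = fun=> 0) //.
by apply/funext => x; rewrite derive_cst.
Qed.

Lemma Ck_on_linear V W n (U : set V) (f : {linear V -> W}) :
  continuous f -> Ck_on n U f.
Proof.
case: n => [cf x _|n cf]; first exact: cf.
split=> [x _|v]; first exact: linear_differentiable.
rewrite (_ : 'D_v _ = fun=> f v); first exact: Ck_on_cst.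
apply/funext => x; rewrite deriveE; last exact: linear_differentiable.
by rewrite diff_lin.
Qed.

Lemma Ck_on_id V n (U : set V) : Ck_on n U (fun x : V => x).
Proof.
case: n => [x _|n]; first exact: cvg_id.
split=> [x _|v]; first exact: ex_diff.
rewrite (_ : 'D_v _ = fun=> v); first exact: Ck_on_cst.
by apply/funext => x; rewrite derive_id.
Qed.

Lemma Ck_onD V W n (U : set V) (f g : V -> W) : open U ->
  Ck_on n U f -> Ck_on n U g -> Ck_on n U (fun x => f x + g x).
Proof.
move=> oU; elim: n f g => [f g cf cg x Ux|n ih f g [df Df] [dg Dg]].
  by apply: continuousD; [exact: cf|exact: cg].
split=> [x Ux|v]; first by apply: differentiableD; [exact: df|exact: dg].
apply: (@Ck_on_ext _ _ _ _ (fun x => 'D_v f x + 'D_v g x)) => //; last first.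
  by apply: ih; [exact: Df|exact: Dg].
move=> x /set_mem Ux; rewrite -deriveD //; apply: diff_derivable; auto.
Qed.

Lemma Ck_onM V n (U : set V) (f g : V -> R) : open U ->
  Ck_on n U f -> Ck_on n U g -> Ck_on n U (fun x => f x * g x).
Proof.
move=> oU; elim: n f g => [f g cf cg x Ux|n ih f g Cf Cg].
  by apply: continuousM; [exact: cf|exact: cg].
have [df Df] := Cf; have [dg Dg] := Cg.
split=> [x Ux|v]; first by apply: differentiableM; [exact: df|exact: dg].
apply: (@Ck_on_ext _ _ _ _ (fun x => f x * 'D_v g x + g x * 'D_v f x)) => //.
  move=> x /set_mem Ux; rewrite -deriveM //; apply: diff_derivable; auto.
by apply: Ck_onD => //; apply: ih; (exact: Ck_onS || exact: Df || exact: Dg).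
Qed.

Lemma Ck_onN V n (U : set V) (f : V -> R) : open U ->
  Ck_on n U f -> Ck_on n U (fun x => - f x).
Proof.
move=> oU Cf; rewrite (_ : (fun x => _) = fun x => (-1) * f x); last first.
  by apply/funext => x; rewrite mulN1r.
by apply: Ck_onM => //; apply: Ck_on_cst.
Qed.

Lemma Ck_on_sum V W n (U : set V) (I : Type) (s : seq I) (P : pred I)
    (f : I -> V -> W) : open U ->
  (forall i, P i -> Ck_on n U (f i)) ->
  Ck_on n U (fun x => \sum_(i <- s | P i) f i x).
Proof.
move=> oU Cf; elim: s => [|i s ih].
  rewrite (_ : (fun x => _) = fun=> 0); first exact: Ck_on_cst.
  by apply/funext => x; rewrite big_nil.
rewrite (_ : (fun x => _) = fun x => (if P i then f i x else 0) +
   \sum_(j <- s | P j) f j x); last first.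
  by apply/funext => x; rewrite big_cons; case: ifP; rewrite ?add0r.
apply: Ck_onD => //; case: (boolP (P i)) => [/Cf//|_].
exact: Ck_on_cst.
Qed.

Lemma Ck_on_prod V n (U : set V) (I : Type) (s : seq I) (P : pred I)
    (f : I -> V -> R) : open U ->
  (forall i, P i -> Ck_on n U (f i)) ->
  Ck_on n U (fun x => \prod_(i <- s | P i) f i x).
Proof.
move=> oU Cf; elim: s => [|i s ih].
  rewrite (_ : (fun x => _) = fun=> 1); first exact: Ck_on_cst.
  by apply/funext => x; rewrite big_nil.
rewrite (_ : (fun x => _) = fun x => (if P i then f i x else 1) *
   \prod_(j <- s | P j) f j x); last first.
  by apply/funext => x; rewrite big_cons; case: ifP; rewrite ?mul1r.
apply: Ck_onM => //; case: (boolP (P i)) => [/Cf//|_].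
exact: Ck_on_cst.
Qed.

Lemma derive1_scale (f : R -> R) (x v : R) : differentiable f x ->
  'D_v f x = v * 'D_1 f x.
Proof.
move=> df; by rewrite !deriveE // -[v in LHS]mulr1; exact: linearZ.
Qed.

(** A known formula for the derivative raises the class by one; the exponential, the inverse, the
    logarithm and the flat functions are all treated this way. *)
Lemma Ck_on_real n (O : set R) (g dg : R -> R) : open O ->
  (forall x, O x -> is_derive x 1 g (dg x)) -> Ck_on n O dg -> Ck_on n.+1 O g.
Proof.
move=> oO gdg Cdg.
have diffg x : O x -> differentiable g x.
  by move=> Ox; apply/derivable1_diffP; case: (gdg x Ox).
split=> // v; apply: (@Ck_on_ext _ _ _ _ (fun x => v * dg x)) => //.
  move=> x /set_mem Ox; rewrite derive1_scale; last exact: diffg.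
  by case: (gdg x Ox) => _ ->.
by apply: Ck_onM => //; apply: Ck_on_cst.
Qed.

Lemma Ck_on_comp V n (U : set V) (O : set R) (f : V -> R) (g : R -> R) :
  open U -> (forall x, U x -> O (f x)) ->
  Ck_on n U f -> Ck_on n O g -> Ck_on n U (fun x => g (f x)).
Proof.
move=> oU UO; elim: n g => [g cf cg x Ux|n ih g Cf Cg].
  by apply: continuous_comp; [exact: cf|exact/cg/UO].
have [df Df] := Cf; have [dg Dg] := Cg.
split=> [x Ux|v].
  by apply: differentiable_comp; [exact: df|exact/dg/UO].
apply: (@Ck_on_ext _ _ _ _ (fun x => 'D_1 g (f x) * 'D_v f x)) => //.
  move=> x /set_mem Ux; have dfx := df x Ux; have dgx := dg _ (UO x Ux).
  rewrite [RHS]deriveE; last exact: differentiable_comp.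
  rewrite diff_comp //= -deriveE // -(deriveE _ dfx).
  by rewrite mulrC; exact/esym/derive1_scale.
by apply: Ck_onM => //; [apply: (ih ('D_1 g)); [exact: Ck_onS|exact: Dg]|exact: Df].
Qed.

Lemma diff_rVE m W (f : 'rV[R]_m -> W) x v : differentiable f x ->
  'd f x v = \sum_i v 0 i *: 'D_(delta_mx 0 i) f x.
Proof.
move=> df; rewrite {1}(row_sum_delta v) linear_sum /=.
by apply: eq_bigr => i _; rewrite linearZ deriveE.
Qed.

Lemma differentiable_mx V m n (f : V -> 'M[R]_(m, n)) x :
  (forall i j, differentiable (fun x => f x i j) x) -> differentiable f x.
Proof.
move=> df.
rewrite (_ : f = \sum_(i < m) \sum_(j < n) (fun x => f x i j *: delta_mx i j));
  last first.
  apply/funext => y; rewrite fct_sumE [LHS]matrix_sum_delta.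
  by apply: eq_bigr => i _; rewrite fct_sumE.
apply: differentiable_sum => i; apply: differentiable_sum => j.
by apply: differentiableZl.
Qed.

Lemma Ck_on_mx V m n k (U : set V) (f : V -> 'M[R]_(m, n)) : open U ->
  Ck_on k U f <-> (forall i j, Ck_on k U (fun x => f x i j)).
Proof.
move=> oU; split.
  elim: k f => [f cf i j x Ux|k ih f [df Df] i j].
    apply: (@continuous_comp _ _ _ f (fun M : 'M[R]_(m, n) => M i j)).
      exact: cf.
    exact: coord_continuous.
  have dfij x : U x -> differentiable (fun x => f x i j) x.
    move=> Ux; apply: (@differentiable_comp _ _ _ _ f (fun M : 'M[R]_(m, n) => M i j)).
      exact: df.
    exact: differentiable_coord.
  split=> // v.
  apply: (@Ck_on_ext _ _ _ _ (fun x => 'D_v f x i j)) => //.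
    move=> x /set_mem Ux; rewrite derive_mx ?mxE//.
    exact/diff_derivable/df.
  exact/ih/Df.
elim: k f => [f cf x Ux|k ih f Cf].
  apply/cvg_ballP => e e0; near=> y; split => // i j.
  move: i j; near: y; apply: filter_forall => i; apply: filter_forall => j.
  have := cf i j x Ux; move/cvg_ballP; exact.
split=> [x Ux|v].
  by apply: differentiable_mx => i j; have [/(_ x Ux)] := Cf i j.
apply: ih => i j; have [_ Df] := Cf i j.
apply: (@Ck_on_ext _ _ _ _ (fun x => 'D_v (fun x => f x i j) x)) => //; last exact: Df.
move=> x /set_mem Ux; rewrite derive_mx ?mxE//.
by apply/diff_derivable/differentiable_mx => i' j'; have [/(_ x Ux)] := Cf i' j'.
Unshelve. all: by end_near. Qed.

(** The direction ['D_v f x] in which [g] gets differentiated varies with [x]; expanding it in the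
    standard basis turns the chain rule into a sum of products to which the induction applies. *)
Lemma Ck_on_comp_rV V m n (U : set V) (O : set 'rV[R]_m) (f : V -> 'rV[R]_m)
    (g : 'rV[R]_m -> R) :
  open U -> (forall x, U x -> O (f x)) ->
  Ck_on n U f -> Ck_on n O g -> Ck_on n U (fun x => g (f x)).
Proof.
move=> oU UO; elim: n g => [g cf cg x Ux|n ih g Cf Cg].
  by apply: continuous_comp; [exact: cf|exact/cg/UO].
have [df Df] := Cf; have [dg Dg] := Cg.
split=> [x Ux|v].
  by apply: differentiable_comp; [exact: df|exact/dg/UO].
apply: (@Ck_on_ext _ _ _ _
  (fun x => \sum_i ('D_v f x) 0 i * 'D_(delta_mx 0 i) g (f x))) => //.
  move=> x /set_mem Ux; have dfx := df x Ux; have dgx := dg _ (UO x Ux).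
  rewrite [RHS]deriveE; last exact: differentiable_comp.
  by rewrite diff_comp //= diff_rVE // -(deriveE _ dfx).
apply: Ck_on_sum => // i _; apply: Ck_onM => //; last first.
  by apply: (ih ('D_(delta_mx 0 i) g)); [exact: Ck_onS | exact: Dg].
exact: (iffLR (Ck_on_mx n ('D_v f) oU) (Df v)).
Qed.

Lemma Ck_on_det V m n (U : set V) (f : V -> 'M[R]_m) : open U ->
  (forall i j, Ck_on n U (fun x => f x i j)) ->
  Ck_on n U (fun x => \det (f x)).
Proof.
move=> oU Cf; apply: Ck_on_sum => // s _; apply: Ck_onM => //.
  exact: Ck_on_cst.
exact: Ck_on_prod.
Qed.

Lemma Ck_on_expR n O : Ck_on n O (@expR R).
Proof.
suff : Ck_on n setT (@expR R) by apply: Ck_on_subset.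
elim: n => [x _|n ih]; first exact: continuous_expR.
by apply: (@Ck_on_real _ _ _ expR) => //; exact: openT.
Qed.

Lemma Ck_on_inv n (O : set R) : O `<=` [set x | x != 0] ->
  Ck_on n O (fun x : R => x^-1).
Proof.
move=> ON; apply: Ck_on_subset ON _.
have oO : open [set x : R | x != 0] by exact: open_neq.
elim: n => [x x0|n ih]; first exact: inv_continuous.
apply: (@Ck_on_real _ _ _ (fun x => - (x^-1 * x^-1))) => // [x x0|].
  apply: (is_derive_eq (@is_deriveV R id x 1 1 x0 _)).
  by rewrite /GRing.scale /= mulr1 expr2 invfM.
by apply: Ck_onN => //; apply: Ck_onM.
Qed.

Lemma Ck_on_ln n (O : set R) : O `<=` [set x | 0 < x] ->
  Ck_on n O (@ln R).
Proof.
move=> ON; apply: Ck_on_subset ON _.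
case: n => [x x0|n]; first exact: continuous_ln.
apply: (@Ck_on_real _ _ _ (fun x => x^-1)) => //.
by apply: Ck_on_inv => x /= x0; rewrite gt_eqF.
Qed.

End CkCalculus.

(** * Integrals of compactly supported continuous functions *)

Section EuclideanIntegral.
Context {R : realType}.

Lemma mx_norm_le m n (A : 'M[R]_(m, n)) (c : R) : 0 <= c ->
  (`|A| <= c) <-> (forall i j, `|A i j| <= c).
Proof.
move=> c0; rewrite {1}/Num.Def.normr /= mx_normrE; split=> [Ac i j|Ac].
  exact: le_trans (le_bigmax _ (fun ij : 'I_m * 'I_n => `|A ij.1 ij.2|) (i, j)) Ac.
by apply: bigmax_le => // -[i j] _; exact: Ac.
Qed.

Lemma rV_ball_compact n (c : 'rV[R]_n) (r : R) :
  compact [set y : 'rV[R]_n | `|y - c| <= r].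
Proof.
apply: bounded_closed_compact.
  exists (r + `|c|); split; first exact: num_real.
  move=> B rB y /= yr; rewrite -[y](subrK c) (le_trans (ler_normD _ _)) //.
  by apply: ltW; apply: le_lt_trans rB; rewrite lerD2r.
rewrite (_ : mkset _ = (fun y => `|y - c|) @^-1` [set z : R | z <= r]) //.
apply: preimage_closed; last exact: closed_le.
move=> y _; suff : {for y, continuous (fun y : 'rV[R]_n => `|y - c|)} by [].
apply: (@continuous_comp _ _ _ (fun y : 'rV[R]_n => y - c) (fun z : 'rV[R]_n => `|z|)).
  by apply: continuousB; [exact: cvg_id|exact: cst_continuous].
exact: norm_continuous.
Qed.

Lemma row_mx_norm e (x : R) (y : 'rV[R]_e) (c : R) : 0 <= c ->
  (`|row_mx (x%:M : 'rV[R]_1) y : 'rV[R]_(1 + e)| <= c) <-> (`|x| <= c /\ `|y| <= c).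
Proof.
move=> c0; split=> [/(mx_norm_le _ c0) H|[xc /(mx_norm_le _ c0) yc]].
  split; first by have := H 0 (lshift e 0); rewrite row_mxEl mxE eqxx mulr1n.
  by apply/(mx_norm_le _ c0) => i j; have := H i (rshift 1 j); rewrite row_mxEr.
apply/(mx_norm_le _ c0) => i j; rewrite !mxE; case: split_ordP => k _ //.
by rewrite mxE !ord1 eqxx mulr1n.
Qed.

Lemma row_mx_cvg e (x : R) (y : 'rV[R]_e) :
  {for (x, y), continuous (fun p : R * 'rV[R]_e =>
     row_mx (p.1%:M : 'rV[R]_1) p.2 : 'rV[R]_(1 + e))}.
Proof.
apply/cvgrPdist_le => eps eps0 /=.
have : \forall p \near (x, y), `|(x, y) - p| <= eps.
  by apply: (@cvgr_dist_le _ _ _ (nbhs (x, y)) _ id (x, y)) => //; exact: cvg_id.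
apply: filterS => -[x' y']; rewrite prod_normE /= ge_max => /andP[xx yy].
by rewrite opp_row_mx add_row_mx -raddfB; apply/row_mx_norm => //; exact: ltW.
Qed.

(** Compact support is recorded by a radius in the sup norm. All slices share this radius, and one
    constant can bound the integrals of all functions with the same [r]. *)
Definition compact_cont d (r : R) (f : 'rV[R]_d -> R) :=
  continuous f /\ forall y, r < `|y| -> f y = 0.

Lemma compact_cont_slice e r (f : 'rV[R]_e.+1 -> R) (x : R) :
  compact_cont r f ->
  compact_cont r (fun y : 'rV[R]_e =>
    f (row_mx (x%:M : 'rV[R]_1) y : 'rV[R]_(1 + e))).
Proof.
move=> [cf f0]; split=> [y|y ry]; last first.
  apply: f0; rewrite real_ltNge ?num_real //; apply/negP => le_r.
  have r0 : 0 <= r by apply: le_trans le_r.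
  have [_] := iffLR (row_mx_norm x y r0) le_r.
  by rewrite leNgt ry.
apply: (@continuous_comp _ _ _ (fun y : 'rV[R]_e =>
  row_mx (x%:M : 'rV[R]_1) y : 'rV[R]_e.+1) f); last exact: cf.
apply: (@continuous_comp _ _ _ (fun y : 'rV[R]_e => (x, y))
  (fun p : R * 'rV[R]_e => row_mx (p.1%:M : 'rV[R]_1) p.2 : 'rV[R]_(1 + e))).
  move=> A [[/= P Q] [/= Px Qy] PQ]; apply: filterS Qy => z Qz.
  by apply: PQ; split => //=; exact: nbhs_singleton Px.
exact: row_mx_cvg.
Qed.

Lemma compact_cont_comb d r (a : R) (f g : 'rV[R]_d -> R) :
  compact_cont r f -> compact_cont r g ->
  compact_cont r (fun y => a * f y + g y).
Proof.
move=> [cf f0] [cg g0]; split=> [y|y ry].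
  suff : {for y, continuous (fun y => a * f y + g y)} by [].
  by apply: continuousD; [apply: continuousM; [exact: cst_continuous|exact: cf]|exact:
    cg].
by rewrite f0 // g0 // mulr0 addr0.
Qed.

Definition line_cont (r : R) (F : R -> R) :=
  continuous F /\ forall x, r < `|x| -> F x = 0.

Notation mu := (@lebesgue_measure R).

Lemma line_cont_integrable r F : line_cont r F ->
  mu.-integrable `[- r, r] (EFin \o F).
Proof.
move=> [cF _]; apply: continuous_compact_integrable.
  exact: segment_compact.
exact: continuous_subspaceT.
Qed.

Lemma line_cont_integral r F : line_cont r F ->
  \int[mu]_x F x = \int[mu]_(x in `[- r, r]) F x.
Proof.
move=> [_ F0]; rewrite [RHS]Rintegral_mkcond; congr (Rintegral _ _ _).
apply/funext => x; rewrite patchE; case: ifPn => // /negP nx.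
apply: F0; rewrite real_ltNge ?num_real //; apply/negP => xr; apply: nx.
by rewrite inE /= in_itv /= -ler_norml.
Qed.

Lemma line_cont_integral_lin r a F G : line_cont r F -> line_cont r G ->
  \int[mu]_x (a * F x + G x) = a * \int[mu]_x F x + \int[mu]_x G x.
Proof.
move=> cF cG.
have cFG : line_cont r (fun x => a * F x + G x).
  case: cF => cF F0; case: cG => cG G0; split=> [x|x rx].
    suff : {for x, continuous (fun x => a * F x + G x)} by [].
    by apply: continuousD; [apply: continuousM; [exact: cst_continuous|exact:
      cF]|exact: cG].
  by rewrite F0 // G0 // mulr0 addr0.
have iF := line_cont_integrable cF.
rewrite (line_cont_integral cFG) (line_cont_integral cF) (line_cont_integral cG).
rewrite RintegralD //; last first.
- exact: line_cont_integrable.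
- exact: (integrableZl _ a iF).
by rewrite RintegralZl.
Qed.

Lemma line_cont_integral_bound r F C : line_cont r F -> (forall x, `|F x| <= C) ->
  `|\int[mu]_x F x| <= fine (mu `[- r, r]) * C.
Proof.
move=> cF FC; rewrite (line_cont_integral cF).
have iF := line_cont_integrable cF.
apply: le_trans (le_normr_Rintegral _ iF) _ => //.
rewrite mulrC -Rintegral_cst //; apply: le_Rintegral => //.
  exact: (integrable_norm iF).
apply: continuous_compact_integrable; first exact: segment_compact.
by apply: continuous_subspaceT => x; exact: cvg_cst.
Qed.

(** If [F x0] were positive, continuity would keep [F] above [F x0 / 2] on an interval of length
    [2 e], and the integral would be at least [e * F x0]. *)
Lemma line_cont_integral_eq0 r F : line_cont r F -> (forall x, 0 <= F x) ->
  \int[mu]_x F x = 0 -> forall x, F x = 0.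
Proof.
move=> [cF F0] Fge0 iF0 x0; apply/eqP; rewrite eq_le Fge0 andbT leNgt.
apply/negP => Fx0.
have [e e0 Fe] : exists2 e : R, 0 < e & forall x, `|x0 - x| <= e -> F x0 / 2 <= F x.
  have F2 : 0 < F x0 / 2 by rewrite divr_gt0.
  have /cvgrPdist_le/(_ _ F2)/nbhs_ballP[e /= e0 He] := cF x0.
  exists (e / 2); first by rewrite divr_gt0.
  move=> x xe; have /He /= : ball x0 e x.
    by apply: le_lt_trans xe _; rewrite ltr_pdivrMr // ltr_pMr // ltr1n.
  by rewrite ler_distlC => /andP[+ _]; rewrite {1}(splitr (F x0)) addrK.
(* The segment of integration is enlarged so as to contain the whole interval around [x0]. *)
pose r' := Num.max r (`|x0| + e).
have cF' : line_cont r' F.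
  by split=> // x; rewrite gt_max => /andP[rx _]; exact: F0.
pose J := `[x0 - e, x0 + e]%classic : set R.
have JA : J `<=` `[- r', r'].
  move=> x; rewrite /J /= !in_itv /= -!ler_norml => xe.
  rewrite /r' le_max; apply/orP; right.
  rewrite -ler_distl in xe.
  by rewrite -[x](subrK x0) (le_trans (ler_normD _ _)) // addrC lerD.
have iA := line_cont_integrable cF'.
have mJ : measurable J by exact: measurable_itv.
have mA : measurable (`[- r', r']%classic : set R) by exact: measurable_itv.
have iJ : mu.-integrable J (EFin \o F) by exact: integrableS iA.
have : F x0 / 2 * (2 * e) <= \int[mu]_(x in J) F x.
  have -> : 2 * e = fine (mu J).
    rewrite /J lebesgue_measure_itv /= lte_fin ltrBlDr -addrA ltrDl addr_gt0 //.
    by rewrite -EFinD /=; ring.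
  rewrite -Rintegral_cst //; apply: le_Rintegral => //.
    apply: continuous_compact_integrable; first exact: segment_compact.
    by apply: continuous_subspaceT => x; exact: cvg_cst.
  move=> x; rewrite /J /= in_itv /= => xJ; apply: Fe.
  by rewrite distrC ler_distl.
have : \int[mu]_(x in J) F x <= 0.
  rewrite -iF0 (line_cont_integral cF').
  have AE : `[- r', r']%classic = J `|` (`[- r', r'] `\` J) :> set R.
    by rewrite setDE setUIr setUv setIT; apply/esym/setUidr.
  rewrite AE Rintegral_setU //; last first.
  - by apply/disj_setPS => x [] ? [].
  - by rewrite -AE.
  - exact: measurableD.
  by rewrite lerDl; exact: Rintegral_ge0.
move=> H1 H2; have := le_trans H2 H1; apply/negP; rewrite -ltNge.
by rewrite mulr_gt0 ?divr_gt0 ?mulr_gt0.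
Qed.

(** The assumptions are linearity and boundedness in dimension [e], available by induction in the
    next lemma. On the compact ball the slice at [x] is uniformly close to the slice at [x0];
    linearity and the bound then bring their integrals close. *)
Lemma euclidean_integral_slice_cont e r (f : 'rV[R]_e.+1 -> R) (B : R) :
  (forall a (f g : 'rV[R]_e -> R), compact_cont r f -> compact_cont r g ->
    euclidean_integral (fun y => a * f y + g y) =
    a * euclidean_integral f + euclidean_integral g) ->
  0 <= B ->
  (forall (f : 'rV[R]_e -> R) (C : R), compact_cont r f -> (forall y, `|f y| <= C) ->
    `|euclidean_integral f| <= B * C) ->
  compact_cont r f ->
  line_cont r (fun x => euclidean_integral
    (fun y : 'rV[R]_e => f (row_mx (x%:M : 'rV[R]_1) y : 'rV[R]_(1 + e)))).
Proof.
move=> lin B0 bnd cf; have [ctf f0] := cf; split=> [x0|x rx]; last first.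
  suff : `|euclidean_integral (fun y : 'rV[R]_e =>
      f (row_mx (x%:M : 'rV[R]_1) y : 'rV[R]_(1 + e)))| <= B * 0.
    by rewrite mulr0 normr_le0 => /eqP.
  apply: bnd; first exact: compact_cont_slice.
  move=> y; rewrite f0 ?normr0 // real_ltNge ?num_real //; apply/negP => le_r.
  have r0 : 0 <= r by apply: le_trans le_r.
  have [+ _] := iffLR (row_mx_norm x y r0) le_r.
  by rewrite leNgt rx.
apply/cvgrPdist_le => eps eps0.
(* [B] may be 0, hence the division of [eps] by [B + 1]. *)
have B1 : 0 < B + 1 by rewrite ltr_wpDl.
have eB : 0 < eps / (B + 1) by rewrite divr_gt0.
pose K := [set y : 'rV[R]_e | `|y| <= r].
have cK : compact K.
  rewrite (_ : K = [set y | `|y - 0| <= r]); first exact: rV_ball_compact.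
  by apply/seteqP; split=> y /=; rewrite subr0.
have near_K : \forall x \near x0, forall y, K y ->
   `|f (row_mx (x0%:M : 'rV[R]_1) y : 'rV[R]_(1 + e)) -
     f (row_mx (x%:M : 'rV[R]_1) y : 'rV[R]_(1 + e))| <= eps / (B + 1).
  have H := iffLR (compact_near_coveringP K) cK _ (nbhs x0) (fun x y =>
   `|f (row_mx (x0%:M : 'rV[R]_1) y : 'rV[R]_(1 + e)) -
     f (row_mx (x%:M : 'rV[R]_1) y : 'rV[R]_(1 + e))| <= eps / (B + 1)).
  apply: H => y Ky.
  have e2 : 0 < eps / (B + 1) / 2 by rewrite divr_gt0.
  have cfy : {for (x0, y), continuous (fun p : R * 'rV[R]_e =>
     f (row_mx (p.1%:M : 'rV[R]_1) p.2 : 'rV[R]_(1 + e)))}.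
    apply: (@continuous_comp _ _ _ (fun p : R * 'rV[R]_e =>
     row_mx (p.1%:M : 'rV[R]_1) p.2 : 'rV[R]_(1 + e)) f); first exact: row_mx_cvg.
    exact: ctf.
  have /cvgrPdist_le/(_ _ e2) [[/= P Q] [/= Px Qy] PQ] := cfy.
  exists (Q, P) => // -[/= y' x'] [Qy' Px'].
  have := PQ (x', y') (conj Px' Qy').
  have := PQ (x0, y') (conj (nbhs_singleton Px) Qy') => /= H1 H2.
  rewrite [leRHS]splitr -[X in `|X|](subrKA (f (row_mx
    (x0%:M : 'rV[R]_1) y : 'rV[R]_(1 + e)))).
  by rewrite (le_trans (ler_normD _ _)) // lerD // distrC.
apply: filterS near_K => x Hx.
have cx0 := compact_cont_slice x0 cf; have cx := compact_cont_slice x cf.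
rewrite -mulN1r addrC -lin //.
apply: le_trans (bnd _ (eps / (B + 1)) _ _) _.
- exact: compact_cont_comb.
- move=> y; rewrite mulN1r addrC; have [yr|yr] := leP `|y| r; first exact: Hx.
  by case: cx => _ -> //; case: cx0 => _ -> //; rewrite subrr normr0 ltW.
by rewrite mulrCA -[leRHS]mulr1 ler_pM2l // ler_pdivrMr // mul1r lerDl.
Qed.

(** The two properties are proved together: each passes to the next dimension through the continuity
    of the integrated slices, which takes both. *)
Lemma euclidean_integral_lin_bound d (r : R) :
  (forall a (f g : 'rV[R]_d -> R), compact_cont r f -> compact_cont r g ->
    euclidean_integral (fun y => a * f y + g y) =
    a * euclidean_integral f + euclidean_integral g) /\
  exists2 B : R, 0 <= B &
  (forall (f : 'rV[R]_d -> R) (C : R), compact_cont r f -> (forall y, `|f y| <= C) ->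
    `|euclidean_integral f| <= B * C).
Proof.
elim: d => [|e [lin [B B0 bnd]]].
  by split=> //; exists 1 => // f C _ fC /=; rewrite mul1r.
have sl f := euclidean_integral_slice_cont (f := f) lin B0 bnd.
split=> [a f g cf cg|].
  rewrite /= -(line_cont_integral_lin a (sl _ cf) (sl _ cg)).
  apply: eq_Rintegral => x _; apply: lin; exact: compact_cont_slice.
exists (fine (mu `[- r, r]) * B).
  by rewrite mulr_ge0 // fine_ge0.
move=> f C cf fC /=; rewrite -mulrA.
apply: line_cont_integral_bound; first exact: sl.
by move=> x; apply: bnd => //; exact: compact_cont_slice.
Qed.

Lemma euclidean_integral_lin d (r a : R) (f g : 'rV[R]_d -> R) :
  compact_cont r f -> compact_cont r g ->
  euclidean_integral (fun y => a * f y + g y) =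
  a * euclidean_integral f + euclidean_integral g.
Proof. by have [+ _] := euclidean_integral_lin_bound d r; exact. Qed.

Lemma euclidean_integral_bound d (r : R) : exists2 B : R, 0 <= B &
  (forall (f : 'rV[R]_d -> R) (C : R), compact_cont r f -> (forall y, `|f y| <= C) ->
    `|euclidean_integral f| <= B * C).
Proof. by have [_] := euclidean_integral_lin_bound d r. Qed.

Lemma euclidean_integral_ge0 d (f : 'rV[R]_d -> R) :
  (forall y, 0 <= f y) -> 0 <= euclidean_integral f.
Proof.
elim: d f => [f f0|e ih f f0]; first exact: f0.
by apply: Rintegral_ge0 => x _; exact: ih.
Qed.

(** The integral of a slice is a continuous nonnegative function of the outer variable, so it
    vanishes for every slice, and the induction applies to the slice through [y]. *)
Lemma euclidean_integral_eq0 d r (f : 'rV[R]_d -> R) :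
  compact_cont r f -> (forall y, 0 <= f y) -> euclidean_integral f = 0 ->
  forall y, f y = 0.
Proof.
elim: d f => [f cf f0 + y|e ih f cf f0 if0 y]; first by rewrite (thinmx0 y).
have [lin [B B0 bnd]] := euclidean_integral_lin_bound e r.
have sl := euclidean_integral_slice_cont lin B0 bnd cf.
have Fx := line_cont_integral_eq0 sl
  (fun x => euclidean_integral_ge0 (fun y => f0 _)) if0.
pose y' : 'rV[R]_(1 + e) := y.
have := ih _ (compact_cont_slice (lsubmx y' 0 0) cf) (fun y => f0 _) (Fx _) (rsubmx y').
by rewrite -mx11_scalar hsubmxK.
Qed.

End EuclideanIntegral.

(** * Determinants, traces and positive definite matrices *)

Section MatrixCalculus.
Context {R : realType}.

Lemma Ck_on_mulmx (V : normedModType R) k (U : set V) m n p (f : V -> 'M[R]_(m, n))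
    (g : V -> 'M[R]_(n, p)) : open U ->
  Ck_on k U f -> Ck_on k U g -> Ck_on k U (fun x => f x *m g x).
Proof.
move=> oU /(Ck_on_mx _ _ oU) Cf /(Ck_on_mx _ _ oU) Cg; apply/Ck_on_mx => // i j.
rewrite (_ : (fun x => _) = fun x => \sum_l f x i l * g x l j); last first.
  by apply/funext => x; rewrite mxE.
by apply: Ck_on_sum => // l _; exact: Ck_onM.
Qed.

Lemma Ck_on_tr (V : normedModType R) k (U : set V) n (f : V -> 'M[R]_n) : open U ->
  Ck_on k U f -> Ck_on k U (fun x => \tr (f x)).
Proof.
by move=> oU /(Ck_on_mx _ _ oU) Cf; apply: Ck_on_sum => // i _; exact: Cf.
Qed.

(** Cramer's rule: an entry of the inverse is a cofactor divided by the determinant. *)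
Lemma Ck_on_invmx (V : normedModType R) k (U : set V) n (f : V -> 'M[R]_n) :
  open U -> (forall x, U x -> \det (f x) != 0) ->
  Ck_on k U f -> Ck_on k U (fun x => invmx (f x)).
Proof.
move=> oU f0 /(Ck_on_mx _ _ oU) Cf; apply/Ck_on_mx => // i j.
apply: (@Ck_on_ext _ _ _ _ _ (fun x => (\det (f x))^-1 *
  ((-1) ^+ (j + i) * \det (row' j (col' i (f x)))))) => //.
  move=> x /set_mem Ux; rewrite /invmx unitmxE unitfE f0 // !mxE.
  by rewrite /cofactor addnC.
apply: Ck_onM => //.
  apply: (@Ck_on_comp _ _ _ _ [set x | x != 0] (fun x => \det (f x)) (fun x =>
    x^-1)) => //.
  - exact: Ck_on_det.
  - exact: Ck_on_inv.
apply: Ck_onM => //; first exact: Ck_on_cst.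
apply: Ck_on_det => // i' j'.
rewrite (_ : (fun x => _) = fun x => f x (lift j i') (lift i j')) //.
by apply/funext => x; rewrite !mxE.
Qed.

Lemma Ck_on_line k (U : set R) m n (A H : 'M[R]_(m, n)) : open U ->
  Ck_on k U (fun t : R => A + t *: H).
Proof.
move=> oU; apply/Ck_on_mx => // i j.
rewrite (_ : (fun x => _) = fun x => A i j + x * H i j); last first.
  by apply/funext => x; rewrite !mxE.
apply: Ck_onD => //; first exact: Ck_on_cst.
apply: Ck_onM => //; last exact: Ck_on_cst.
exact: Ck_on_id.
Qed.

(** Laplace expansion along the first row. For [j != 0] both the entry and the cofactor of the
    identity vanish, so the product has derivative 0; for [j = 0] the derivative is [X 0 0] plus
    that of the minor, given by induction. *)
Lemma is_derive_det1 n (X : 'M[R]_n) :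
  is_derive (0 : R) 1 (fun t : R => \det (1%:M + t *: X)) (\tr X).
Proof.
elim: n X => [X|n ih X].
  rewrite (_ : (fun t => _) = cst 1); last first.
    by apply/funext => t; rewrite det_mx00.
  by apply: is_derive_eq; rewrite /mxtrace big_ord0.
have dM i j : is_derive (0 : R) 1 (fun t => (1%:M + t *: X) i j) (X i j).
  rewrite (_ : (fun t => _) = (fun t => (i == j)%:R + t * X i j)); last first.
    by apply/funext => t; rewrite !mxE.
  have H := is_deriveD (is_derive_cst ((i == j)%:R : R) (0 : R) 1)
    (is_deriveZ (X i j) (is_derive_id (0 : R) 1)).
  rewrite (_ : (fun t => _) = cst (i == j)%:R + X i j \*: id) //.
    by apply: (is_derive_eq H); rewrite add0r /GRing.scale /= mulr1.
  by apply/funext => t; rewrite fctE /= mulrC.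
have dC j : derivable (fun t : R => cofactor (1%:M + t *: X) 0 j) 0 1.
  apply: derivableM; first exact: derivable_cst.
  apply/derivable1_diffP.
  have : Ck_on 1 setT (fun t : R => \det (row' 0 (col' j (1%:M + t *: X)))).
    apply: Ck_on_det; first exact: openT.
    move=> i k; have /(Ck_on_mx _ _ openT) := @Ck_on_line 1 setT _ _ (row' 0
      (col' j 1%:M)) (row' 0 (col' j X)) openT.
    move=> /(_ i k); rewrite (_ : (fun t => _) = (fun t =>
      row' 0 (col' j (1%:M + t *: X)) i k)) //.
    by apply/funext => t; rewrite !mxE.
  by case=> /(_ 0 I).
have cof1 j : cofactor (1%:M : 'M[R]_n.+1) 0 j = (j == 0)%:R.
  have := mul1mx (\adj (1%:M : 'M[R]_n.+1)); rewrite mul_mx_adj det1 =>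
    /matrixP/(_ j 0).
  by rewrite !mxE => <-.
pose g j (t : R) := (1%:M + t *: X) 0 j * cofactor (1%:M + t *: X) 0 j.
have dg j : is_derive (0 : R) 1 (g j) (if j == 0 then \tr X else 0).
  have dCj := derivableP (dC j).
  have -> : g j = (fun t => (1%:M + t *: X) 0 j) * (fun t : R =>
    cofactor (1%:M + t *: X) 0 j) by [].
  apply: is_derive_eq.
  rewrite !scale0r !addr0 cof1 !mxE; case: eqVneq => [<-|j0]; last first.
    by rewrite !mulr0n !scale0r addr0.
  rewrite !mulr1n !scale1r /mxtrace big_ord_recl addrC; congr (_ + _).
  have := ih (row' 0 (col' 0 X)); rewrite (_ : (fun t => _) = (fun t : R =>
    cofactor (1%:M + t *: X) 0 0)).
    by case=> _ ->; apply: eq_bigr => i _; rewrite !mxE.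
  apply/funext => t; rewrite /cofactor addn0 expr0 mul1r; congr (\det _).
  by apply/matrixP => i k; rewrite !mxE (inj_eq lift_inj).
have -> : (fun t : R => \det (1%:M + t *: X)) = \sum_(j < n.+1) g j.
  by apply/funext => t; rewrite (expand_det_row _ 0) fct_sumE.
apply: (is_derive_eq (is_derive_sum dg)).
by rewrite -big_mkcond big_pred1_eq.
Qed.

(** Jacobi's formula, reduced to the identity by [A + t H = A (1 + t A^-1 H)]. *)
Lemma is_derive_det n (A H : 'M[R]_n) : A \in unitmx ->
  is_derive (0 : R) 1 (fun t : R => \det (A + t *: H)) (\det A * \tr (invmx A *m H)).
Proof.
move=> uA; rewrite (_ : (fun t => _) = (\det A) *: (fun t =>
  \det (1%:M + t *: (invmx A *m H)))).
  have := is_derive_det1 (invmx A *m H) => dX.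
  exact: is_deriveZ.
apply/funext => t; rewrite fctE /GRing.scale /= -det_mulmx mulmxDr mulmx1.
by rewrite -scalemxAr mulmxA mulmxV // mul1mx.
Qed.

(** By the resolvent identity [(B + h K)^-1 - B^-1 = - h (B + h K)^-1 K B^-1] the difference
    quotient equals [- N h] exactly for small nonzero [h], and [N] is continuous at 0. *)
Lemma is_derive_invmx_tr n (A B K : 'M[R]_n) : B \in unitmx ->
  is_derive (0 : R) 1 (fun t : R => \tr (invmx (B + t *: K) *m A))
    (- \tr (invmx B *m K *m invmx B *m A)).
Proof.
move=> uB.
pose U := [set t : R | \det (B + t *: K) != 0].
have Cl := @Ck_on_line 0 setT _ _ B K openT.
have Cdet : continuous (fun t : R => \det (B + t *: K)).
  move=> t; apply: (@Ck_on_det _ _ _ 0 setT _ openT _ t I) => i j.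
  by apply: (iffLR (Ck_on_mx 0 _ openT)).
have oU : open U.
  rewrite (_ : U = (fun t : R => \det (B + t *: K)) @^-1` [set x | x != 0]) //.
  by apply: open_comp => [t _|]; [exact: Cdet|exact: open_neq].
have U0 : U 0 by rewrite /U /= scale0r addr0 -unitfE -unitmxE.
pose N (t : R) := \tr (invmx (B + t *: K) *m (K *m invmx B *m A)).
have CN k : Ck_on k U N.
  apply: Ck_on_tr => //.
  apply: (@Ck_on_mulmx _ _ _ _ _ _ (fun t : R => invmx (B + t *: K)) (fun=> _)) => //;
    last exact: Ck_on_cst.
  by apply: Ck_on_invmx => //; exact: Ck_on_line.
have cN : {for 0, continuous N} by exact: (CN 0%N).
have key : \forall h \near (0 : R)^', - N h =
    h^-1 *: (\tr (invmx (B + (h *: 1 + 0) *: K) *m A) - \tr (invmx (B + 0 *: K) *m A)).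
  have nU : \forall h \near (0 : R)^', U h.
    by apply: cvg_within; exact: open_nbhs_nbhs.
  near=> h.
  have h0 : h != 0 by near: h; exact: nbhs_dnbhs_neq.
  have uh : B + h *: K \in unitmx.
    by rewrite unitmxE unitfE; have : U h by near: h.
  rewrite /N addr0 scale0r addr0 [h *: 1]mulr1 -raddfB -mulmxBl.
  have -> : invmx (B + h *: K) - invmx B = - h *: (invmx (B + h *: K) *m K *m invmx B).
    have -> : - h *: (invmx (B + h *: K) *m K *m invmx B) =
        invmx (B + h *: K) *m (B - (B + h *: K)) *m invmx B.
      rewrite opprD addrA subrr add0r mulmxN mulNmx -scalemxAr -scalemxAl scaleNr.
      by [].
    by rewrite mulmxBr mulVmx // mulmxBl mul1mx -mulmxA mulmxV // mulmx1.
  rewrite /= -scalemxAl mxtraceZ /GRing.scale /= mulNr mulrN mulrA mulVf // mul1r.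
  by rewrite !mulmxA.
have lim : (fun h : R => h^-1 *: (\tr (invmx (B + (h *: 1 + 0) *: K) *m A) - \tr
  (invmx (B + 0 *: K) *m A))) @ (0 : R)^' --> - N 0.
  apply: cvg_trans (near_eq_cvg key) _.
  by apply: cvgN; apply: cvg_within_filter; exact: cN.
rewrite (_ : - \tr _ = - N 0); last first.
  by rewrite /N scale0r addr0 !mulmxA.
split; first by apply/cvg_ex; exists (- N 0).
exact: cvg_lim.
Unshelve. all: by end_near. Qed.

End MatrixCalculus.

(** * Positive definite matrices: Schur complements, Cholesky factors, trace and determinant *)

Section PositiveDefinite.
Context {R : realType}.

Definition posdef n (S : 'M[R]_n) :=
  S^T = S /\ forall v : 'rV[R]_n, v != 0 -> 0 < (v *m S *m v^T) 0 0.

Lemma posdef_congr n (S L : 'M[R]_n) : L \in unitmx ->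
  posdef S -> posdef (L *m S *m L^T).
Proof.
move=> uL [symS posS]; split; first by rewrite !trmx_mul trmxK symS mulmxA.
move=> v v0; rewrite !mulmxA -mulmxA -trmx_mul; apply: posS.
by apply: contraNneq v0 => vL; rewrite -[v]mulmx1 -(mulmxV uL) mulmxA vL mul0mx.
Qed.

Lemma posdefZ n (S : 'M[R]_n) c : 0 < c -> posdef S -> posdef (c *: S).
Proof.
move=> c0 [symS posS]; split; first by rewrite linearZ /= symS.
by move=> v v0; rewrite -scalemxAr -scalemxAl mxE mulr_gt0 // posS.
Qed.

(* [T] is the Schur complement of the upper left entry [s] and [q] is the trace
   lost in passing from [S] to the block diagonal matrix. *)
Lemma posdef_schur n (S : 'M[R]_(1 + n)) : posdef S ->
  exists L : 'M[R]_(1 + n), exists s : R, exists T : 'M[R]_n, exists q : R,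
  [/\ 0 < s, posdef T, \det L = 1, S = L *m block_mx s%:M 0 0 T *m L^T &
      [/\ \tr S = s + \tr T + q, 0 <= q & q = 0 -> S = block_mx s%:M 0 0 T]].
Proof.
move=> [symS posS].
pose s := S 0 0; pose w : 'rV[R]_n := ursubmx S.
pose L : 'M[R]_(1 + n) := block_mx 1%:M 0 (s^-1 *: w^T) 1%:M.
pose T : 'M[R]_n := drsubmx S - s^-1 *: (w^T *m w).
have ulE : ulsubmx S = s%:M.
  apply/matrixP => i j; rewrite !ord1 !mxE eqxx mulr1n /s; congr (S _ _);
    exact: val_inj.
have dlE : dlsubmx S = w^T by rewrite /w trmx_ursub symS.
have s0 : 0 < s.
  have := posS (row_mx 1%:M 0).
  have -> : (row_mx (1%:M : 'rV[R]_1) 0 : 'rV[R]_(1 + n)) != 0.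
    by apply/eqP => /eqP; rewrite row_mx_eq0 oner_eq0.
  move=> /(_ isT); rewrite -[S]submxK mul_row_block tr_row_mx mul_row_col.
  by rewrite !mul1mx !mul0mx !addr0 trmx0 mulmx0 addr0 trmx1 mulmx1 ulE mxE eqxx.
have SE : S = L *m block_mx s%:M 0 0 T *m L^T.
  rewrite /L tr_block_mx !trmx1 trmx0 mulmx_block !mul1mx !mul0mx !mulmx0 !addr0 !add0r.
  rewrite mulmx_block !mulmx0 !mul0mx !addr0 !mulmx1 ?add0r.
  rewrite linearZ /= trmxK mul_scalar_mx !scalerA divff ?gt_eqF // scale1r.
  rewrite mul_mx_scalar scalerA divff ?gt_eqF // scale1r -scalemxAr.
  rewrite /T addrC subrK -[LHS]submxK ulE dlE; congr block_mx.
have detL : \det L = 1 by rewrite det_lblock !det1 mulr1.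
have symT : T^T = T.
  rewrite /T linearB /= linearZ /= trmx_mul trmxK; congr (_ - _).
  by rewrite trmx_drsub symS.
have posT : forall v : 'rV[R]_n, v != 0 -> 0 < (v *m T *m v^T) 0 0.
  (* The test vector is chosen so that [L] sends it to [(0, v)], on which the block diagonal form is
     that of [T]. *)
  move=> v v0; have := posS (row_mx (- (s^-1 *: (v *m w^T))) v).
  have -> : row_mx (- (s^-1 *: (v *m w^T))) v != 0.
    by rewrite row_mx_eq0 negb_and v0 orbT.
  move=> /(_ isT); rewrite SE !mulmxA -mulmxA -trmx_mul.
  have -> : row_mx (- (s^-1 *: (v *m w^T))) v *m L = row_mx 0 v.
    rewrite /L mul_row_block !mulmx1 mulmx0 add0r -scalemxAr.
    by rewrite addNr.
  rewrite mul_row_block tr_row_mx mul_row_col !mulmx0 !mul0mx !add0r trmx0 mulmx0.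
  by rewrite add0r.
(* [\tr (w^T *m w)] is the squared length of the off-diagonal row [w], so [q] vanishes only if [w]
   does. *)
exists L, s, T, (s^-1 * \tr (w^T *m w)); split => //.
have trw : \tr (w^T *m w) = \sum_i w 0 i ^+ 2.
  by apply: eq_bigr => i _; rewrite mxE big_ord1 mxE expr2.
have trw0 : 0 <= \tr (w^T *m w) by rewrite trw sumr_ge0 // => i _; exact: sqr_ge0.
split.
- rewrite -[S in LHS]submxK mxtrace_block ulE mxtrace_scalar mulr1n -addrA;
  congr (_ + _).
  by rewrite /T linearB /= mxtraceZ subrK.
- by rewrite mulr_ge0 // invr_ge0 ltW.
move=> /eqP; rewrite mulf_eq0 invr_eq0 gt_eqF //= trw psumr_eq0; last by move=> i _;
  exact: sqr_ge0.
move=> /allP w0; have {}w0 : w = 0.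
  apply/rowP => i; have := w0 i (mem_index_enum _).
  by rewrite implyTb sqrf_eq0 => /eqP ->; rewrite mxE.
by rewrite -[LHS]submxK ulE dlE /T -/w w0 trmx0 mul0mx scaler0 subr0.
Qed.

Lemma ln_lt_sub1 (x : R) : 0 < x -> x != 1 -> ln x < x - 1.
Proof.
move=> x0 x1; rewrite ltrBrDl -{2}(lnK (x := x)) ?posrE // expR_gt1Dx //.
by rewrite ln_eq0.
Qed.

Lemma ln_le_sub1 (x : R) : 0 < x -> ln x <= x - 1.
Proof.
move=> x0; have [->|x1] := eqVneq x 1; first by rewrite ln1 subrr.
exact/ltW/ln_lt_sub1.
Qed.

Lemma posdef_ln_det n (S : 'M[R]_n) : posdef S ->
  [/\ 0 < \det S, ln (\det S) <= \tr S - n%:R &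
      ln (\det S) = \tr S - n%:R -> S = 1%:M].
Proof.
elim: n S => [S _|n ih S pS].
  rewrite det_mx00 /mxtrace big_ord0 ln1 subrr; split => //.
  by move=> _; apply/matrixP => -[].
have [L [s [T [q [s0 pT dL SE [trS q0 qE]]]]]] := posdef_schur (pS : posdef
  (S : 'M[R]_(1 + n))).
have [dT lT eT] := ih T pT.
have dS : \det S = s * \det T.
  rewrite -[\det S]/(@determinant _ (1 + n) S) SE !det_mulmx det_tr dL mul1r mulr1.
  by rewrite det_lblock det_scalar1.
have trS' : \tr S = s + \tr T + q by exact: trS.
rewrite dS trS' lnM ?posrE //.
(* [tr S - (n + 1) - ln (det S)] is the sum of the three nonnegative slacks [s - 1 - ln s],
   [tr T - n - ln (det T)] and [q]; equality forces each of them to vanish. *)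
have ls := ln_le_sub1 s0.
split; first by rewrite mulr_gt0.
  by rewrite -natr1; lra.
rewrite -natr1 => eqS.
have s1 : s = 1.
  by apply/eqP/negP => /negP s1; have := ln_lt_sub1 s0 s1; lra.
have T1 : T = 1%:M by apply: eT; lra.
have -> : S = block_mx s%:M 0 0 T :> 'M[R]_(1 + n) by apply: qE; lra.
by rewrite s1 T1 -scalar_mx_block.
Qed.

Lemma posdef_cholesky n (S : 'M[R]_n) : posdef S ->
  exists2 L, L \in unitmx & S = L *m L^T.
Proof.
elim: n S => [S _|n ih S pS].
  by exists 1%:M; [exact: unitmx1|rewrite [S]flatmx0 [RHS]flatmx0].
have [L [s [T [q [s0 pT dL SE _]]]]] := posdef_schur (pS : posdef (S : 'M[R]_(1 + n))).
have [C uC TE] := ih T pT.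
pose E : 'M[R]_(1 + n) := block_mx (Num.sqrt s)%:M 0 0 C.
have EE : block_mx s%:M 0 0 T = E *m E^T.
  rewrite /E TE tr_block_mx !trmx0 mulmx_block !mulmx0 !mul0mx !addr0 add0r
    tr_scalar_mx.
  by rewrite -scalar_mxM -expr2 sqr_sqrtr // ltW.
have {}SE : S = (L *m E) *m (L *m E)^T :> 'M[R]_(1 + n).
  by rewrite SE EE trmx_mul !mulmxA.
exists (L *m E : 'M[R]_(1 + n)) => //.
rewrite unitmxE -[\det _]/(@determinant _ (1 + n) _) det_mulmx dL mul1r.
rewrite det_lblock det_scalar1 unitfE mulf_neq0 //.
  by rewrite sqrtr_eq0 -ltNge.
by rewrite -unitfE -unitmxE.
Qed.

(** [B^-1 A] is in general not symmetric. With [B = L L^T], the matrix [L^-1 A L^-T] is symmetric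
    and similar to it, and it is the identity only when [A = L L^T]. *)
Lemma posdef_pair n (A B : 'M[R]_n) : posdef A -> posdef B ->
  exists2 S : 'M[R]_n, posdef S & [/\ \tr S = \tr (invmx B *m A), \det S = \det A /
    \det B &
    S = 1%:M -> A = B].
Proof.
move=> pA pB; have [L uL BE] := posdef_cholesky pB.
have uLT : L^T \in unitmx by rewrite unitmx_tr.
exists (invmx L *m A *m (invmx L)^T).
  by apply: posdef_congr => //; rewrite unitmx_inv.
split.
- rewrite mxtrace_mulC mulmxA BE trmx_inv; congr (\tr (_ *m _)).
  apply: (can_inj (mulmxK (_ : L *m L^T \in unitmx))).
    by rewrite unitmx_mul uL.
  rewrite mulVmx ?unitmx_mul ?uL // mulmxA -(mulmxA _ (invmx L)) mulVmx //.
  by rewrite mulmx1 mulVmx.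
- by rewrite BE !det_mulmx !det_tr det_inv invfM -mulrA mulrCA.
- have AE : A = L *m (invmx L *m A *m (invmx L)^T) *m L^T.
    by rewrite !mulmxA mulmxV // mul1mx trmx_inv -mulmxA mulVmx // mulmx1.
  by move=> S1; rewrite AE S1 mulmx1.
Qed.

Lemma posdef_amgm n (S : 'M[R]_n) : (0 < n)%N -> posdef S ->
  n%:R * expR (ln (\det S) / n%:R) <= \tr S.
Proof.
move=> n0 pS; have [dS _ _] := posdef_ln_det pS.
have n0' : (n%:R : R) != 0 by rewrite pnatr_eq0 -lt0n.
(* [c] is [(det S)^(- 1 / n)]: the matrix [c S] has determinant 1, and the inequality between
   logarithm and trace reduces to [0 <= c tr S - n]. *)
pose c := expR (- (ln (\det S) / n%:R)).
have c0 : 0 < c by exact: expR_gt0.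
have [_ + _] := posdef_ln_det (posdefZ c0 pS).
rewrite detZ -expRM_natr mulNr divfK // expRN lnK ?posrE // mulVf ?gt_eqF // ln1.
rewrite mxtraceZ subr_ge0 /c expRN mulrC -ler_pdivlMr ?invr_gt0 ?expR_gt0 //.
Qed.

End PositiveDefinite.

(** * Partitions of unity *)

Section Bump.
Context {R : realType}.

(** The factor [x^-k] in front of the classical flat function makes the span of the family closed
    under differentiation, so that smoothness is an induction over all [k] at once. *)
Definition flat (k : nat) (x : R) : R :=
  if 0 < x then x ^- k * expR (- x^-1) else 0.

Lemma flat_gt0 k x : 0 < x -> 0 < flat k x.
Proof.
by move=> x0; rewrite /flat x0 mulr_gt0 ?expR_gt0 // invr_gt0 exprn_gt0.
Qed.

Lemma flat_ge0 k x : 0 <= flat k x.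
Proof.
by have [x0|x0] := ltP 0 x; [exact/ltW/flat_gt0|rewrite /flat ltNge x0].
Qed.

(** For positive [x] the exponential of [1 / x] dominates the term of order [k + 1] of its series.
    The linear bound is what makes the functions tend to 0 at the origin. *)
Lemma flat_le k x : `|flat k x| <= (k.+1)`!%:R * `|x|.
Proof.
rewrite ger0_norm ?flat_ge0 // /flat; case: ifPn => [x0|_]; last first.
  by rewrite mulr_ge0.
have xV : 0 < x^-1 by rewrite invr_gt0.
have := expR_ge1Dxn k (ltW xV).
rewrite expRN gtr0_norm // -exprVn => H.
rewrite ler_pdivrMr ?expR_gt0 //.
have : x^-1 ^+ k.+1 / k.+1`!%:R <= expR x^-1 by apply: le_trans H; rewrite lerDr.
rewrite ler_pdivrMr ?ltr0n ?fact_gt0 // => H2.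
rewrite mulrAC -ler_pdivrMr // mulrC -exprS; apply: le_trans H2 _.
by rewrite mulrC.
Qed.

Lemma is_derive_flat k (x : R) :
  is_derive x 1 (flat k) (- k%:R * flat k.+1 x + flat k.+2 x).
Proof.
have [x0|x0|->] := ltgtP x 0.
- have -> : - k%:R * flat k.+1 x + flat k.+2 x = 0.
    by rewrite /flat ltNge (ltW x0) /= mulr0 addr0.
  apply: (@near_eq_is_derive _ _ _ (cst (0 : R))).
  near=> y; rewrite /flat ltNge; have -> // : y <= 0.
  by apply: ltW; near: y; exact: lt_nbhsl.
- have xn0 : x != 0 by rewrite gt_eqF.
  pose F (y : R) := y^-1 ^+ k * expR (- y^-1).
  have nF : \near x, F x = flat k x.
    near=> y; rewrite /flat; have -> : 0 < y by near: y; exact: lt_nbhsr.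
    by rewrite /F exprVn.
  have dV : is_derive x 1 (fun y : R => y^-1) (- x^-2).
    apply: (is_derive_eq (@is_deriveV R id x 1 1 xn0 _)).
    by rewrite /GRing.scale /= mulr1.
  have dX : is_derive x 1 (fun y : R => y^-1 ^+ k) (k%:R * x^-1 ^+ k.-1 * (- x^-2)).
    have -> : (fun y : R => y^-1 ^+ k) = (fun y : R => y^-1) ^+ k.
      by apply/funext => y; rewrite exprfctE.
    by apply: is_derive_eq; rewrite /GRing.scale /= mulr_natl.
  have dE : is_derive x 1 (fun y : R => expR (- y^-1)) (expR (- x^-1) * x^-2).
    have dN : is_derive x 1 (fun y : R => - y^-1) (x^-2).
      have -> : (fun y : R => - y^-1) = - (fun y : R => y^-1) by [].
      by apply: is_derive_eq; rewrite opprK.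
    have -> : (fun y : R => expR (- y^-1)) = expR \o (fun y : R => - y^-1) by [].
    exact: is_derive1_comp.
  have dF : is_derive x 1 F (- k%:R * flat k.+1 x + flat k.+2 x); last first.
    exact: near_eq_is_derive nF dF.
  have -> : F = (fun y : R => y^-1 ^+ k) * (fun y : R => expR (- y^-1)) by [].
  apply: is_derive_eq.
  rewrite /flat x0 /GRing.scale /= -!exprVn.
  by clear F nF dX; case: k => [|k]; rewrite ?expr0 /= ?exprS; ring.
- have -> : - k%:R * flat k.+1 0 + flat k.+2 0 = 0.
    by rewrite /flat ltxx mulr0 addr0.
  have lim : (fun h : R => h^-1 *: (flat k (h *: 1 + 0) - flat k 0)) @ (0 : R)^' -->
    (0 : R).
    apply/cvgrPdist_le => e e0; near=> h.
    have h0 : h != 0 by near: h; exact: nbhs_dnbhs_neq.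
    rewrite sub0r normrN addr0 [h *: 1]mulr1 {2}/flat ltxx subr0.
    (* The difference quotient at 0 of one member of the family is the next member, to which the
       linear bound applies. *)
    have -> : h^-1 *: flat k h = flat k.+1 h.
      rewrite /flat; case: ifP => _; last by rewrite scaler0.
      by rewrite /GRing.scale /= mulrA exprS invfM.
    apply: le_trans (flat_le _ _) _.
    rewrite mulrC -ler_pdivlMr ?ltr0n ?fact_gt0 //.
    near: h; apply: dnbhs0_le; by rewrite divr_gt0 // ltr0n fact_gt0.
  by split; [apply/cvg_ex; exists 0|exact: cvg_lim].
Unshelve. all: by end_near. Qed.

Lemma Ck_on_flat n k (U : set R) : Ck_on n U (flat k).
Proof.
suff : Ck_on n setT (flat k) by exact: Ck_on_subset.
elim: n k => [k x _|n ih k].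
  apply: differentiable_continuous; apply/derivable1_diffP.
  by have [] := is_derive_flat k x.
apply: (Ck_on_real openT (fun x _ => is_derive_flat k x)).
apply: Ck_onD => //; first exact: openT.
by apply: Ck_onM => //; [exact: openT|exact: Ck_on_cst].
Qed.

(** A product over the coordinates suits the sup norm: for [0 < r] it is positive exactly on the
    open cube of half-side [r] around [c]. *)
Definition cube_bump d (c : 'rV[R]_d) (r : R) (y : 'rV[R]_d) : R :=
  \prod_i (flat 0 (r - (y 0 i - c 0 i)) * flat 0 (r + (y 0 i - c 0 i))).

Lemma Ck_on_cube_bump d (c : 'rV[R]_d) r n U : Ck_on n U (cube_bump c r).
Proof.
suff : Ck_on n setT (cube_bump c r) by exact: Ck_on_subset.
have Ci i (e : R) : Ck_on n setT (fun y : 'rV[R]_d => r + e * (y 0 i - c 0 i)).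
  apply: Ck_onD; [exact: openT|exact: Ck_on_cst|].
  apply: Ck_onM; [exact: openT|exact: Ck_on_cst|].
  apply: Ck_onD; [exact: openT| |exact: Ck_on_cst].
  by move: 0 i; apply/Ck_on_mx; [exact: openT|exact: Ck_on_id].
apply: Ck_on_prod => [|i _]; first exact: openT.
apply: Ck_onM; first exact: openT.
- rewrite (_ : (fun y => _) = (fun y : 'rV[R]_d => flat 0 (r + -1 * (y 0 i - c 0 i)))).
    by apply: (@Ck_on_comp _ _ _ _ setT) => //; [exact: openT|exact: Ck_on_flat].
  by apply/funext => y; rewrite mulN1r.
- rewrite (_ : (fun y => _) = (fun y : 'rV[R]_d => flat 0 (r + 1 * (y 0 i - c 0 i)))).
    by apply: (@Ck_on_comp _ _ _ _ setT) => //; [exact: openT|exact: Ck_on_flat].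
  by apply/funext => y; rewrite mul1r.
Qed.

Lemma cube_bump_ge0 d (c : 'rV[R]_d) r y : 0 <= cube_bump c r y.
Proof. by apply: prodr_ge0 => i _; rewrite mulr_ge0 ?flat_ge0. Qed.

Lemma cube_bump_gt0 d (c : 'rV[R]_d) r : 0 < r -> 0 < cube_bump c r c.
Proof.
move=> r0; apply: prodr_gt0 => i _.
by rewrite subrr subr0 addr0 mulr_gt0 ?flat_gt0.
Qed.

Lemma cube_bump_neq0 d (c : 'rV[R]_d) r y : 0 < r ->
  cube_bump c r y != 0 -> `|y - c| <= r.
Proof.
move=> r0 by0; apply/mx_norm_le; first exact: ltW.
move=> j i; rewrite (ord1 j) !mxE; rewrite leNgt; apply: contra by0 => ry.
rewrite /cube_bump (bigD1 i) //=.
suff -> : flat 0 (r - (y 0 i - c 0 i)) * flat 0 (r +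
  (y 0 i - c 0 i)) = 0 by rewrite mul0r.
move: ry; rewrite lter_normr => /orP[ry|ry].
  rewrite {1}/flat ifF ?mul0r //; apply/negbTE; rewrite -leNgt subr_le0; exact: ltW.
rewrite [X in _ * X]/flat ifF ?mulr0 //; apply/negbTE; rewrite -leNgt.
by rewrite -[_ - c 0 i]opprK subr_le0 ltW.
Qed.

End Bump.

Section ManifoldPOU.
Context {R : realType} {d : nat}.
Variable M : smoothManifold R d.

Lemma chart_image_coord (a : chart M) (x : M) : dom a x -> chart_image a
  (Defs.coord a x).
Proof. by move=> ax; exists x. Qed.

Lemma chart_image_param (a : chart M) y : chart_image a y -> dom a (param a y).
Proof. by move=> [x ax <-]; rewrite coordK. Qed.

Lemma paramK (a : chart M) y : chart_image a y -> Defs.coord a (param a y) = y.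
Proof. by move=> [x ax <-]; rewrite coordK. Qed.

Lemma near_chart_image (a : chart M) y : chart_image a y ->
  \forall y' \near y, chart_image a y'.
Proof. by move=> ay; apply: open_nbhs_nbhs; split => //; exact: image_open. Qed.

Lemma near_param (a : chart M) y (U : set M) : chart_image a y -> open U ->
  U (param a y) -> \forall y' \near y, U (param a y').
Proof.
move=> ay oU Uy; apply: (param_continuous ay).
by apply: open_nbhs_nbhs; split.
Qed.

Lemma overlap_open (a b : chart M) : open (Defs.coord a @` (dom a `&` dom b)).
Proof.
rewrite openE => _ [x [ax bx] <-]; rewrite /interior.
have ay := chart_image_coord ax.
have nb := near_param ay (dom_open b); rewrite coordK // in nb.
have na := near_chart_image ay.
near=> y; exists (param a y); last by rewrite paramK //; near: y.
split; first by apply: chart_image_param; near: y.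
by near: y; exact: nb.
Unshelve. all: by end_near. Qed.

(** A cube bump in the chart is extended by zero to [M]. The closed cube has compact image, which is
    closed because [M] is Hausdorff; a point outside the chart therefore has a neighbourhood on
    which the extension vanishes. *)
Lemma chart_bump (x : M) : exists (a : chart M) (b : M -> R),
  [/\ forall a', smooth_on (chart_image a') (b \o param a'),
      forall z, 0 <= b z, 0 < b x &
      closure [set z | b z != 0] `<=` dom a].
Proof.
have [a ax] := dom_cover x; exists a.
set c := Defs.coord a x.
have [r r0 rU] : exists2 r : R, 0 < r &
    forall y, `|y - c| <= r -> chart_image a y.
  have /nbhs_ballP [e /= e0 eU] := near_chart_image (chart_image_coord ax).
  exists (e / 2); first by rewrite divr_gt0.
  move=> y yc; apply: eU; rewrite -ball_normE /= distrC.
  by apply: le_lt_trans yc _; rewrite ltr_pdivrMr // ltr_pMr // ltr1n.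
pose b (z : M) : R := if pselect (dom a z) then cube_bump c r (Defs.coord a z) else 0.
pose K' := [set y : 'rV[R]_d | `|y - c| <= r].
have cK' : compact K' by exact: rV_ball_compact.
have cK : compact (param a @` K').
  apply: continuous_compact cK'; apply: continuous_in_subspaceT => y /set_mem yK.
  by apply: param_continuous; exact: rU.
have clK : closed (param a @` K').
  by apply: compact_closed cK; exact: manifold_hausdorff.
have bK z : b z != 0 -> (param a @` K') z.
  rewrite /b; case: pselect => [az bz|_ /eqP//].
  by exists (Defs.coord a z); [exact: cube_bump_neq0 bz|rewrite coordK].
exists b; split.
- move=> a' n; apply: Ck_on_near => y a'y.
  have [ay|ay] := pselect (dom a (param a' y)).
    have Uy : (Defs.coord a' @` (dom a' `&` dom a)) y.
      exists (param a' y); last by rewrite paramK.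
      by split=> //; exact: chart_image_param.
    exists (fun y => cube_bump c r ((Defs.coord a \o param a') y)).
      have := near_param a'y (dom_open a) ay; apply: filterS => y' ay' /=.
      by rewrite /b; case: pselect.
    apply: (@Ck_on_subset _ _ _ _ (Defs.coord a' @` (dom a' `&` dom a)));
      first by move=> _ ->.
    apply: (@Ck_on_comp_rV _ _ _ _ _ setT) => //.
    - exact: overlap_open.
    - exact: transition_smooth.
    - exact: Ck_on_cube_bump.
  exists (fun=> 0); last exact: Ck_on_cst.
  have nK : (~` (param a @` K')) (param a' y).
    move=> [y' Ky' Ey]; apply: ay; rewrite -Ey; apply: chart_image_param; exact: rU.
  have := near_param a'y (closed_openC clK) nK; apply: filterS => y' nKy' /=.
  by apply/eqP; apply: contrapT => /negP /bK.
- by move=> z; rewrite /b; case: pselect => [az|naz] //=; exact: cube_bump_ge0.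
- by rewrite /b; case: pselect => [az|//] /=; exact: cube_bump_gt0.
- move=> z zc; have [y Ky <-] : (param a @` K') z.
    by rewrite (iffLR (closure_id _) clK); apply: closureS zc => z' /bK.
  by apply: chart_image_param; exact: rU.
Qed.

Lemma compact_finite_cover (O : M -> set M) : compact [set: M] ->
  (forall x, open (O x)) -> (forall x, O x x) ->
  exists s : seq M, forall z, exists2 x, x \in s & O x z.
Proof.
move=> /compact_near_coveringP cM oO Ox.
(* Finite lists directed by inclusion: compactness in its near-covering form, applied along this
   filter, yields one list that serves all points. *)
pose F : set_system (seq M) :=
  [set P | exists s0 : seq M, forall s : seq M, {subset s0 <= s} -> P s].
have FF : Filter F.
  split; first by exists [::].
    move=> P Q [s0 H0] [s1 H1]; exists (s0 ++ s1) => s ss; split.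
      by apply: H0 => x xs; apply: ss; rewrite mem_cat xs.
    by apply: H1 => x xs; apply: ss; rewrite mem_cat xs orbT.
  by move=> P Q PQ [s0 H0]; exists s0 => s /H0 /PQ.
have [x _|s0 /(_ s0 (fun x xs => xs)) H] := cM _ F (fun (s : seq M) z =>
  exists2 x : M, x \in s & O x z) FF.
  exists (O x, [set s : seq M | x \in s]).
    split=> /=; first by apply: open_nbhs_nbhs; split.
    by exists [:: x] => s; apply; rewrite mem_head.
  by move=> -[z s] [/= Oz xs]; exists x.
by exists s0 => z; exact: H.
Qed.

(** Finitely many bumps have a sum [S] that is positive everywhere; dividing by [S] normalizes them
    without changing their supports. *)
Lemma partition_of_unity_exists : compact [set: M] -> $|partition_of_unity M|.
Proof.
move=> cM.
have [a_ Ha] := choice chart_bump; have [b_ Hb] := choice Ha.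
have oO x : open [set z | 0 < b_ x z].
  have [smb b0 _ _] := Hb x; rewrite openE => z /= bz.
  have [a az] := dom_cover z.
  have ay := chart_image_coord az.
  have cb : {for z, continuous (fun z => (b_ x \o param a) (Defs.coord a z))}.
    apply: continuous_comp; first exact: Defs.coord_continuous.
    exact: (smb a 0%N).
  have nz : \forall z' \near z, 0 < (b_ x \o param a) (Defs.coord a z').
    apply: (cvgr_gt _ cb); by rewrite /= coordK.
  have na : \forall z' \near z, dom a z' by apply: open_nbhs_nbhs; split => //;
    exact: dom_open.
  rewrite /interior; near=> z' => /=.
  have : 0 < (b_ x \o param a) (Defs.coord a z') by near: z'; exact: nz.
  by rewrite /= coordK //; near: z'; exact: na.
have [s Hs] := compact_finite_cover cM oO (fun x => let: And4 _ _ h _ := Hb x in h).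
pose t := in_tuple s.
pose S (z : M) := \sum_(i < size s) b_ (tnth t i) z.
have S0 z : 0 < S z.
  have [x /(tnthP t) [i ->] bz] := Hs z.
  rewrite /S (bigD1 i) //= ltr_wpDr //.
  by apply: sumr_ge0 => j _; have [_ + _ _] := Hb (tnth t j); exact.
apply: squash; apply: (@PartitionOfUnity _ _ _ (size s) (fun i => a_ (tnth t i))
   (fun i z => b_ (tnth t i) z / S z)).
- move=> i a n; have oU := @image_open _ _ M a.
  apply: Ck_onM => //; first by have [+ _ _ _] := Hb (tnth t i); exact.
  apply: (@Ck_on_comp _ _ _ _ [set x | x != 0] (fun y => S (param a y)) (fun x =>
    x^-1)) => //.
  + by move=> y _ /=; rewrite gt_eqF.
  + by apply: Ck_on_sum => // j _; have [+ _ _ _] := Hb (tnth t j); exact.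
  + exact: Ck_on_inv.
- by move=> i z; rewrite divr_ge0 //; [have [_ + _ _] := Hb (tnth t i);
  exact|exact: ltW].
- move=> i; rewrite (_ : [set x | _] = [set z | b_ (tnth t i) z != 0]).
    by have [_ _ _] := Hb (tnth t i).
  by apply/seteqP; split=> z /=; rewrite mulf_eq0 invr_eq0 (gt_eqF (S0 z)) orbF.
- by move=> z; rewrite -mulr_suml -/(S z) divff // (gt_eqF (S0 z)).
Unshelve. all: by end_near. Qed.

End ManifoldPOU.

(** * Integration of densities against a partition of unity *)

Section PouIntegral.
Context {R : realType} {d : nat} {M : smoothManifold R d}.
Variable P : partition_of_unity M.
Hypothesis cM : compact [set: M].

(** The closure is taken in [M] before passing to coordinates, which gives a compact set inside the
    open chart image. *)
Definition pou_supp (i : 'I_(pou_size P)) : set 'rV[R]_d :=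
  Defs.coord (pou_chart i) @` closure [set x | pou_fun i x != 0].

Definition pou_cutoff (i : 'I_(pou_size P)) (f : 'rV[R]_d -> R) : 'rV[R]_d -> R :=
  (fun y => pou_fun i (param (pou_chart i) y) * f y) \_ (chart_image (pou_chart i)).

(** Continuity is asked on the supports alone: components are set to 0 outside the chart image and
    may jump at its boundary. *)
Definition pou_cont (rho : scalar_density M) :=
  forall i y, pou_supp i y -> {for y, continuous (rho (pou_chart i))}.

Lemma pou_supp_sub i : pou_supp i `<=` chart_image (pou_chart i).
Proof. by move=> _ [x xc <-]; exists x => //; exact: pou_support xc. Qed.

Lemma pou_supp_compact i : compact (pou_supp i).
Proof.
apply: continuous_compact.
  apply: continuous_in_subspaceT => x /set_mem xc.
  by apply: Defs.coord_continuous; exact: pou_support xc.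
by apply: subclosed_compact cM _ => //; exact: closed_closure.
Qed.

Lemma pou_fun_supp i y : chart_image (pou_chart i) y ->
  pou_fun i (param (pou_chart i) y) != 0 -> pou_supp i y.
Proof.
by move=> Uy f0; exists (param (pou_chart i) y); [exact: subset_closure|exact: paramK].
Qed.

Lemma pou_cutoff_out i f y : ~ pou_supp i y -> pou_cutoff i f y = 0.
Proof.
move=> nKy; rewrite /pou_cutoff patchE; case: ifPn => // /set_mem Uy.
have [->|f0] := eqVneq (pou_fun i (param (pou_chart i) y)) 0; first by rewrite mul0r.
by case: nKy; exact: pou_fun_supp.
Qed.

Lemma pou_cutoff_in i f y : pou_supp i y ->
  pou_cutoff i f y = pou_fun i (param (pou_chart i) y) * f y.
Proof. by move=> Ky; rewrite /pou_cutoff patchE mem_set //; exact: pou_supp_sub. Qed.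

(** The radius depends on the support only. Around a point of the support the cutoff is a product of
    continuous functions; off the closed support it is zero on a neighbourhood. *)
Lemma pou_cutoff_cont i : exists r : R, forall f,
  (forall y, pou_supp i y -> {for y, continuous f}) ->
  compact_cont r (pou_cutoff i f).
Proof.
have [r [_ rK]] := compact_bounded (pou_supp_compact (i := i)).
exists (r + 1) => f cf; split=> [y|y ry]; last first.
  apply: pou_cutoff_out => Ky; have := rK (r + 1); rewrite ltrDl ltr01 => /(_ isT y Ky).
  by rewrite /= leNgt ry.
have [Ky|nKy] := pselect (pou_supp i y).
  have Uy := pou_supp_sub Ky.
  have cg : {for y, continuous (fun y => pou_fun i (param (pou_chart i) y) * f y)}.
    by apply: continuousM; [exact: (pou_smooth i (pou_chart i) 0%N)|exact: cf].
  suff : {for y, continuous (pou_cutoff i f)} by [].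
  rewrite /prop_for /continuous_at /pou_cutoff patchE mem_set //.
  apply: cvg_trans cg; apply: (@near_eq_cvg _ _ (nbhs y) _).
  have nU := near_chart_image Uy; near=> y'.
  by rewrite patchE mem_set //; near: y'; exact: nU.
suff : {for y, continuous (pou_cutoff i f)} by [].
rewrite /prop_for /continuous_at pou_cutoff_out //.
have cl : closed (pou_supp i).
  by apply: compact_closed; [exact: norm_hausdorff|exact: pou_supp_compact].
have := open_nbhs_nbhs (conj (closed_openC cl) nKy) => nK.
have c0 : {for y, continuous (fun=> 0 : R)} by exact: cst_continuous.
apply: cvg_trans c0; apply: (@near_eq_cvg _ _ (nbhs y) _).
by apply: filterS nK => y' /pou_cutoff_out ->.
Unshelve. all: by end_near. Qed.

Lemma pou_integralE rho : pou_integral P rho =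
  \sum_(i < pou_size P) euclidean_integral (pou_cutoff i (rho (pou_chart i))).
Proof. by []. Qed.

Lemma pou_integral_lin (c : R) (f g : scalar_density M) : pou_cont f -> pou_cont g ->
  pou_integral P (fun a y => c * f a y + g a y) = c * pou_integral P f + pou_integral P
    g.
Proof.
move=> cf cg; rewrite !pou_integralE mulr_sumr -big_split /=; apply: eq_bigr => i _.
have [r Hr] := pou_cutoff_cont i.
rewrite -(euclidean_integral_lin c (Hr _ (cf i)) (Hr _ (cg i))).
congr euclidean_integral; apply/funext => y.
rewrite /pou_cutoff !patchE; case: ifP => _; last by rewrite mulr0 addr0.
by rewrite mulrDr mulrCA.
Qed.

Lemma pou_integral_ext (f g : scalar_density M) :
  (forall i y, pou_supp i y -> f (pou_chart i) y = g (pou_chart i) y) ->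
  pou_integral P f = pou_integral P g.
Proof.
move=> fg; rewrite !pou_integralE; apply: eq_bigr => i _.
congr euclidean_integral; apply/funext => y.
have [Ky|nKy] := pselect (pou_supp i y); last by rewrite !pou_cutoff_out.
by rewrite !pou_cutoff_in // fg.
Qed.

Lemma pou_fun_le1 i x : pou_fun (p := P) i x <= 1.
Proof.
rewrite -(pou_sum P x) (bigD1 i) //= lerDl sumr_ge0 // => j _; exact: pou_ge0.
Qed.

Lemma pou_integral_bound : exists2 B : R, 0 <= B & forall (f : scalar_density M)
  (C : R),
  0 <= C -> pou_cont f ->
  (forall i y, pou_supp i y -> `|f (pou_chart i) y| <= C) ->
  `|pou_integral P f| <= B * C.
Proof.
have H i : exists B : R, 0 <= B /\ forall (f : 'rV[R]_d -> R) (C : R), 0 <= C ->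
    (forall y, pou_supp i y -> {for y, continuous f}) ->
    (forall y, pou_supp i y -> `|f y| <= C) ->
    `|euclidean_integral (pou_cutoff i f)| <= B * C.
  have [r Hr] := pou_cutoff_cont i; have [B B0 HB] := euclidean_integral_bound d r.
  exists B; split => // f C C0 cf fC; apply: HB; first exact: Hr.
  move=> y; have [Ky|nKy] := pselect (pou_supp i y);
    last by rewrite pou_cutoff_out // normr0.
  rewrite pou_cutoff_in // normrM ger0_norm ?pou_ge0 // -[C]mul1r.
  by apply: ler_pM => //; [exact: pou_ge0|exact: pou_fun_le1|exact: fC].
have [B HB] := choice H; exists (\sum_i B i).
  by apply: sumr_ge0 => i _; case: (HB i).
move=> f C C0 cf fC; rewrite pou_integralE (le_trans (ler_norm_sum _ _ _)) //.
rewrite mulr_suml; apply: ler_sum => i _; have [_] := HB i.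
by apply => //; [exact: cf|exact: fC].
Qed.

Lemma pou_cutoff_ge0 i f y : (forall y, pou_supp i y -> 0 <= f y) ->
  0 <= pou_cutoff i f y.
Proof.
move=> f0; have [Ky|nKy] := pselect (pou_supp i y); last by rewrite pou_cutoff_out.
by rewrite pou_cutoff_in // mulr_ge0 ?pou_ge0 // f0.
Qed.

Lemma pou_integral_ge0 (f : scalar_density M) :
  (forall i y, pou_supp i y -> 0 <= f (pou_chart i) y) -> 0 <= pou_integral P f.
Proof.
move=> f0; rewrite pou_integralE; apply: sumr_ge0 => i _.
by apply: euclidean_integral_ge0 => y; apply: pou_cutoff_ge0; exact: f0.
Qed.

(** Nothing can be said where the weight vanishes, but by [pou_fun_gt0] every point of [M] has
    positive weight in some chart of the partition. *)
Lemma pou_integral_eq0 (f : scalar_density M) : pou_cont f ->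
  (forall i y, pou_supp i y -> 0 <= f (pou_chart i) y) -> pou_integral P f = 0 ->
  forall (i : 'I_(pou_size P)) y, chart_image (pou_chart i) y -> 0 < pou_fun i (param
    (pou_chart i) y) ->
  f (pou_chart i) y = 0.
Proof.
move=> cf f0 /eqP; rewrite pou_integralE psumr_eq0; last first.
  by move=> i _; apply: euclidean_integral_ge0 => y; apply: pou_cutoff_ge0; exact: f0.
move=> /allP if0 i y Uy chi0; have [r Hr] := pou_cutoff_cont i.
have := if0 i (mem_index_enum _); rewrite implyTb => /eqP if0i.
have := euclidean_integral_eq0 (Hr _ (cf i)) (fun y => pou_cutoff_ge0 y (f0 i)) if0i y.
rewrite pou_cutoff_in; last by apply: pou_fun_supp => //; rewrite gt_eqF.
by move/eqP; rewrite mulf_eq0 gt_eqF //= => /eqP.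
Qed.

Lemma pou_fun_gt0 x : exists i : 'I_(pou_size P),
  0 < pou_fun i x /\ dom (pou_chart i) x.
Proof.
have [i xi] : exists i : 'I_(pou_size P), 0 < pou_fun i x.
  apply: contrapT => H; have := pou_sum P x.
  rewrite big1 => [/esym/eqP|i _]; first by rewrite oner_eq0.
  by apply/eqP; rewrite eq_le pou_ge0 andbT leNgt; apply/negP => xi; apply: H; exists i.
exists i; split=> //; apply: pou_support.
by apply: subset_closure => /=; rewrite gt_eqF.
Qed.

End PouIntegral.

(** Compactness excludes the default value of [dens_integral]; the later arguments work with any [P]
    that computes it. *)
Lemma dens_integral_pou (R : realType) (d : nat) (M : smoothManifold R d) :
  compact [set: M] -> exists P : partition_of_unity M,
    forall rho, dens_integral rho = pou_integral P rho.
Proof.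
move=> cM; rewrite /dens_integral; case: pselect => [P|]; first by exists (unsquash P).
by case; exact: partition_of_unity_exists.
Qed.

(** * Differentiation under the integral sign *)

Section DirectionalDerivatives.
Context {R : realType} {V : normedModType R}.

(** The finite-dimensional counterpart of [dir_derive], with the same convention: the head of the
    list is the outermost derivative. *)
Fixpoint dirD (F : V -> R) (hs : seq V) : V -> R :=
  match hs with
  | [::] => F
  | h :: hs' => fun v => 'D_h (dirD F hs') v
  end.

Lemma dirD_rcons F hs h : dirD F (rcons hs h) = dirD ('D_h F) hs.
Proof. by elim: hs => //= k hs ->. Qed.

Lemma smooth_on_dirD (U : set V) F hs : smooth_on U F -> smooth_on U (dirD F hs).
Proof. by move=> sF; elim: hs => //= h hs ih n; have [_] := ih n.+1; exact. Qed.

Lemma smooth_on_derive (U : set V) (F : V -> R) h : smooth_on U F -> smooth_on U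
  ('D_h F).
Proof. by move=> sF n; have [_] := sF n.+1; exact. Qed.

Lemma smooth_on_differentiable (U : set V) (F : V -> R) v :
  smooth_on U F -> U v -> differentiable F v.
Proof. by move=> sF; have [+ _] := sF 1%N; exact. Qed.

Lemma dirD_ext (U : set V) F G hs : open U -> (forall v, U v -> F v = G v) ->
  forall v, U v -> dirD F hs v = dirD G hs v.
Proof.
move=> oU FG; elim: hs => [|h hs ih] //= v Uv; apply: near_eq_derive.
by apply: filterS ih _; exact: open_nbhs_nbhs.
Qed.

Lemma dirD_sum (U : set V) (I : finType) (c : I -> R) (F : I -> V -> R) hs :
  open U -> (forall i, smooth_on U (F i)) ->
  forall v, U v -> dirD (fun v => \sum_i c i * F i v) hs v = \sum_i c i * dirD
    (F i) hs v.
Proof.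
move=> oU sF; elim: hs => [|h hs ih] //= v Uv.
rewrite (@near_eq_derive _ _ _ _ (fun v => \sum_i c i * dirD (F i) hs v)); last first.
  by apply: filterS ih _; exact: open_nbhs_nbhs.
have dF i : differentiable (dirD (F i) hs) v.
  by apply: smooth_on_differentiable Uv; exact: smooth_on_dirD.
have H : forall s : seq I, differentiable (fun v =>
  \sum_(i <- s) c i * dirD (F i) hs v) v /\
    'D_h (fun v => \sum_(i <- s) c i * dirD (F i) hs v) v = \sum_(i <- s) c i * 'D_h
      (dirD (F i) hs) v.
  elim=> [|i s [d1 e1]].
    have -> : (fun v => \sum_(i <- [::]) c i * dirD (F i) hs v) = cst 0.
      by apply/funext => w; rewrite big_nil.
    by rewrite big_nil derive_cst; split; [exact: differentiable_cst|].
  have -> : (fun v => \sum_(j <- i :: s) c j * dirD (F j) hs v) =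
     c i \*: dirD (F i) hs + (fun v => \sum_(j <- s) c j * dirD (F j) hs v).
    by apply/funext => w; rewrite big_cons.
  have dc : differentiable (c i \*: dirD (F i) hs) v by exact: differentiableZ.
  split; first exact: differentiableD.
  rewrite deriveD; [|exact: diff_derivable|exact: diff_derivable].
  by rewrite deriveZ ?e1 ?big_cons //; exact: diff_derivable.
by have [] := H (index_enum I).
Qed.

Lemma is_derive_line (G : V -> R) (v h : V) (s : R) : differentiable G (v + s *: h) ->
  is_derive s 1 (fun s : R => G (v + s *: h)) ('D_h G (v + s *: h)).
Proof.
move=> dG; have := @diff_derivable _ _ _ G _ h dG.
have E : (fun t : R => t^-1 *: (G (v + (t *: 1 + s) *: h) - G (v + s *: h))) =
    (fun t : R => t^-1 *: (G (t *: h + (v + s *: h)) - G (v + s *: h))).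
  apply/funext => t; congr (_ *: (G _ - _)).
  by rewrite [t *: 1]mulr1 scalerDl addrCA.
by rewrite /derivable => dd; split; rewrite /derivable /derive /= E.
Qed.

(** Entrywise closeness among lists of equal length: joint continuity in the base point and in any
    number of directions becomes convergence along one filter. *)
Definition seq_nbhs (hs : seq V) (v : V) : set_system (seq V * V) :=
  [set A | exists2 e : R, 0 < e & forall hs' v', size hs' = size hs ->
    (forall i, (i < size hs)%N -> `|nth 0 hs i - nth 0 hs' i| < e) ->
    `|v - v'| < e -> A (hs', v')].

Lemma seq_nbhs_filter hs v : Filter (seq_nbhs hs v).
Proof.
split; first by exists 1.
  move=> A B [e e0 He] [e' e0' He']; exists (Num.min e e').
    by rewrite lt_min e0.
  move=> hs' v' sz H; rewrite lt_min => /andP[H1 H2]; split.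
    by apply: He => // i /H; rewrite lt_min => /andP[].
  by apply: He' => // i /H; rewrite lt_min => /andP[].
by move=> A B AB [e e0 He]; exists e => // hs' v' *; apply/AB/He.
Qed.

Variables (I : finType) (e : I -> V) (l : I -> V -> R).
Hypothesis expand : forall h, h = \sum_i l i h *: e i.
Hypothesis l_cont : forall i, continuous (l i).

Lemma derive_expand (F : V -> R) h v : differentiable F v ->
  'D_h F v = \sum_i l i h * 'D_(e i) F v.
Proof.
move=> dF; rewrite deriveE // {1}(expand h) linear_sum; apply: eq_bigr => i _.
by rewrite linearZ deriveE.
Qed.

(* Expanding the first direction in a basis makes the joint continuity in the
   base point and the directions follow from that in the remaining ones. *)
Lemma dirD_continuous (U : set V) F hs v : open U -> smooth_on U F -> U v ->
  (fun p => dirD F p.1 p.2) @ seq_nbhs hs v --> dirD F hs v.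
Proof.
move=> oU; elim/last_ind: hs F => [|hs h ih] F sF Uv.
  have cF : {for v, continuous F} by exact: (sF 0%N).
  move=> A /= /cF/nbhs_ballP[r r0 rA]; exists r => //= hs' v' /size0nil -> _ vv'.
  by apply: rA; rewrite -ball_normE.
have FF := seq_nbhs_filter (rcons hs h) v.
(* The last entry of the list is the innermost direction. Only its coordinates depend on it; the
   functions ['D_(e i) F] are fixed and smooth, and the induction hypothesis treats the entries
   before it. *)
pose G (p : seq V * V) := \sum_i l i (nth 0 p.1 (size hs)) * dirD ('D_(e i) F) (take
  (size hs) p.1) p.2.
have GE hs' h' v' : size hs' = size hs -> U v' -> dirD F (rcons hs' h') v' = G
  (rcons hs' h', v').
  move=> sz Uv'; rewrite dirD_rcons /G /= nth_rcons sz ltnn eqxx -cats1 -sz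
    take_size_cat //.
  rewrite (@dirD_ext U _ (fun v => \sum_i l i h' * 'D_(e i) F v)) //.
    by apply: (@dirD_sum U) => // i; exact: smooth_on_derive.
  by move=> w Uw; apply: derive_expand; exact: smooth_on_differentiable Uw.
have near_E : seq_nbhs (rcons hs h) v [set p | G p = dirD F p.1 p.2].
  have /nbhs_ballP[r r0 rU] : nbhs v U by exact: open_nbhs_nbhs.
  exists r => // hs' v' sz _ vv' /=; case/lastP: hs' sz => [|hs' h'] /=.
    by rewrite size_rcons.
  by rewrite !size_rcons => -[sz]; rewrite -GE //; apply: rU; rewrite -ball_normE.
apply: (@cvg_trans _ (G @ seq_nbhs (rcons hs h) v)).
  exact: (@near_eq_cvg _ _ _ FF).
have -> : dirD F (rcons hs h) v = \sum_i l i h * dirD ('D_(e i) F) hs v.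
  by rewrite GE // /G /= nth_rcons ltnn eqxx -cats1 take_size_cat.
have cvgi i : (fun p : seq V * V => l i (nth 0 p.1 (size hs)) * dirD ('D_(e i) F)
  (take (size hs) p.1) p.2)
    @ seq_nbhs (rcons hs h) v --> l i h * dirD ('D_(e i) F) hs v.
  apply: cvgM.
    move=> A /(@l_cont i h) /nbhs_ballP [r /= r0 rA]; exists r => // hs' v' _ H _ /=.
    apply: rA; rewrite -ball_normE /=; have := H (size hs).
    by rewrite size_rcons nth_rcons ltnn eqxx => /(_ (leqnn _)).
  move=> A /(ih _ (smooth_on_derive (e i) sF) Uv) [r r0 rA];
    exists r => // hs' v' sz H vv' /=.
  rewrite size_rcons in sz H; apply: rA => //; first by rewrite size_takel // sz.
  move=> j jhs; rewrite nth_take //; have := H j; rewrite nth_rcons jhs; apply.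
  exact: ltnW.
rewrite /G; elim: (index_enum I) => [|i s ihs].
  rewrite big_nil; under [X in X @ _]funext do rewrite big_nil.
  by move=> A /nbhs_singleton A0; exists 1.
rewrite big_cons; under [X in X @ _]funext do rewrite big_cons.
exact: (cvgD (cvgi i) ihs).
Qed.

End DirectionalDerivatives.

Section MeanValue.
Context {R : realType}.

(** A mean value theorem for [t] of either sign, with the intermediate point controlled through its
    absolute value. *)
Lemma MVT_sym (g dg : R -> R) (t : R) :
  (forall s, `|s| <= `|t| -> is_derive (s : R) 1 g (dg s)) ->
  exists2 c, `|c| <= `|t| & g t - g 0 = t * dg c.
Proof.
move=> gd.
have cg s : `|s| <= `|t| -> {for s, continuous g}.
  by move=> /gd [ds _]; apply: differentiable_continuous; exact/derivable1_diffP.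
have [t0|t0] := leP 0 t.
  have tt s : s \in `[0, t] -> `|s| <= `|t|.
    by rewrite in_itv /= => /andP[s0 st]; rewrite !ger0_norm.
  have gd' s : s \in `]0, t[ -> is_derive s 1 g (dg s).
    by move=> st; apply: gd; apply: tt; exact: subset_itv_oo_cc st.
  have cg' : {within `[0, t], continuous g}.
    by apply: continuous_in_subspaceT => s /set_mem /tt /cg.
  have [c ct E] := MVT_segment t0 gd' cg'.
  by exists c; [exact: tt|rewrite E subr0 mulrC].
have tt s : s \in `[t, 0] -> `|s| <= `|t|.
  by rewrite in_itv /= => /andP[st s0]; rewrite !ler0_norm ?lerN2 // ltW.
have gd' s : s \in `]t, 0[ -> is_derive s 1 g (dg s).
  by move=> st; apply: gd; apply: tt; exact: subset_itv_oo_cc st.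
have cg' : {within `[t, 0], continuous g}.
  by apply: continuous_in_subspaceT => s /set_mem /tt /cg.
have [c ct E] := MVT_segment (ltW t0) gd' cg'.
by exists c; [exact: tt|rewrite -[LHS]opprB E sub0r; ring].
Qed.

End MeanValue.

Lemma continuous_near_dist (R : realType) (V : normedModType R) (X : topologicalType)
  (u : X -> V) (x : X) (r : R) : {for x, continuous u} -> 0 < r ->
  \forall y \near x, `|u x - u y| < r.
Proof. by move=> cu r0; have := cu _ (nbhsx_ballx _ _ r0); rewrite -ball_normE. Qed.

Section UniformDirD.
Context {R : realType} {V : normedModType R} {X : topologicalType}.
Variables (I : finType) (e : I -> V) (l : I -> V -> R).
Hypothesis expand : forall h, h = \sum_i l i h *: e i.
Hypothesis l_cont : forall i, continuous (l i).
Variables (U : set V) (F : V -> R) (K : set X).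
Hypotheses (oU : open U) (sF : smooth_on U F) (cK : compact K).

(** Half of the tolerance absorbs the passage from [x] to [y], the other half the perturbation of
    the values at [y]. The conclusion has the local form from which compactness extracts a uniform
    radius. *)
Lemma dirD_near (u : X -> V) (hs : seq (X -> V)) (x : X) :
  {for x, continuous u} -> (forall i, (i < size hs)%N -> {for x, continuous (nth (fun=>
    0) hs i)}) ->
  forall A, seq_nbhs [seq h x | h <- hs] (u x) A ->
  \forall y \near x & r \near 0^'+, forall hs' v', size hs' = size hs ->
    (forall i, (i < size hs)%N -> `|nth (fun=> 0) hs i y - nth 0 hs' i| < r) ->
    `|u y - v'| < r -> A (hs', v').
Proof.
move=> cu chs A [d d0 dA].
have d2 : 0 < d / 2 by rewrite divr_gt0.
have nu : \forall y \near x, `|u x - u y| < d / 2.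
  exact: continuous_near_dist.
have nh : \forall y \near x, forall i : 'I_(size hs),
    `|nth (fun=> 0) hs i x - nth (fun=> 0) hs i y| < d / 2.
  apply: filter_forall => i; have := chs i (ltn_ord i) => ci.
  exact: (continuous_near_dist ci).
exists ([set y | `|u x - u y| < d / 2 /\ forall i : 'I_(size hs),
    `|nth (fun=> 0) hs i x - nth (fun=> 0) hs i y| < d / 2], [set r | r <= d / 2]).
  split=> /=; first exact: filterI.
  exact: nbhs_right_le.
move=> [y r] [/= [uy hy] rd] hs' v' sz H uv; apply: dA.
- by rewrite size_map.
- move=> i; rewrite size_map => ihs; rewrite (nth_map (fun=> 0)) //.
  rewrite (splitr d) -(subrKA (nth (fun=> 0) hs i y)) (le_lt_trans (ler_normD _ _)) //.
  by rewrite ltrD ?(hy (Ordinal ihs)) // (lt_le_trans (H i ihs)).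
- rewrite (splitr d) -(subrKA (u y)) (le_lt_trans (ler_normD _ _)) //.
  by rewrite ltrD // (lt_le_trans uv).
Qed.

(** The perturbed values [hs'] and [v'] are arbitrary vectors and not values of fields. One
    statement thus covers nearby points (continuity of integrands), nearby fields (continuity of
    functionals) and segments [u + s h] (differentiation). *)
Lemma dirD_uniform (u : X -> V) (hs : seq (X -> V)) (eps : R) : 0 < eps ->
  (forall x, K x -> {for x, continuous u}) -> (forall x, K x -> U (u x)) ->
  (forall x i, K x -> (i < size hs)%N -> {for x, continuous (nth (fun=> 0) hs i)}) ->
  \forall r \near 0^'+, forall x, K x -> forall hs' v', size hs' = size hs ->
    (forall i, (i < size hs)%N -> `|nth (fun=> 0) hs i x - nth 0 hs' i| < r) ->
    `|u x - v'| < r ->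
    U v' /\ `|dirD F [seq h x | h <- hs] (u x) - dirD F hs' v'| < eps.
Proof.
move=> e0 cu Uu chs.
pose Q (r : R) (x : X) := forall hs' v', size hs' = size hs ->
    (forall i, (i < size hs)%N -> `|nth (fun=> 0) hs i x - nth 0 hs' i| < r) ->
    `|u x - v'| < r ->
    U v' /\ `|dirD F [seq h x | h <- hs] (u x) - dirD F hs' v'| < eps.
have := iffLR (compact_near_coveringP K) cK _ (0 : R)^'+ Q _.
apply=> x Kx.
have e2 : 0 < eps / 2 by rewrite divr_gt0.
have H : seq_nbhs [seq h x | h <- hs] (u x)
    [set p | U p.2 /\ `|dirD F [seq h x | h <- hs] (u x) - dirD F p.1 p.2| < eps / 2].
  have FF := seq_nbhs_filter [seq h x | h <- hs] (u x).
  apply: filterI.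
    have /nbhs_ballP[r r0 rU] : nbhs (u x) U by apply: open_nbhs_nbhs; split => //;
      exact: Uu.
    by exists r => // hs' v' _ _ vv'; apply: rU; rewrite -ball_normE.
  have /cvgr_dist_lt := dirD_continuous (hs := [seq h x | h <- hs]) expand l_cont oU sF
    (Uu x Kx).
  by move=> /(_ _ e2).
have [[/= N1 N2] [/= n1 n2] N12] := dirD_near (cu x Kx) (fun i => chs x i Kx) H.
exists (N1, N2 `&` [set r | 0 < r]).
  by split=> //=; apply: filterI => //; exact: nbhs_right_gt.
move=> [y r] [/= y1 [r2 r0]] hs' v' sz H1 H2.
have [Uy Hy] : U (u y) /\ `|dirD F [seq h x | h <- hs] (u x) -
    dirD F [seq h y | h <- hs] (u y)| < eps / 2.
  apply: (N12 (y, r) (conj y1 r2)); first by rewrite size_map.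
    by move=> i ihs; rewrite (nth_map (fun=> 0)) // subrr normr0.
  by rewrite subrr normr0.
have [Uv Hv] := N12 (y, r) (conj y1 r2) hs' v' sz H1 H2.
split=> //; rewrite (splitr eps) -(subrKA (dirD F [seq h x | h <- hs] (u x))).
by rewrite (le_lt_trans (ler_normD _ _)) // ltrD // distrC.
Qed.

End UniformDirD.

(** * Iterated derivatives of integral functionals of two tensor fields *)

Section IntegralFunctional.
Context {R : realType} {d : nat} {M : smoothManifold R d}.
Variable P : partition_of_unity M.
Hypothesis cM : compact [set: M].
Local Notation V := ('M[R]_d * 'M[R]_d)%type.
Local Notation tensor2 := (tensor M * tensor M)%type.

Definition mx2_basis (b : ('I_d * 'I_d) + ('I_d * 'I_d)) : V :=
  match b with
  | inl ij => (delta_mx ij.1 ij.2, 0)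
  | inr ij => (0, delta_mx ij.1 ij.2)
  end.

Definition mx2_coord (b : ('I_d * 'I_d) + ('I_d * 'I_d)) (h : V) : R :=
  match b with
  | inl ij => h.1 ij.1 ij.2
  | inr ij => h.2 ij.1 ij.2
  end.

Lemma mx2_expand (h : V) : h = \sum_b mx2_coord b h *: mx2_basis b.
Proof.
rewrite big_sumType /=; case: h => A B /=.
have -> : \sum_(i : 'I_d * 'I_d) A i.1 i.2 *: ((delta_mx i.1 i.2, 0) : V) = (A, 0).
  rewrite [in RHS](matrix_sum_delta A) pair_bigA /=.
  elim/big_ind2 : _ => // [x1 x2 y1 y2 -> ->|i _].
    by rewrite /GRing.add /= /add_pair /= addr0.
  by rewrite /GRing.scale /= /scale_pair /= scaler0.
have -> : \sum_(i : 'I_d * 'I_d) B i.1 i.2 *: ((0, delta_mx i.1 i.2) : V) = (0, B).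
  rewrite [in RHS](matrix_sum_delta B) pair_bigA /=.
  elim/big_ind2 : _ => // [x1 x2 y1 y2 -> ->|i _].
    by rewrite /GRing.add /= /add_pair /= addr0.
  by rewrite /GRing.scale /= /scale_pair /= scaler0.
by rewrite /GRing.add /= /add_pair /= addr0 add0r.
Qed.

Lemma mx2_coord_cont b : continuous (mx2_coord b).
Proof.
case: b => ij x /=.
  apply: (@continuous_comp _ _ _ fst (fun A : 'M[R]_d => A ij.1 ij.2));
    first exact: cvg_fst.
  exact: coord_continuous.
apply: (@continuous_comp _ _ _ snd (fun A : 'M[R]_d => A ij.1 ij.2));
  first exact: cvg_snd.
exact: coord_continuous.
Qed.

Definition tensor_ev (u : tensor2) (a : chart M) (y : 'rV[R]_d) : V :=
  (u.1 a y, u.2 a y).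

Definition field_cont (u : tensor2) := forall (i : 'I_(pou_size P)) y,
  pou_supp i y -> {for y, continuous (tensor_ev u (pou_chart i))}.

Variables (U : set V) (F : V -> R).
Hypotheses (oU : open U) (sF : smooth_on U F).

Definition field_in (u : tensor2) := field_cont u /\
  forall (i : 'I_(pou_size P)) y, pou_supp i y -> U (tensor_ev u (pou_chart i) y).

Definition integrand (hs : seq tensor2) (u : tensor2) : scalar_density M :=
  fun a y => dirD F [seq tensor_ev h a y | h <- hs] (tensor_ev u a y).

Lemma field_uniform (u : tensor2) (hs : seq tensor2) (eps : R) : 0 < eps ->
  field_in u -> (forall j, (j < size hs)%N -> field_cont (nth 0 hs j)) ->
  exists2 r : R, 0 < r & forall (i : 'I_(pou_size P)) y, pou_supp i y ->
    forall hs' v', size hs' = size hs ->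
    (forall j, (j < size hs)%N -> `|tensor_ev (nth 0 hs j)
      (pou_chart i) y - nth 0 hs' j| < r) ->
    `|tensor_ev u (pou_chart i) y - v'| < r ->
    U v' /\ `|integrand hs u (pou_chart i) y - dirD F hs' v'| < eps.
Proof.
move=> e0 [cu Uu] chs.
have H (i : 'I_(pou_size P)) : \forall r \near (0 : R)^'+, forall y, pou_supp i y ->
    forall hs' v', size hs' = size hs ->
    (forall j, (j < size hs)%N -> `|tensor_ev (nth 0 hs j)
      (pou_chart i) y - nth 0 hs' j| < r) ->
    `|tensor_ev u (pou_chart i) y - v'| < r ->
    U v' /\ `|integrand hs u (pou_chart i) y - dirD F hs' v'| < eps.
  have := @dirD_uniform _ _ _ _ _ _ mx2_expand mx2_coord_cont U F _ oU sF
    (pou_supp_compact (i := i) cM) (tensor_ev u (pou_chart i))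
    [seq (tensor_ev h (pou_chart i)) | h <- hs] eps e0 (cu i) (Uu i).
  rewrite size_map => /(_ _) HH; have {}HH := HH _.
  apply: filterS (HH _); last first.
    by move=> y j Ky jhs; rewrite (nth_map 0) //; exact: chs.
  move=> r Hr y Ky hs' v' sz H1 H2.
  have [] := Hr y Ky hs' v' sz _ H2.
    by move=> j jhs; rewrite (nth_map 0) //; exact: H1.
  by move=> Uv; rewrite -map_comp.
have [r [r0 Hr]] : exists r : R, 0 < r /\ forall (i : 'I_(pou_size P)) y, pou_supp i y
  ->
    forall hs' v', size hs' = size hs ->
    (forall j, (j < size hs)%N -> `|tensor_ev (nth 0 hs j)
      (pou_chart i) y - nth 0 hs' j| < r) ->
    `|tensor_ev u (pou_chart i) y - v'| < r ->
    U v' /\ `|integrand hs u (pou_chart i) y - dirD F hs' v'| < eps.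
  apply: (@filter_ex _ (0 : R)^'+); apply: filterI; first exact: nbhs_right_gt.
  exact: (filter_forall _ H).
by exists r.
Qed.

Lemma integrand_cont (u : tensor2) (hs : seq tensor2) :
  field_in u -> (forall j, (j < size hs)%N -> field_cont (nth 0 hs j)) ->
  pou_cont P (integrand hs u).
Proof.
move=> uU chs i y Ky; apply/(@cvgrPdist_lt _ _ _ (nbhs y)) => eps e0.
have [r r0 Hr] := field_uniform e0 uU chs.
have [cu _] := uU.
have nu : \forall y' \near y, `|tensor_ev u (pou_chart i) y - tensor_ev u
  (pou_chart i) y'| < r.
  exact: (continuous_near_dist (cu i y Ky) r0).
have nhj (j : 'I_(size hs)) : \forall y' \near y,
    `|tensor_ev (nth 0 hs j) (pou_chart i) y - tensor_ev (nth 0 hs j)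
      (pou_chart i) y'| < r.
  exact: (continuous_near_dist (chs j (ltn_ord j) i y Ky) r0).
have nh := filter_forall _ nhj.
near=> y'.
have [] := Hr i y Ky [seq tensor_ev h (pou_chart i) y' | h <- hs] (tensor_ev u
  (pou_chart i) y').
- by rewrite size_map.
- move=> j jhs; rewrite (nth_map 0) //.
  suff H : forall j : 'I_(size hs), `|tensor_ev (nth 0 hs j) (pou_chart i) y -
      tensor_ev (nth 0 hs j) (pou_chart i) y'| < r by exact: (H (Ordinal jhs)).
  by near: y'; exact: nh.
- by near: y'; exact: nu.
- by [].
Unshelve. all: by end_near. Qed.

Lemma tensor_evD (u h : tensor2) (t : R) a y :
  tensor_ev (u + t *: h) a y = tensor_ev u a y + t *: tensor_ev h a y.
Proof. by []. Qed.

Lemma field_cont_line (u h : tensor2) (t : R) : field_cont u -> field_cont h ->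
  field_cont (u + t *: h).
Proof.
move=> cu ch i y Ky.
have -> : tensor_ev (u + t *: h) (pou_chart i) =
  (fun y => tensor_ev u (pou_chart i) y + t *: tensor_ev h (pou_chart i) y) by [].
by apply: continuousD; [exact: cu|apply: continuousZ;
  [exact: cst_continuous|exact: ch]].
Qed.

Lemma field_bounded (h : tensor2) : field_cont h -> exists2 B : R, 0 < B &
  forall (i : 'I_(pou_size P)) y, pou_supp i y -> `|tensor_ev h (pou_chart i) y| <= B.
Proof.
move=> ch.
have H (i : 'I_(pou_size P)) : \forall B \near +oo, forall y, pou_supp i y ->
  `|tensor_ev h (pou_chart i) y| <= B.
  have cK : compact (tensor_ev h (pou_chart i) @` pou_supp i).
    apply: continuous_compact; last exact: pou_supp_compact.
    by apply: continuous_in_subspaceT => y /set_mem; exact: ch.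
  have [B [_ HB]] := compact_bounded cK.
  exists B; split; first exact: num_real.
  by move=> B' BB' y Ky; apply: (HB B' BB'); exists y.
have [B [B0 HB]] : exists B : R, 0 < B /\ forall (i : 'I_(pou_size P)) y, pou_supp i y
  ->
    `|tensor_ev h (pou_chart i) y| <= B.
  apply: (@filter_ex _ (+oo : set_system R)); apply: filterI;
    first exact: nbhs_pinfty_gt.
  exact: (filter_forall _ H).
by exists B.
Qed.

Lemma field_in_line (u h : tensor2) : field_in u -> field_cont h ->
  \forall t \near (0 : R), field_in (u + t *: h).
Proof.
move=> uU ch; have [cu _] := uU; have [B B0 HB] := field_bounded ch.
(* Only the membership in [U] is wanted, hence the empty list of directions and the arbitrary
   tolerance 1. *)
have [r r0 Hr] := field_uniform (hs := [::]) ltr01 uU (fun j (H : (j < 0)%N) =>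
  match notF H with end).
have rB : 0 < r / B by exact: divr_gt0.
have nt : \forall t \near (0 : R), `|t| < r / B.
  by have := nbhsx_ballx (0 : R) _ rB; apply: filterS => t;
    rewrite -ball_normE /= sub0r normrN.
near=> t; split; first exact: field_cont_line.
move=> i y Ky; have [] := Hr i y Ky [::] (tensor_ev (u + t *: h)
  (pou_chart i) y) erefl => //.
rewrite tensor_evD opprD addrA subrr add0r normrN normrZ.
apply: (@le_lt_trans _ _ (`|t| * B)); first by rewrite ler_wpM2l //; exact: HB.
by rewrite -ltr_pdivlMr //; near: t; exact: nt.
Unshelve. all: by end_near. Qed.

(** The candidate derivative minus the difference quotient is a single integral. By the mean value
    theorem its integrand at each point is a derivative of [F] at [v] minus the same one at
    [v + c k] with [|c| <= |t|]; this is uniformly small, and integrals are bounded by a constant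
    times the supremum. *)
Lemma is_derive_pou_integral (u h : tensor2) (hs : seq tensor2) :
  field_in u -> field_cont h -> (forall j, (j < size hs)%N -> field_cont
    (nth 0 hs j)) ->
  is_derive (0 : R) 1 (fun t : R => pou_integral P (integrand hs (u + t *: h)))
    (pou_integral P (integrand (h :: hs) u)).
Proof.
move=> uU ch chs.
have chs' j : (j < size (h :: hs))%N -> field_cont (nth 0 (h :: hs) j).
  by case: j => //= j; exact: chs.
have [B B0 HB] := field_bounded ch.
have [C C0 HC] := pou_integral_bound P cM.
have lim : (fun t : R => t^-1 *: (pou_integral P (integrand hs (u +
  (t *: 1 + 0) *: h)) -
    pou_integral P (integrand hs (u + 0 *: h)))) @ (0 : R)^' -->
    pou_integral P (integrand (h :: hs) u).
  apply/cvgrPdist_le => eps e0.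
  have C1 : 0 < C + 1 by rewrite ltr_wpDl.
  have e1 : 0 < eps / (C + 1) by exact: divr_gt0.
  have [r r0 Hr] := field_uniform e1 uU chs'.
  have nU : \forall t \near (0 : R)^', field_in (u + t *: h).
    by apply: cvg_within; exact: field_in_line.
  near=> t.
  have t0 : t != 0 by near: t; exact: nbhs_dnbhs_neq.
  have tU : field_in (u + t *: h) by near: t; exact: nU.
  have tr : `|t| * B < r.
    by rewrite -ltr_pdivlMr //; near: t; apply: dnbhs0_lt; exact: divr_gt0.
  rewrite addr0 [t *: 1]mulr1 scale0r addr0.
  have c1 := integrand_cont uU chs'; have c2 := integrand_cont uU chs.
  have c3 := integrand_cont tU chs.
  have c4 : pou_cont P (fun a y => (-1) * integrand hs u a y + integrand hs
    (u + t *: h) a y).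
    move=> i y Ky; apply: continuousD; last exact: c3.
    by apply: continuousM; [exact: cst_continuous|exact: c2].
  have c5 : pou_cont P (fun a y => (- t^-1) * ((-1) * integrand hs u a y + integrand hs
    (u + t *: h) a y) + integrand (h :: hs) u a y).
    move=> i y Ky; apply: continuousD; last exact: c1.
    by apply: continuousM; [exact: cst_continuous|exact: c4].
  have -> : pou_integral P (integrand (h :: hs) u) - t^-1 *: (pou_integral P
    (integrand hs (u + t *: h)) -
    pou_integral P (integrand hs u)) = pou_integral P (fun a y =>
     (- t^-1) * ((-1) * integrand hs u a y + integrand hs
       (u + t *: h) a y) + integrand (h :: hs) u a y).
    rewrite (pou_integral_lin cM (- t^-1) c4 c1) (pou_integral_lin cM (-1) c2 c3).
    by rewrite /GRing.scale /=; ring.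
  apply: le_trans (HC _ (eps / (C + 1)) (ltW e1) c5 _) _; last first.
    by rewrite mulrCA -[leRHS]mulr1 ler_pM2l // ler_pdivrMr // mul1r lerDl.
  move=> i y Ky; apply: ltW.
  set v := tensor_ev u (pou_chart i) y; set k := tensor_ev h (pou_chart i) y.
  set ks := [seq tensor_ev h (pou_chart i) y | h <- hs].
  (* The whole segment up to [t] stays in [U], where [F] is smooth, as the mean value theorem
     demands. *)
  have Hs (s : R) : `|s| <= `|t| -> U (v + s *: k) /\
      `|dirD F (k :: ks) v - dirD F (k :: ks) (v + s *: k)| < eps / (C + 1).
    move=> st; have := Hr i y Ky (k :: ks) (v + s *: k).
    rewrite /= size_map => /(_ erefl) HH; apply: HH.
      case=> [|j] jhs /=; first by rewrite subrr normr0.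
      by rewrite (nth_map 0) // subrr normr0.
    rewrite opprD addrA subrr add0r normrN normrZ.
    apply: le_lt_trans tr; apply: ler_pM => //; exact: HB.
  have gd (s : R) : `|s| <= `|t| -> is_derive s 1 (fun s : R => dirD F ks (v + s *: k))
      (dirD F (k :: ks) (v + s *: k)).
    move=> /Hs [Us _]; apply: is_derive_line.
    by apply: smooth_on_differentiable Us; exact: smooth_on_dirD.
  have [c ct E] := MVT_sym gd.
  have [_] := Hs c ct.
  rewrite /integrand tensor_evD -/v -/k -/ks [in X in X -> _]distrC => Hc.
  have -> : - t^-1 * (-1 * dirD F ks v + dirD F ks (v + t *: k)) +
     dirD F [seq tensor_ev h0 (pou_chart i) y | h0 <- h :: hs] v =
     dirD F (k :: ks) v - dirD F (k :: ks) (v + c *: k).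
    rewrite scale0r addr0 in E; rewrite mulN1r [- _ + dirD _ _ _]addrC E.
    by rewrite mulNr mulrA mulVf // mul1r addrC.
  by rewrite distrC.
split; first by apply/cvg_ex; exists (pou_integral P (integrand (h :: hs) u)).
exact: cvg_lim.
Unshelve. all: by end_near. Qed.

Lemma pou_integral_continuous (u : tensor2) (hs : seq tensor2) (eps : R) : 0 < eps ->
  field_in u -> (forall j, (j < size hs)%N -> field_cont (nth 0 hs j)) ->
  exists2 r : R, 0 < r & forall (u' : tensor2) (hs' : seq tensor2),
    field_in u' -> (forall j, (j < size hs)%N -> field_cont (nth 0 hs' j)) ->
    size hs' = size hs ->
    (forall (i : 'I_(pou_size P)) y, pou_supp i y ->
      `|tensor_ev u (pou_chart i) y - tensor_ev u' (pou_chart i) y| < r /\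
      forall j, (j < size hs)%N -> `|tensor_ev (nth 0 hs j) (pou_chart i) y -
        tensor_ev (nth 0 hs' j) (pou_chart i) y| < r) ->
    `|pou_integral P (integrand hs u) - pou_integral P (integrand hs' u')| < eps.
Proof.
move=> e0 uU chs.
have [C C0 HC] := pou_integral_bound P cM.
have C1 : 0 < C + 1 by rewrite ltr_wpDl.
have e1 : 0 < eps / (C + 1) by exact: divr_gt0.
have [r r0 Hr] := field_uniform e1 uU chs.
exists r => // u' hs' u'U chs' sz H.
have c1 := integrand_cont uU chs.
have c2 : pou_cont P (integrand hs' u') by apply: integrand_cont => // j; rewrite sz;
  exact: chs'.
rewrite -mulN1r addrC -(pou_integral_lin cM (-1) c2 c1).
apply: le_lt_trans (HC _ (eps / (C + 1)) (ltW e1) _ _) _.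
- move=> i y Ky; apply: continuousD; last exact: c1.
  by apply: continuousM; [exact: cst_continuous|exact: c2].
- move=> i y Ky; rewrite mulN1r addrC; apply: ltW.
  have [H1 H2] := H i y Ky.
  have [] := Hr i y Ky [seq tensor_ev h (pou_chart i) y | h <- hs'] (tensor_ev u'
    (pou_chart i) y) => //.
    by rewrite size_map.
  by move=> j jhs; rewrite (nth_map 0) ?sz //; exact: H2.
- by rewrite mulrCA -[ltRHS]mulr1 ltr_pM2l // ltr_pdivrMr // mul1r ltrDl.
Qed.

(* [D] need only be given by the integral where the fields take their values in
   [U], a condition that is open along lines. *)
Lemma dir_derive_pou_integral (D : tensor2 -> R) (hs : seq tensor2) :
  (forall u, field_in u -> D u = pou_integral P (integrand [::] u)) ->
  (forall j, (j < size hs)%N -> field_cont (nth 0 hs j)) ->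
  forall u, field_in u -> dir_derive D hs u = pou_integral P (integrand hs u).
Proof.
move=> DE; elim: hs => [|h hs ih] chs u uU /=; first exact: DE.
have chs' j : (j < size hs)%N -> field_cont (nth 0 hs j) by move=> jhs;
  exact: (chs j.+1).
have ch : field_cont h by exact: (chs 0%N).
rewrite derive1E.
have [_ <-] := is_derive_pou_integral uU ch chs'.
apply: near_eq_derive; have := field_in_line uU ch; apply: filterS => t.
exact: ih.
Qed.

Lemma derivable_dir_derive (D : tensor2 -> R) (hs : seq tensor2) u h :
  (forall u, field_in u -> D u = pou_integral P (integrand [::] u)) ->
  (forall j, (j < size hs)%N -> field_cont (nth 0 hs j)) ->
  field_in u -> field_cont h ->
  is_derive (0 : R) 1 (fun t : R => dir_derive D hs (u + t *: h))
    (pou_integral P (integrand (h :: hs) u)).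
Proof.
move=> DE chs uU ch.
apply: near_eq_is_derive (is_derive_pou_integral uU ch chs).
have := field_in_line uU ch; apply: filterS => t tU.
by apply/esym; exact: dir_derive_pou_integral.
Qed.

End IntegralFunctional.

(** * The integrand as a function of two matrices *)

Section RealDerivatives.
Context {R : realType}.
Implicit Types (f g : R -> R) (x a b c : R).

Lemma is_derive_fD f g x a b : is_derive x 1 f a -> is_derive x 1 g b ->
  is_derive x 1 (fun t => f t + g t) (a + b).
Proof. exact: is_deriveD. Qed.

Lemma is_derive_fB f g x a b : is_derive x 1 f a -> is_derive x 1 g b ->
  is_derive x 1 (fun t => f t - g t) (a - b).
Proof. exact: is_deriveB. Qed.

Lemma is_derive_fM f g x a b : is_derive x 1 f a -> is_derive x 1 g b ->
  is_derive x 1 (fun t => f t * g t) (f x * b + g x * a).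
Proof. exact: is_deriveM. Qed.

Lemma is_derive_fZ f x a c : is_derive x 1 f a ->
  is_derive x 1 (fun t => c * f t) (c * a).
Proof. exact: is_deriveZ. Qed.

Lemma is_derive_fexp f x a : is_derive x 1 f a ->
  is_derive x 1 (fun t => expR (f t)) (expR (f x) * a).
Proof. by move=> fa; exact: (is_derive1_comp (is_derive_expR (f x)) fa). Qed.

Lemma is_derive_fln f x a : 0 < f x -> is_derive x 1 f a ->
  is_derive x 1 (fun t => ln (f t)) ((f x)^-1 * a).
Proof. by move=> f0 fa; exact: (is_derive1_comp (is_derive1_ln f0) fa). Qed.

Lemma is_derive_fcst x c : is_derive x 1 (fun=> c) 0.
Proof. exact: is_derive_cst. Qed.

Lemma is_derive_tr_line n (B A H : 'M[R]_n) (x : R) :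
  is_derive x 1 (fun t : R => \tr (B *m (A + t *: H))) (\tr (B *m H)).
Proof.
have -> : (fun t : R => \tr (B *m (A + t *: H))) =
    (fun t => \tr (B *m A) + \tr (B *m H) * t).
  by apply/funext => t; rewrite mulmxDr -scalemxAr linearD /= linearZ /= mulrC.
apply: (is_derive_eq (is_derive_fD (is_derive_fcst _ _)
  (is_derive_fZ _ (is_derive_id _ _)))).
by rewrite add0r mulr1.
Qed.

Lemma is_derive_ln_det n (A H : 'M[R]_n) : 0 < \det A ->
  is_derive (0 : R) 1 (fun t : R => ln (\det (A + t *: H))) (\tr (invmx A *m H)).
Proof.
move=> A0; have uA : A \in unitmx by rewrite unitmxE unitfE gt_eqF.
have dA := is_derive_det H uA.
have A0' : 0 < \det (A + (0 : R) *: H) by rewrite scale0r addr0.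
apply: (is_derive_eq (is_derive_fln A0' dA)).
by rewrite scale0r addr0 mulrA mulVf ?mul1r // gt_eqF.
Qed.

End RealDerivatives.

Section Integrand.
Context {R : realType} {d : nat}.
Hypothesis d0 : (0 < d)%N.
Local Notation V := ('M[R]_d * 'M[R]_d)%type.

(** Positive definite matrices are symmetric and so form no open set of matrices when [d > 1]; this
    larger domain is open in the space where the derivatives are taken. *)
Definition det_pos : set V := [set v | 0 < \det v.1 /\ 0 < \det v.2].

Lemma Ck_on_fst n (O : set V) : Ck_on n O (fun v : V => v.1).
Proof. by apply: (@Ck_on_linear _ _ _ _ _ (@fst 'M[R]_d 'M[R]_d : {linear V ->
  'M[R]_d})) => v; exact: cvg_fst. Qed.

Lemma Ck_on_snd n (O : set V) : Ck_on n O (fun v : V => v.2).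
Proof. by apply: (@Ck_on_linear _ _ _ _ _ (@snd 'M[R]_d 'M[R]_d : {linear V ->
  'M[R]_d})) => v; exact: cvg_snd. Qed.

Lemma Ck_on_det_fst n (O : set V) : open O -> Ck_on n O (fun v : V => \det v.1).
Proof. by move=> oO; apply: Ck_on_det => //; apply/Ck_on_mx => //; exact: Ck_on_fst.
  Qed.

Lemma Ck_on_det_snd n (O : set V) : open O -> Ck_on n O (fun v : V => \det v.2).
Proof. by move=> oO; apply: Ck_on_det => //; apply/Ck_on_mx => //; exact: Ck_on_snd.
  Qed.

Lemma open_det_pos : open det_pos.
Proof.
have -> : det_pos = (fun v : V => \det v.1) @^-1` [set x | 0 < x] `&`
    (fun v : V => \det v.2) @^-1` [set x | 0 < x] by [].
by apply: openI; apply: open_comp => // v _;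
  [exact: (@Ck_on_det_fst 0 _ openT v I)|exact: (@Ck_on_det_snd 0 _ openT v I)].
Qed.

Definition lndet1 (v : V) : R := ln (\det v.1).
Definition lndet2 (v : V) : R := ln (\det v.2).
Definition tr_ratio (v : V) : R := \tr (invmx v.2 *m v.1).

(** If [x] and [y] are half the logarithms of the two determinants, the volumes are [e^x] and [e^y],
    and the three parts are the three terms of the Kullback-Leibler integrand. In [shape_part] the
    power [2 / d] of the volume ratio is [e^(2 (x - y) / d)]. *)
Definition kl_part1 (v : V) := 2^-1 * (lndet1 v - lndet2 v) * expR (2^-1 * lndet1 v).
Definition kl_part2 (v : V) := expR (2^-1 * lndet2 v).
Definition kl_part3 (v : V) := expR (2^-1 * lndet1 v).
Definition shape_part (v : V) :=
  (tr_ratio v - d%:R * expR (d%:R^-1 * (lndet1 v - lndet2 v))) * expR (2^-1 * lndet2 v).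

Definition kl_integrand (v : V) : R :=
  2 / d%:R * (kl_part1 v + kl_part2 v - kl_part3 v) + 2^-1 * shape_part v.

Lemma smooth_lndet1 : smooth_on det_pos lndet1.
Proof.
move=> n; apply: (@Ck_on_comp _ _ _ _ [set x | 0 < x] (fun v : V => \det v.1)).
- exact: open_det_pos.
- by move=> v [].
- by apply: Ck_on_det_fst; exact: open_det_pos.
- exact: Ck_on_ln.
Qed.

Lemma smooth_lndet2 : smooth_on det_pos lndet2.
Proof.
move=> n; apply: (@Ck_on_comp _ _ _ _ [set x | 0 < x] (fun v : V => \det v.2)).
- exact: open_det_pos.
- by move=> v [].
- by apply: Ck_on_det_snd; exact: open_det_pos.
- exact: Ck_on_ln.
Qed.

Lemma smooth_tr_ratio : smooth_on det_pos tr_ratio.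
Proof.
have oU := open_det_pos; move=> n; apply: Ck_on_tr => //.
apply: (@Ck_on_mulmx _ _ _ _ _ _ _ (fun v : V => invmx v.2) (fun v : V => v.1)) => //.
  apply: (@Ck_on_invmx _ _ _ _ _ (fun v : V => v.2)) => //.
    by move=> v [_ v2]; rewrite gt_eqF.
  exact: Ck_on_snd.
exact: Ck_on_fst.
Qed.

Lemma smooth_expZ (c : R) (f : V -> R) : smooth_on det_pos f ->
  smooth_on det_pos (fun v => expR (c * f v)).
Proof.
have oU := open_det_pos; move=> sf n.
apply: (@Ck_on_comp _ _ _ _ setT (fun v : V => c * f v)) => //.
  by apply: Ck_onM => //; exact: Ck_on_cst.
exact: Ck_on_expR.
Qed.

Lemma smooth_sub (f g : V -> R) : smooth_on det_pos f -> smooth_on det_pos g ->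
  smooth_on det_pos (fun v => f v - g v).
Proof.
have oU := open_det_pos; move=> sf sg n.
by apply: Ck_onD => //; apply: Ck_onN.
Qed.

Lemma smooth_kl_part1 : smooth_on det_pos kl_part1.
Proof.
have oU := open_det_pos; move=> n; apply: Ck_onM => //.
  apply: Ck_onM => //; first exact: Ck_on_cst.
  by apply: smooth_sub; [exact: smooth_lndet1|exact: smooth_lndet2].
by apply: smooth_expZ; exact: smooth_lndet1.
Qed.

Lemma smooth_kl_part2 : smooth_on det_pos kl_part2.
Proof. by apply: smooth_expZ; exact: smooth_lndet2. Qed.

Lemma smooth_kl_part3 : smooth_on det_pos kl_part3.
Proof. by apply: smooth_expZ; exact: smooth_lndet1. Qed.

Lemma smooth_shape_part : smooth_on det_pos shape_part.
Proof.
have oU := open_det_pos; move=> n; apply: Ck_onM => //; last exact: smooth_kl_part2.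
apply: (@smooth_sub _ (fun v => d%:R * expR (d%:R^-1 * (lndet1 v - lndet2 v)))).
  exact: smooth_tr_ratio.
move=> k; apply: Ck_onM => //; first exact: Ck_on_cst.
apply: (@smooth_expZ _ (fun v => lndet1 v - lndet2 v)).
by apply: smooth_sub; [exact: smooth_lndet1|exact: smooth_lndet2].
Qed.

Lemma smooth_kl_integrand : smooth_on det_pos kl_integrand.
Proof.
have oU := open_det_pos; move=> n; apply: Ck_onD => //.
  apply: Ck_onM => //; first exact: Ck_on_cst.
  apply: (@smooth_sub (fun v => kl_part1 v + kl_part2 v) kl_part3);
    last exact: smooth_kl_part3.
  by move=> k; apply: Ck_onD => //; [exact: smooth_kl_part1|exact: smooth_kl_part2].
by apply: Ck_onM => //; [exact: Ck_on_cst|exact: smooth_shape_part].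
Qed.

Lemma sqrt_expR (x : R) : 0 < x -> Num.sqrt x = expR (2^-1 * ln x).
Proof. by move=> x0; rewrite -powR12_sqrt ?ltW // /powR gt_eqF. Qed.

Lemma ln_vol_ratio (x y : R) : 0 < x -> 0 < y ->
  ln (Num.sqrt x / Num.sqrt y) = 2^-1 * (ln x - ln y).
Proof. by move=> x0 y0; rewrite !sqrt_expR // -expRB expRK mulrBr. Qed.

Lemma powR_vol_ratio (x y : R) : 0 < x -> 0 < y ->
  (Num.sqrt x / Num.sqrt y) `^ (2 / d%:R) = expR (d%:R^-1 * (ln x - ln y)).
Proof.
move=> x0 y0; rewrite /powR gt_eqF ?divr_gt0 ?sqrtr_gt0 // ln_vol_ratio //.
by congr expR; rewrite mulrCA mulrA mulrA mulVf ?mul1r // pnatr_eq0.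
Qed.

(** The expression factors as [e^x (e^z - 1 - z)] with [z = y - x], so this is the convexity
    inequality for the exponential; its strict form gives [kl_eq0]. *)
Lemma kl_pos (x y : R) : 0 <= (x - y) * expR x + expR y - expR x.
Proof.
have -> : expR y = expR x * expR (y - x) by rewrite -expRD addrC subrK.
have H := expR_ge1Dx (y - x); have Hx := expR_gt0 x.
have -> : (x - y) * expR x + expR x * expR (y - x) - expR x =
  expR x * (expR (y - x) - (1 + (y - x))) by ring.
by rewrite mulr_ge0 ?expR_ge0 // subr_ge0.
Qed.

Lemma kl_eq0 (x y : R) : (x - y) * expR x + expR y - expR x = 0 -> x = y.
Proof.
have -> : expR y = expR x * expR (y - x) by rewrite -expRD addrC subrK.
have -> : (x - y) * expR x + expR x * expR (y - x) - expR x =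
  expR x * (expR (y - x) - (1 + (y - x))) by ring.
move=> /eqP; rewrite mulf_eq0 expR_eq0 /= subr_eq0 => /eqP H.
apply/eqP/negP => /negP xy.
have := @expR_gt1Dx R (y - x); rewrite subr_eq0 eq_sym => /(_ xy).
by rewrite H ltxx.
Qed.

(** The arithmetic-geometric mean inequality for [S], the symmetric stand-in for [B^-1 A]: the
    exponential in [shape_part] is [(det S)^(1 / d)]. *)
Lemma shape_part_ge0 (A B : 'M[R]_d) : posdef A -> posdef B -> 0 <= shape_part (A, B).
Proof.
move=> pA pB; have [S pS [trS dS _]] := posdef_pair pA pB.
have [dA _ _] := posdef_ln_det pA; have [dB _ _] := posdef_ln_det pB.
rewrite mulr_ge0 ?expR_ge0 // subr_ge0 /tr_ratio /= -trS /lndet1 /lndet2 /=.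
by have := posdef_amgm d0 pS; rewrite dS ln_div // mulrC [_ / _]mulrC mulrC.
Qed.

Lemma kl_parts_ge0 v : 0 <= kl_part1 v + kl_part2 v - kl_part3 v.
Proof.
by rewrite /kl_part1 mulrBr; exact: kl_pos.
Qed.

Lemma d_neq0 : d%:R != 0 :> R. Proof. by rewrite pnatr_eq0 -lt0n. Qed.

Lemma kl_integrand_ge0 (A B : 'M[R]_d) : posdef A -> posdef B -> 0 <= kl_integrand
  (A, B).
Proof.
move=> pA pB; rewrite addr_ge0 // mulr_ge0 ?kl_parts_ge0 ?divr_ge0 //.
exact: shape_part_ge0.
Qed.

(** The Kullback-Leibler part forces equal determinants. The shape part then gives
    [tr (B^-1 A) = d], so [S] has determinant 1 and trace [d], which is the equality case of
    [posdef_ln_det]. *)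
Lemma kl_integrand_eq0 (A B : 'M[R]_d) : posdef A -> posdef B ->
  kl_integrand (A, B) = 0 -> A = B.
Proof.
move=> pA pB; have [S pS [trS dS S1]] := posdef_pair pA pB.
have [dA _ _] := posdef_ln_det pA; have [dB _ _] := posdef_ln_det pB.
have d0' : 0 < d%:R :> R by rewrite ltr0n.
move/eqP; rewrite paddr_eq0; last 2 first.
- by rewrite mulr_ge0 ?kl_parts_ge0 ?divr_ge0.
- by rewrite mulr_ge0 // shape_part_ge0.
rewrite !mulf_eq0 !invr_eq0 (negbTE d_neq0) pnatr_eq0 /= => /andP[/eqP + /eqP].
rewrite {1}/kl_part1 mulrBr => /kl_eq0 ab; have {}ab : lndet1 (A, B) = lndet2 (A, B).
  by apply: (mulfI (x := 2^-1 : R)) ab; rewrite invr_eq0 pnatr_eq0.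
rewrite /shape_part ab subrr mulr0 expR0 mulr1 => /eqP.
rewrite expR_eq0 orbF subr_eq0 => /eqP trd.
apply: S1; have [_ _] := posdef_ln_det pS; apply.
rewrite trS dS -[\tr _]/(tr_ratio (A, B)) trd subrr ln_div //.
by rewrite -[ln _]/(lndet1 (A, B)) ab subrr.
Qed.

Lemma kl_integrand_diag (A : 'M[R]_d) : 0 < \det A -> kl_integrand (A, A) = 0.
Proof.
move=> A0; have uA : A \in unitmx by rewrite unitmxE unitfE gt_eqF.
rewrite /kl_integrand /shape_part /kl_part1 /kl_part2 /kl_part3 /tr_ratio /lndet1
  /lndet2 /=.
by rewrite mulVmx // mxtrace1 subrr !mulr0 mul0r expR0 mulr1 subrr add0r subrr mulr0
  mul0r mulr0 addr0.
Qed.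

Lemma is_derive_kl_l (A B H : 'M[R]_d) : 0 < \det A -> 0 < \det B ->
  is_derive (0 : R) 1 (fun s : R => kl_integrand (A + s *: H, B))
  (2 / d%:R * (2^-1 * (ln (\det A) - ln (\det B)) * (expR (2^-1 * ln (\det A)) *
    (2^-1 * \tr (invmx A *m H))))
   + 2^-1 * ((\tr (invmx B *m H) - expR (d%:R^-1 * (ln (\det A) - ln (\det B))) * \tr
     (invmx A *m H)) *
      expR (2^-1 * ln (\det B)))).
Proof.
move=> A0 B0; have dA := is_derive_ln_det H A0.
have dE := is_derive_fexp (is_derive_fZ 2^-1 dA).
have dAB := is_derive_fB dA (is_derive_fcst 0 (ln (\det B))).
have d1 := is_derive_fM (is_derive_fZ 2^-1 dAB) dE.
have dK := is_derive_fZ (2 / d%:R) (is_derive_fB (is_derive_fD d1 (is_derive_fcst 0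
  (expR (2^-1 * ln (\det B))))) dE).
have dS := is_derive_fM (is_derive_fB (is_derive_tr_line (invmx B) A H 0)
  (is_derive_fZ d%:R (is_derive_fexp (is_derive_fZ d%:R^-1 dAB))))
  (is_derive_fcst 0 (expR (2^-1 * ln (\det B)))).
apply: (is_derive_eq (is_derive_fD dK (is_derive_fZ 2^-1 dS))).
have -> : A + (0 : R) *: H = A by rewrite scale0r addr0.
field; exact: d_neq0.
Qed.

(** The formula is needed off the diagonal because the mixed derivative differentiates it once more,
    in [A]. *)
Lemma is_derive_kl_r (A B K : 'M[R]_d) : 0 < \det A -> 0 < \det B ->
  is_derive (0 : R) 1 (fun t : R => kl_integrand (A, B + t *: K))
  (2 / d%:R * (2^-1 * \tr (invmx B *m K) * (expR (2^-1 * ln (\det B)) - expR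
    (2^-1 * ln (\det A))))
   + 2^-1 * ((- \tr (invmx B *m K *m invmx B *m A) +
       expR (d%:R^-1 * (ln (\det A) - ln (\det B))) * \tr (invmx B *m K) +
       (\tr (invmx B *m A) - d%:R * expR (d%:R^-1 * (ln (\det A) - ln (\det B)))) *
         (2^-1 * \tr (invmx B *m K))) * expR (2^-1 * ln (\det B)))).
Proof.
move=> A0 B0; have dB := is_derive_ln_det K B0.
have uB : B \in unitmx by rewrite unitmxE unitfE gt_eqF.
have dE := is_derive_fexp (is_derive_fZ 2^-1 dB).
have dAB := is_derive_fB (is_derive_fcst 0 (ln (\det A))) dB.
have d1 := is_derive_fM (is_derive_fZ 2^-1 dAB) (is_derive_fcst 0 (expR (2^-1 * ln
  (\det A)))).
have dK := is_derive_fZ (2 / d%:R) (is_derive_fB (is_derive_fD d1 dE)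
  (is_derive_fcst 0 (expR (2^-1 * ln (\det A))))).
have dS := is_derive_fM (is_derive_fB (is_derive_invmx_tr A K uB)
  (is_derive_fZ d%:R (is_derive_fexp (is_derive_fZ d%:R^-1 dAB)))) dE.
apply: (is_derive_eq (is_derive_fD dK (is_derive_fZ 2^-1 dS))).
have -> : B + (0 : R) *: K = B by rewrite scale0r addr0.
field; exact: d_neq0.
Qed.

Lemma pair_line_l (A B H : 'M[R]_d) (s : R) :
  (A, B) + s *: ((H, 0) : V) = (A + s *: H, B).
Proof.
by rewrite /GRing.scale /= /scale_pair /= scaler0 /GRing.add /= /add_pair /= addr0.
Qed.

Lemma pair_line_r (A B K : 'M[R]_d) (s : R) :
  (A, B) + s *: ((0, K) : V) = (A, B + s *: K).
Proof.
by rewrite /GRing.scale /= /scale_pair /= scaler0 /GRing.add /= /add_pair /= addr0.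
Qed.

Lemma derive_kl_l (A B H : 'M[R]_d) : det_pos (A, B) ->
  'D_((H, 0) : V) kl_integrand (A, B) = 'D_1 (fun s : R =>
    kl_integrand (A + s *: H, B)) 0.
Proof.
move=> AB; have := @is_derive_line _ _ kl_integrand (A, B) (H, 0) 0.
have -> : (fun s : R => kl_integrand ((A, B) + s *: ((H, 0) : V))) =
    (fun s : R => kl_integrand (A + s *: H, B)).
  by apply/funext => s; rewrite pair_line_l.
rewrite scale0r addr0 => HH.
by have [_ <-] := HH (smooth_on_differentiable smooth_kl_integrand AB).
Qed.

Lemma derive_kl_r (A B K : 'M[R]_d) : det_pos (A, B) ->
  'D_((0, K) : V) kl_integrand (A, B) = 'D_1 (fun t : R =>
    kl_integrand (A, B + t *: K)) 0.
Proof.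
move=> AB; have := @is_derive_line _ _ kl_integrand (A, B) (0, K) 0.
have -> : (fun s : R => kl_integrand ((A, B) + s *: ((0, K) : V))) =
    (fun s : R => kl_integrand (A, B + s *: K)).
  by apply/funext => s; rewrite pair_line_r.
rewrite scale0r addr0 => HH.
by have [_ <-] := HH (smooth_on_differentiable smooth_kl_integrand AB).
Qed.

Lemma derive_kl_diag_l (A H : 'M[R]_d) : 0 < \det A ->
  'D_((H, 0) : V) kl_integrand (A, A) = 0.
Proof.
move=> A0; rewrite derive_kl_l //; have [_ ->] := is_derive_kl_l H A0 A0.
by rewrite subrr !mulr0 expR0 mul1r subrr !mul0r !mulr0 addr0.
Qed.

Lemma derive_kl_diag_r (A K : 'M[R]_d) : 0 < \det A ->
  'D_((0, K) : V) kl_integrand (A, A) = 0.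
Proof.
move=> A0; have uA : A \in unitmx by rewrite unitmxE unitfE gt_eqF.
rewrite derive_kl_r //; have [_ ->] := is_derive_kl_r K A0 A0.
rewrite !subrr !mulr0 expR0 mulVmx // mxtrace1 -mulmxA mulVmx // mulmx1; ring.
Qed.

(** The products [tr (G^-1 H) tr (G^-1 K)] cancel: the Kullback-Leibler part gives the coefficient
    [- 1 / (2 d)], the exponential in the shape part [1 / (2 d)], and the factor
    [tr (G^-1 A) - d e^(...)] has derivative 0 at [A = G]. *)
Lemma derive2_kl_diag (G H K : 'M[R]_d) : 0 < \det G ->
  'D_((H, 0) : V) ('D_((0, K) : V) kl_integrand) (G, G) =
  - (2^-1 * (\tr (invmx G *m H *m invmx G *m K) * Num.sqrt (\det G))).
Proof.
move=> G0; have GG : det_pos (G, G) by [].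
have uG : G \in unitmx by rewrite unitmxE unitfE gt_eqF.
have sD : smooth_on det_pos ('D_((0, K) : V) kl_integrand).
  exact: smooth_on_derive smooth_kl_integrand.
have := @is_derive_line _ _ ('D_((0, K) : V) kl_integrand) (G, G) (H, 0) 0.
rewrite scale0r addr0 => HH.
have [_ <-] := HH (smooth_on_differentiable sD GG).
have dG := is_derive_ln_det H G0.
have dE := is_derive_fexp (is_derive_fZ 2^-1 dG).
have dGG := is_derive_fB dG (is_derive_fcst 0 (ln (\det G))).
have dX := is_derive_fexp (is_derive_fZ d%:R^-1 dGG).
set k := \tr (invmx G *m K).
have d1 := is_derive_fZ (2 / d%:R) (is_derive_fZ (2^-1 * k)
  (is_derive_fB (is_derive_fcst 0 (expR (2^-1 * ln (\det G)))) dE)).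
have d2 := is_derive_fB (is_derive_fM dX (is_derive_fcst 0 k))
  (is_derive_tr_line (invmx G *m K *m invmx G) G H 0).
have d3 := is_derive_fM (is_derive_fB (is_derive_tr_line (invmx G) G H 0)
  (is_derive_fZ d%:R dX))
  (is_derive_fcst 0 (2^-1 * k)).
have d4 := is_derive_fZ 2^-1 (is_derive_fM (is_derive_fD d2 d3) (is_derive_fcst 0
  (expR (2^-1 * ln (\det G))))).
have dT := is_derive_fD d1 d4.
(* [is_derive_kl_r] applies at [(G + s H, G)] while the determinant is positive, hence for small
   [s]. *)
have nE : \forall s \near (0 : R), 'D_((0, K) : V) kl_integrand ((G, G) + s *:
  ((H, 0) : V)) =
   2 / d%:R * (2^-1 * k * (expR (2^-1 * ln (\det G)) - expR (2^-1 * ln (\det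
     (G + s *: H)))))
   + 2^-1 * (((expR (d%:R^-1 * (ln (\det (G + s *: H)) - ln (\det G))) * k
        - \tr (invmx G *m K *m invmx G *m (G + s *: H))) +
       (\tr (invmx G *m (G + s *: H)) - d%:R * expR (d%:R^-1 * (ln (\det
         (G + s *: H)) - ln (\det G)))) *
         (2^-1 * k)) * expR (2^-1 * ln (\det G))).
  have npos : \forall s \near (0 : R), 0 < \det (G + s *: H).
    have [ds _] := is_derive_det H uG.
    have cs : {for 0, continuous (fun s : R => \det (G + s *: H))}.
      by apply: differentiable_continuous; exact/derivable1_diffP.
    by apply: (cvgr_gt _ cs); rewrite scale0r addr0.
  near=> s.
  have s0 : 0 < \det (G + s *: H) by near: s; exact: npos.
  rewrite pair_line_l derive_kl_r //; have [_ ->] := is_derive_kl_r K s0 G0.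
  by rewrite -/k; ring.
rewrite (near_eq_derive _ nE); case: dT => _ ->.
have -> : G + (0 : R) *: H = G by rewrite scale0r addr0.
rewrite !subrr !mulr0 expR0 sqrt_expR //.
rewrite [\tr (invmx G *m H *m invmx G *m K)]mxtrace_mulC !mulmxA.
have -> : \tr (K *m invmx G *m H *m invmx G) = \tr (invmx G *m K *m invmx G *m H).
  by rewrite mxtrace_mulC !mulmxA.
by field; exact: d_neq0.
Unshelve. all: by end_near. Qed.

End Integrand.

(** * Metrics with prescribed volume *)

Section Jacobians.
Context {R : realType} {d : nat}.
Variable M : smoothManifold R d.

Lemma mul_jacobian m n (f : 'rV[R]_m -> 'rV[R]_n) p v : v *m 'J f p = 'd f p v.
Proof. by rewrite /jacobian mul_rV_lin1. Qed.

Lemma eq_mulmxl m n (A B : 'M[R]_(m, n)) :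
  (forall v : 'rV[R]_m, v *m A = v *m B) -> A = B.
Proof. by move=> AB; apply/row_matrixP => i; rewrite !rowE AB. Qed.

Lemma near_eq_jacobian m n (f g : 'rV[R]_m -> 'rV[R]_n) (p : 'rV[R]_m) :
  {near p, f =1 g} -> differentiable f p -> 'J f p = 'J g p.
Proof.
move=> fg df; have dg := near_eq_differentiable fg df.
have H (v : 'rV[R]_m) : v *m 'J f p = v *m 'J g p.
  transitivity ('d f p v); first exact: mul_jacobian.
  transitivity ('d g p v); last exact/esym/mul_jacobian.
  by have := @near_eq_derive _ _ _ f g p v fg; rewrite (deriveE v df) (deriveE v dg).
exact: eq_mulmxl H.
Qed.

Lemma jacobian_comp m n k (f : 'rV[R]_m -> 'rV[R]_n) (g : 'rV[R]_n -> 'rV[R]_k) p :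
  differentiable f p -> differentiable g (f p) -> 'J (g \o f) p = 'J f p *m 'J g (f p).
Proof.
move=> df dg; apply/row_matrixP => i; rewrite !rowE mulmxA !mul_jacobian.
by rewrite diff_comp.
Qed.

Lemma jacobian_id m p : 'J (id : 'rV[R]_m -> 'rV[R]_m) p = 1%:M.
Proof.
apply/row_matrixP => i; rewrite !rowE mul_jacobian mulmx1.
by rewrite diff_val.
Qed.

Lemma Ck_on_jacobian m n k (U : set 'rV[R]_m) (f : 'rV[R]_m -> 'rV[R]_n) :
  open U -> smooth_on U f -> Ck_on k U (fun p => 'J f p).
Proof.
move=> oU sf; apply/Ck_on_mx => // i j.
apply: (@Ck_on_ext _ _ _ _ _ (fun p => ('D_(delta_mx 0 i) f p) 0 j)) => //.
  move=> p /set_mem Up; rewrite deriveE; last by have [+ _] := sf 1%N; exact.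
  by rewrite -mul_jacobian -rowE mxE.
by apply: (iffLR (Ck_on_mx _ _ oU)); have [_] := sf k.+1; exact.
Qed.

Lemma transition_differentiable (a b : chart M) x : dom a x -> dom b x ->
  differentiable (Defs.coord b \o param a) (Defs.coord a x).
Proof.
move=> ax bx; have [+ _] := transition_smooth a b 1%N; apply.
by exists x.
Qed.

(** The chain rule; the row convention puts the factors in the order of travel. Passing through [b]
    agrees with the direct transition only near the point, which suffices for Jacobians. *)
Lemma transition_jac_comp (a b c : chart M) x : dom a x -> dom b x -> dom c x ->
  transition_jac a c x = transition_jac a b x *m transition_jac b c x.
Proof.
move=> ax bx cx; rewrite /transition_jac.
have dab := transition_differentiable ax bx.
have E : (Defs.coord b \o param a) (Defs.coord a x) = Defs.coord b x by rewrite /=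
  coordK.
have dbc := transition_differentiable bx cx.
have dbc' : differentiable (Defs.coord c \o param b)
    ((Defs.coord b \o param a) (Defs.coord a x)) by rewrite E.
have JJ := jacobian_comp dab dbc'; rewrite E in JJ; rewrite -JJ.
apply: near_eq_jacobian; last exact: transition_differentiable.
have ay := chart_image_coord ax.
have := near_param ay (dom_open b); rewrite coordK // => /(_ bx).
by apply: filterS => y by_ /=; rewrite coordK.
Qed.

Lemma transition_jac_id (a : chart M) x : dom a x -> transition_jac a a x = 1%:M.
Proof.
move=> ax; rewrite /transition_jac -(jacobian_id (Defs.coord a x)).
apply: near_eq_jacobian; last exact: transition_differentiable.
have := near_chart_image (chart_image_coord ax).
by apply: filterS => y ay /=; rewrite paramK.
Qed.

Lemma transition_jac_unit (a b : chart M) x : dom a x -> dom b x ->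
  transition_jac a b x \in unitmx.
Proof.
move=> ax bx.
have E : transition_jac a b x *m transition_jac b a x = 1%:M.
  by rewrite -(transition_jac_comp ax bx ax) (transition_jac_id ax).
exact: (proj1 (mulmx1_unit E)).
Qed.

End Jacobians.

(** * Existence of a Riemannian metric *)

Section MetricExistence.
Context {R : realType} {d : nat} {M : smoothManifold R d}.
Variable P : partition_of_unity M.

(** The average, weighted by the partition, of the Euclidean metrics of its charts: the Gram matrix
    of the Jacobian is the pullback of the identity. *)
Definition pou_metric : tensor M := fun a y =>
  if pselect (chart_image a y) then
    \sum_(i < pou_size P) pou_fun i (param a y) *:
      ('J (Defs.coord (pou_chart i) \o param a) y *m ('J (Defs.coord
        (pou_chart i) \o param a) y)^T)
  else 0.

Lemma pou_metricE a x : dom a x -> pou_metric a (Defs.coord a x) =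
  \sum_(i < pou_size P) pou_fun i x *:
    (transition_jac a (pou_chart i) x *m (transition_jac a (pou_chart i) x)^T).
Proof.
move=> ax; rewrite /pou_metric; case: pselect => [_|[]] /=;
  last exact: chart_image_coord.
by apply: eq_bigr => i _; rewrite coordK.
Qed.

Lemma pou_fun_notin (i : 'I_(pou_size P)) x : ~ dom (pou_chart i) x -> pou_fun i x = 0.
Proof.
move=> nx; apply/eqP; apply: contrapT => /negP x0; apply: nx.
by apply: pou_support; exact: subset_closure.
Qed.

(** Each summand is smooth at points of its own chart. At other points its Jacobian carries no
    information, but the weight vanishes nearby, the support being closed and inside the chart. *)
Lemma smooth_pou_metric a : smooth_on (chart_image a) (pou_metric a).
Proof.
have oU := @image_open _ _ M a.
move=> n; apply/(@Ck_on_mx _ _ _ _ _ _ _ oU) => k l.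
apply: (@Ck_on_ext _ _ _ _ _ (fun y => \sum_(i < pou_size P) pou_fun i (param a y) *
   (\sum_j 'J (Defs.coord (pou_chart i) \o param a) y k j *
           'J (Defs.coord (pou_chart i) \o param a) y l j))) => //.
  move=> y /set_mem ay; rewrite /pou_metric; case: pselect => [_|[//]] /=.
  rewrite summxE; apply: eq_bigr => i _; rewrite !mxE; congr (_ * _).
  by apply: eq_bigr => j _; rewrite [X in _ = _ * X]mxE.
apply: Ck_on_sum => // i _; apply: Ck_on_near => y ay.
have [cy|ncy] := pselect (dom (pou_chart i) (param a y)).
  exists (fun y => pou_fun i (param a y) *
   (\sum_j 'J (Defs.coord (pou_chart i) \o param a) y k j *
           'J (Defs.coord (pou_chart i) \o param a) y l j)).
    by apply: (@filterE _ (nbhs y)) => y'.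
  set O := Defs.coord a @` (dom a `&` dom (pou_chart i)).
  have oO : open O by exact: overlap_open.
  have Oy : O y by exists (param a y); [split=> //;
    exact: chart_image_param|exact: paramK].
  apply: (@Ck_on_subset _ _ _ _ O); first by move=> _ ->.
  apply: Ck_onM => //.
    by apply: Ck_on_subset (pou_smooth i a n) => _ [x [ax _] <-];
      exact: chart_image_coord.
  have CJ := Ck_on_jacobian n oO (transition_smooth a (pou_chart i)).
  have CJ' := iffLR (Ck_on_mx _ _ oO) CJ.
  by apply: Ck_on_sum => // j _; apply: Ck_onM.
exists (fun=> 0); last exact: Ck_on_cst.
pose S := closure [set x | pou_fun i x != 0].
have nS : (~` S) (param a y) by move=> /pou_support.
have oS : open (~` S) by apply: closed_openC; exact: closed_closure.
have := near_param ay oS nS; apply: filterS => y' nS'.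
suff -> : pou_fun i (param a y') = 0 by rewrite mul0r.
apply/eqP; apply: contrapT => /negP x0; apply: nS'.
exact: subset_closure.
Qed.

(** The alternative matches a point outside or inside the chart of the summand: either the weight is
    zero or the chain rule for Jacobians holds. *)
Lemma gram_pullback (c : R) (A B C : 'M[R]_d) : c = 0 \/ A = B *m C ->
  c *: (A *m A^T) = B *m (c *: (C *m C^T)) *m B^T.
Proof.
case=> ->; first by rewrite !scale0r mulmx0 mul0mx.
by rewrite -scalemxAr -scalemxAl trmx_mul !mulmxA.
Qed.

Lemma gram_quadratic (c : R) (A : 'M[R]_d) (v : 'rV[R]_d) :
  (v *m (c *: (A *m A^T)) *m v^T) 0 0 = c * \sum_j ((v *m A) 0 j) ^+ 2.
Proof.
rewrite -scalemxAr -scalemxAl mxE; congr (_ * _).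
have -> : v *m (A *m A^T) *m v^T = (v *m A) *m (v *m A)^T by rewrite trmx_mul !mulmxA.
by rewrite mxE; apply: eq_bigr => j _; rewrite [X in _ * X]mxE expr2.
Qed.

(** For definiteness, some chart has positive weight at the point, and its invertible Jacobian sends
    [v] to a nonzero vector; the other summands are nonnegative. *)
Lemma Met_pou_metric : Met pou_metric.
Proof.
split; first split.
- exact: smooth_pou_metric.
- by move=> a y ny; rewrite /pou_metric; case: pselect.
- move=> a y; rewrite /pou_metric; case: pselect => [_|_] /=; last by rewrite trmx0.
  rewrite linear_sum /=; apply: eq_bigr => i _.
  by rewrite linearZ /= trmx_mul trmxK.
- move=> a b x ax bx; rewrite (pou_metricE ax) (pou_metricE bx).
  have H (I : finType) (J K : 'M[R]_d) (F : I -> 'M[R]_d) :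
      J *m (\sum_i F i) *m K = \sum_i J *m F i *m K by rewrite mulmx_sumr mulmx_suml.
  rewrite H; apply: eq_bigr => i _; apply: gram_pullback.
  have [cx|ncx] := pselect (dom (pou_chart i) x); first by right;
    exact: transition_jac_comp.
  by left; exact: pou_fun_notin.
move=> a y [x ax <-] v v0; rewrite (pou_metricE ax) mulmx_sumr mulmx_suml summxE.
have E i : (v *m (pou_fun i x *: (transition_jac a (pou_chart i) x *m
  (transition_jac a (pou_chart i) x)^T)) *m v^T) 0 0
   = pou_fun (p := P) i x * \sum_j ((v *m transition_jac a (pou_chart i) x) 0 j) ^+ 2.
  exact: gram_quadratic.
rewrite (eq_bigr _ (fun i _ => E i)).
have [i [xi ci]] := pou_fun_gt0 P x.
rewrite (bigD1 i) //= ltr_wpDr //.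
  by apply: sumr_ge0 => j _; rewrite mulr_ge0 ?pou_ge0 // sumr_ge0 // => k _;
    exact: sqr_ge0.
rewrite mulr_gt0 // lt_neqAle sumr_ge0 ?andbT; last by move=> k _; exact: sqr_ge0.
rewrite eq_sym psumr_neq0; last by move=> k _; exact: sqr_ge0.
have : v *m transition_jac a (pou_chart i) x != 0.
  apply: contraNneq v0 => vJ.
  by rewrite -[v]mulmx1 -(mulmxV (transition_jac_unit ax ci)) mulmxA vJ mul0mx.
case/rV0Pn => k vk; apply/hasP; exists k; first exact: mem_index_enum.
by rewrite /= exprn_even_gt0.
Qed.

End MetricExistence.

(** * Conformal metrics with prescribed volume density *)

Section Conformal.
Context {R : realType} {d : nat} {M : smoothManifold R d}.
Hypothesis d0 : (0 < d)%N.

Lemma Met_posdef (g : tensor M) a y : Met g -> chart_image a y -> posdef (g a y).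
Proof. by move=> [[_ _ symg _] posg] ay; split; [exact: symg|exact: posg]. Qed.

Lemma Met_det_gt0 (g : tensor M) a y : Met g -> chart_image a y -> 0 < \det (g a y).
Proof. by move=> gM ay; have [] := posdef_ln_det (Met_posdef gM ay). Qed.

(** This is [(rho / vol g)^(2 / d)]: scaling the metric by [c] scales the determinant by [c^d] and
    the volume by [c^(d / 2)]. *)
Definition conformal_factor (g : tensor M) (rho : scalar_density M) a y : R :=
  expR (2 / d%:R * (ln (rho a y) - 2^-1 * ln (\det (g a y)))).

Definition conformal (g : tensor M) (rho : scalar_density M) : tensor M :=
  fun a y => conformal_factor g rho a y *: g a y.

Lemma Met_conformal g rho : Met g -> Dens rho -> Met (conformal g rho).
Proof.
move=> gM [sr r0 rpos rT]; have [[sg g0 symg gT] posg] := gM; split; first split.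
- move=> a n; have oU := @image_open _ _ M a.
  apply/(@Ck_on_mx _ _ _ _ _ _ _ oU) => k l.
  have Cg := iffLR (Ck_on_mx _ _ oU) (sg a n).
  apply: (@Ck_on_ext _ _ _ _ _ (fun y => conformal_factor g rho a y * g a y k l)) => //.
    by move=> y _; rewrite mxE.
  apply: Ck_onM => //.
  apply: (@Ck_on_comp _ _ _ _ setT (fun y => 2 / d%:R * (ln (rho a y) - 2^-1 * ln
    (\det (g a y))))) => //; last exact: Ck_on_expR.
  apply: Ck_onM => //; first exact: Ck_on_cst.
  apply: Ck_onD => //.
    apply: (@Ck_on_comp _ _ _ _ [set x | 0 < x] (rho a)) => //;
      [exact: rpos|exact: sr|exact: Ck_on_ln].
  apply: Ck_onN => //; apply: Ck_onM => //; first exact: Ck_on_cst.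
  apply: (@Ck_on_comp _ _ _ _ [set x | 0 < x] (fun y => \det (g a y))) => //.
  + by move=> y ay; exact: Met_det_gt0.
  + exact: Ck_on_det.
  + exact: Ck_on_ln.
- by move=> a y ny; rewrite /conformal g0 // scaler0.
- by move=> a y; rewrite /conformal linearZ /= symg.
(* Under a change of chart [rho] and the volume of [g] both acquire the factor [|det J|], so the
   conformal factor is a genuine function on [M]. *)
- move=> a b x ax bx; rewrite /conformal (gT a b x) // -scalemxAr -scalemxAl;
  congr (_ *: _).
  rewrite /conformal_factor (rT a b x) // (gT a b x) // !det_mulmx det_tr.
  set J := \det _; have J0 : J != 0 by rewrite -unitfE -unitmxE transition_jac_unit.
  have db := Met_det_gt0 gM (chart_image_coord bx).
  have rb := rpos _ _ (chart_image_coord bx).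
  have -> : J * \det (g b (Defs.coord b x)) * J = `|J| * `|J| * \det (g b
    (Defs.coord b x)).
    by rewrite -normrM ger0_norm -?expr2 ?sqr_ge0 // expr2; ring.
  have J0' : 0 < `|J| by rewrite normr_gt0.
  rewrite !lnM ?posrE ?mulr_gt0 //; congr (expR (_ * _)); by field.
- move=> a y ay v v0; rewrite -scalemxAr -scalemxAl mxE mulr_gt0 ?expR_gt0 //.
  exact: posg.
Qed.

Lemma ln_det_conformal g rho a y : Met g -> chart_image a y ->
  ln (\det (conformal g rho a y)) = 2 * ln (rho a y).
Proof.
move=> gM ay; have dg := Met_det_gt0 gM ay.
rewrite /conformal detZ lnM ?posrE ?exprn_gt0 ?expR_gt0 //.
rewrite lnXn ?expR_gt0 // expRK -mulr_natr.
by field; exact: d_neq0.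
Qed.

Lemma vol_conformal g rho : Met g -> Dens rho -> vol (conformal g rho) = rho.
Proof.
move=> gM rD; have [sr r0 rpos rT] := rD; have cM := Met_conformal gM rD.
apply/funext => a; apply/funext => y; rewrite /vol.
have [ay|nay] := pselect (chart_image a y).
  rewrite sqrt_expR; last exact: Met_det_gt0.
  by rewrite ln_det_conformal // mulrA mulVf ?pnatr_eq0 // mul1r lnK // posrE;
    exact: rpos.
(* Outside the chart image the metric is the zero matrix, whose determinant is 0 because [d] is
   positive, in agreement with the default value of [rho]. *)
have [[_ + _ _] _] := cM => ->//; rewrite (r0 a y) //.
have -> : (0 : 'M[R]_d) = 0 *: 1%:M by rewrite scale0r.
by rewrite detZ expr0n -[d == 0%N]negbK -lt0n d0 mul0r sqrtr0.
Qed.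

(** For two conformal metrics [B^-1 A] is a multiple of the identity, the equality case of the
    arithmetic-geometric mean inequality. *)
Lemma shape_part_conformal g rho0 rho1 a y : Met g -> Dens rho0 -> Dens rho1 ->
  chart_image a y -> shape_part (conformal g rho0 a y, conformal g rho1 a y) = 0.
Proof.
move=> gM rD0 rD1 ay; have dg := Met_det_gt0 gM ay.
have ug : g a y \in unitmx by rewrite unitmxE unitfE gt_eqF.
rewrite /shape_part /tr_ratio /lndet1 /lndet2 /= !ln_det_conformal //.
have c1 : conformal_factor g rho1 a y != 0 by rewrite gt_eqF // expR_gt0.
rewrite /conformal invmxZ; last by rewrite unitmxE detZ unitfE mulf_neq0 ?expf_neq0 //
  gt_eqF.
rewrite -scalemxAr -scalemxAl scalerA mxtraceZ mulVmx // mxtrace1 /conformal_factor.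
rewrite -expRN -expRD [_ * d%:R]mulrC -mulrBr.
suff -> : 2 / d%:R * (ln (rho0 a y) - 2^-1 * ln (\det (g a y))) +
   - (2 / d%:R * (ln (rho1 a y) - 2^-1 * ln (\det (g a y)))) =
   d%:R^-1 * (2 * ln (rho0 a y) - 2 * ln (rho1 a y)) by rewrite subrr mulr0 mul0r.
by field; exact: d_neq0.
Qed.

End Conformal.

(** * The divergence on metrics *)

Section KLMetIntegral.
Context {R : realType} {d : nat} {M : smoothManifold R d}.
Hypothesis d0 : (0 < d)%N.
Hypothesis cM : compact [set: M].
Variable P : partition_of_unity M.
Hypothesis densE : forall rho : scalar_density M, dens_integral rho = pou_integral P
  rho.
Local Notation tensor2 := (tensor M * tensor M)%type.
Local Notation U := (@det_pos R d).

Lemma sym2_field_cont (u : tensor2) : sym2 u.1 -> sym2 u.2 -> field_cont P u.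
Proof.
move=> [s1 _ _ _] [s2 _ _ _] i y Ky; have ay := pou_supp_sub Ky.
have c1 : {for y, continuous (u.1 (pou_chart i))} by exact: (s1 _ 0%N).
have c2 : {for y, continuous (u.2 (pou_chart i))} by exact: (s2 _ 0%N).
move=> A [[/= Q1 Q2] [/= N1 N2] QA].
have n1 : nbhs y (u.1 (pou_chart i) @^-1` Q1) := c1 _ N1.
have n2 : nbhs y (u.2 (pou_chart i) @^-1` Q2) := c2 _ N2.
suff : nbhs y (tensor_ev u (pou_chart i) @^-1` A) by [].
by apply: filterS (filterI n1 n2) => z Z12; exact: QA.
Qed.

Lemma sym2_0 : sym2 (0 : tensor M).
Proof.
split=> [a n|//|a y|a b x _ _]; [exact: Ck_on_cst|exact: trmx0|].
by rewrite mulmx0 mul0mx.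
Qed.

Lemma tensor_line0 (g : tensor M) (t : R) : g + t *: (0 : tensor M) = g.
Proof. by rewrite scaler0 addr0. Qed.

Lemma Met_field_in (u : tensor2) : Met u.1 -> Met u.2 -> field_in P U u.
Proof.
move=> u1 u2; split; first by apply: sym2_field_cont; [case: u1|case: u2].
move=> i y Ky; have ay := pou_supp_sub Ky.
by split; exact: Met_det_gt0.
Qed.

Lemma pou_cont_lin (c : R) (f g : scalar_density M) : pou_cont P f -> pou_cont P g ->
  pou_cont P (fun a y => c * f a y + g a y).
Proof.
move=> cf cg i y Ky; apply: continuousD; last exact: cg.
by apply: continuousM; [exact: cst_continuous|exact: cf].
Qed.

Lemma pou_cont0 : pou_cont P (fun _ _ => 0).
Proof. by move=> i y _; exact: cst_continuous. Qed.

Lemma pou_integral0 : pou_integral P (fun _ _ => 0) = 0.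
Proof.
(* With [c = -1] linearity writes the integral of zero as [- I + I]. *)
have H := pou_integral_lin cM (-1) pou_cont0 pou_cont0.
rewrite [X in _ = X](_ : _ = 0) in H; last by ring.
rewrite -[RHS]H; apply: pou_integral_ext => i y _.
by rewrite mulr0 addr0.
Qed.

Lemma shape_pou_integral (u : tensor2) : field_in P U u ->
  Dshape u.1 u.2 = 2^-1 * pou_integral P (integrand (@shape_part R d) [::] u).
Proof.
move=> [_ uU]; rewrite /Dshape densE; congr (_ * _); apply: pou_integral_ext => i y Ky.
have [A0 B0] := uU i y Ky.
by rewrite /vol powR_vol_ratio // [in LHS](sqrt_expR B0).
Qed.

(** The identity is stated on [field_in], which is open along lines, so that it survives the
    differentiations in [dir_derive]. *)
Lemma KLMet_pou_integral (u : tensor2) : field_in P U u ->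
  KLMet u.1 u.2 = pou_integral P (integrand (@kl_integrand R d) [::] u).
Proof.
move=> uI; have [_ uU] := uI.
rewrite /KLMet (shape_pou_integral uI) /KL !densE.
have oU := @open_det_pos R d.
have nil j : (j < size (Nil tensor2))%N -> field_cont P (nth 0 [::] j) by [].
have c1 := integrand_cont cM oU (@smooth_kl_part1 R d) uI nil.
have c2 := integrand_cont cM oU (@smooth_kl_part2 R d) uI nil.
have c3 := integrand_cont cM oU (@smooth_kl_part3 R d) uI nil.
have c4 := integrand_cont cM oU (@smooth_shape_part R d) uI nil.
have E1 : pou_integral P (fun a y => ln (vol u.1 a y / vol u.2 a y) * vol u.1 a y) =
    pou_integral P (integrand (@kl_part1 R d) [::] u).
  apply: pou_integral_ext => i y Ky; have [A0 B0] := uU i y Ky.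
  by rewrite /vol ln_vol_ratio // (sqrt_expR A0).
have E2 : pou_integral P (vol u.2) = pou_integral P (integrand (@kl_part2 R d) [::] u).
  apply: pou_integral_ext => i y Ky; have [A0 B0] := uU i y Ky.
  by rewrite /vol (sqrt_expR B0).
have E3 : pou_integral P (vol u.1) = pou_integral P (integrand (@kl_part3 R d) [::] u).
  apply: pou_integral_ext => i y Ky; have [A0 B0] := uU i y Ky.
  by rewrite /vol (sqrt_expR A0).
rewrite E1 E2 E3.
have k1 := pou_cont_lin (c := -1) c3 c2; have k2 := pou_cont_lin (c := 1) c1 k1.
have k3 := pou_cont_lin (c := 2^-1) c4 pou_cont0.
(* [pou_integral_lin] handles the form [c f + g]; zero integrals and coefficients 1 are inserted
   until everything has this form. *)
rewrite -[2^-1 * _]addr0 -[X in _ + (_ + X)]pou_integral0 -(pou_integral_lin cM _ c4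
  pou_cont0).
rewrite -addrA [X in _ * (_ + X)]addrC -mulN1r -(pou_integral_lin cM _ c3 c2).
rewrite -[X in _ * (X + _)]mul1r -(pou_integral_lin cM _ c1 k1) -(pou_integral_lin cM _
  k2 k3).
apply: pou_integral_ext => i y _; rewrite /integrand /= /kl_integrand; ring.
Qed.

Lemma KLMet_ge0 (g0 g1 : tensor M) : Met g0 -> Met g1 -> 0 <= KLMet g0 g1.
Proof.
move=> m0 m1; rewrite (@KLMet_pou_integral (g0, g1)); last exact: Met_field_in.
apply: pou_integral_ge0 => i y Ky; have ay := pou_supp_sub Ky.
by apply: kl_integrand_ge0 => //; exact: Met_posdef.
Qed.

(** Vanishing of the integral gives equality of the components at each point in one chart of
    positive weight. The transformation law carries it to every chart, and outside the chart images
    both components are 0. *)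
Lemma KLMet_eq0 (g0 g1 : tensor M) : Met g0 -> Met g1 -> KLMet g0 g1 = 0 <-> g0 = g1.
Proof.
move=> m0 m1; have uI : field_in P U (g0, g1) by exact: Met_field_in.
rewrite (@KLMet_pou_integral (g0, g1)) //; split=> [I0|g01]; last first.
  rewrite -pou_integral0; apply: pou_integral_ext => i y Ky; have ay := pou_supp_sub Ky.
  by rewrite /integrand /tensor_ev /= g01 kl_integrand_diag //; exact: Met_det_gt0.
have nil j : (j < size (Nil tensor2))%N -> field_cont P (nth 0 [::] j) by [].
have cF := integrand_cont cM (@open_det_pos R d) (@smooth_kl_integrand R d) uI nil.
have F0 (i : 'I_(pou_size P)) y : pou_supp i y -> 0 <= integrand
  (@kl_integrand R d) [::] (g0, g1) (pou_chart i) y.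
  by move=> Ky; have ay := pou_supp_sub Ky; apply: kl_integrand_ge0 => //;
    exact: Met_posdef.
have H := pou_integral_eq0 cM cF F0 I0.
have [[_ z0 _ T0] _] := m0; have [[_ z1 _ T1] _] := m1.
apply/funext => a; apply/funext => y.
have [ay|nay] := pselect (chart_image a y); last by rewrite z0 // z1.
case: ay => x ax <-; have [i [xi ci]] := pou_fun_gt0 P x.
rewrite (T0 a (pou_chart i) x) // (T1 a (pou_chart i) x) //; congr (_ *m _ *m _).
have cy := chart_image_coord ci.
apply: (@kl_integrand_eq0 _ _ d0); [exact: Met_posdef|exact: Met_posdef|].
by apply: H => //; rewrite coordK.
Qed.

Lemma KLMet_smooth : smooth_functional (fun u : tensor2 => KLMet u.1 u.2).
Proof.
move=> k hs u Hhs [u1 u2]; have uI := Met_field_in u1 u2.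
have Hnth (ks : k.-tuple tensor2) :
    (forall i, (@sym2 R d M `*` @sym2 R d M) (tnth ks i)) ->
    forall j, (j < size ks)%N -> field_cont P (nth 0 ks j).
  move=> H j; rewrite size_tuple => jk; have [] := H (Ordinal jk).
  by rewrite (tnth_nth 0) /=; exact: sym2_field_cont.
have oU := @open_det_pos R d; have sF := @smooth_kl_integrand R d.
have chs := Hnth _ Hhs.
split=> [h [h1 h2]|e e0].
  by have [] := derivable_dir_derive cM oU sF KLMet_pou_integral chs uI
    (sym2_field_cont h1 h2).
have [r r0 Hr] := pou_integral_continuous cM oU sF e0 uI chs.
(* The integrand involves no derivatives of the tensors, so seminorms of order 0 on the supports of
   the partition control it. *)
pose p := @Seminorms _ _ M (pou_size P) (@pou_chart _ _ _ P) (@pou_supp _ _ _ P)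
  (fun i => pou_supp_compact (i := i) cM) (fun i => @pou_supp_sub _ _ _ P i) 0.
exists p, r; split=> // hs' u' Hhs' [u1' u2'] uu' hh'.
have uI' := Met_field_in u1' u2'; have chs' := Hnth _ Hhs'.
rewrite !(dir_derive_pou_integral cM oU sF KLMet_pou_integral) //.
have sz : size hs' = size hs by rewrite !size_tuple.
have chs2 j : (j < size hs)%N -> field_cont P (nth 0 hs' j) by rewrite -sz; exact: chs'.
have close (v w : tensor2) (i : 'I_(pou_size P)) y : smooth_close2 p r v w ->
    pou_supp i y -> `|tensor_ev v (pou_chart i) y - tensor_ev w (pou_chart i) y| < r.
  move=> [H1 H2] Ky; rewrite prod_normE /= gt_max.
  by rewrite (H1 i [::] y) // (H2 i [::] y).
apply: (Hr u' hs' uI' chs2 sz) => i y Ky; split; first exact: close.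
move=> j; rewrite size_tuple => jk; have := hh' (Ordinal jk).
rewrite !(tnth_nth 0) => hj; exact: close.
Qed.

Lemma KLMet_derive_l (g h : tensor M) : Met g -> sym2 h ->
  is_derive (0 : R) 1 (fun t : R => KLMet (g + t *: h) g) 0.
Proof.
move=> gM hS; have uI : field_in P U (g, g) by exact: Met_field_in.
have ch : field_cont P (h, 0) by apply: sym2_field_cont => //; exact: sym2_0.
have nil j : (j < size (Nil tensor2))%N -> field_cont P (nth 0 [::] j) by [].
have H := derivable_dir_derive cM (@open_det_pos R d) (@smooth_kl_integrand R d)
  KLMet_pou_integral nil uI ch.
have -> : (fun t : R => KLMet (g + t *: h) g) =
    (fun t : R => dir_derive (fun u : tensor2 => KLMet u.1 u.2) [::] ((g, g) + t *:
      (h, 0))).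
  by apply/funext => t /=; rewrite !tensor_line0.
apply: (is_derive_eq H); rewrite -pou_integral0; apply: pou_integral_ext => i y Ky.
by apply: derive_kl_diag_l => //; apply: Met_det_gt0 => //; exact: pou_supp_sub Ky.
Qed.

Lemma KLMet_derive_r (g h : tensor M) : Met g -> sym2 h ->
  is_derive (0 : R) 1 (fun t : R => KLMet g (g + t *: h)) 0.
Proof.
move=> gM hS; have uI : field_in P U (g, g) by exact: Met_field_in.
have ch : field_cont P (0, h) by apply: sym2_field_cont => //; exact: sym2_0.
have nil j : (j < size (Nil tensor2))%N -> field_cont P (nth 0 [::] j) by [].
have H := derivable_dir_derive cM (@open_det_pos R d) (@smooth_kl_integrand R d)
  KLMet_pou_integral nil uI ch.
have -> : (fun t : R => KLMet g (g + t *: h)) =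
    (fun t : R => dir_derive (fun u : tensor2 => KLMet u.1 u.2) [::] ((g, g) + t *:
      (0, h))).
  by apply/funext => t /=; rewrite !tensor_line0.
apply: (is_derive_eq H); rewrite -pou_integral0; apply: pou_integral_ext => i y Ky.
by apply: derive_kl_diag_r => //; apply: Met_det_gt0 => //; exact: pou_supp_sub Ky.
Qed.

Lemma KLMet_divergence : divergence (@KLMet R d M).
Proof.
split; [exact: KLMet_smooth|exact: KLMet_ge0|exact: KLMet_eq0|
  exact: KLMet_derive_l|exact: KLMet_derive_r].
Qed.

Lemma KLMet_induced_metric (g h k : tensor M) : Met g -> sym2 h -> sym2 k ->
  induced_metric (@KLMet R d M) g h k = 2^-1 * Ebin g h k.
Proof.
move=> gM hS kS; have uI : field_in P U (g, g) by exact: Met_field_in.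
have S0 := sym2_0.
(* The order matches [induced_metric]: the outer derivative moves the first argument along [h], the
   inner one the second along [k]. *)
pose hs : seq tensor2 := [:: (h, 0); (0, k)].
have chs j : (j < size hs)%N -> field_cont P (nth 0 hs j).
  by case: j => [|[|j]] //= _; apply: sym2_field_cont.
have DE := dir_derive_pou_integral cM (@open_det_pos R d) (@smooth_kl_integrand R d)
  KLMet_pou_integral chs uI.
have -> : induced_metric (@KLMet R d M) g h k =
    - dir_derive (fun u : tensor2 => KLMet u.1 u.2) hs (g, g).
  rewrite /induced_metric /=; congr (- derive1 _ 0); apply/funext => s.
  congr (derive1 _ 0); apply/funext => t /=.
  by rewrite !tensor_line0.
rewrite DE /Ebin densE.
have c0 : pou_cont P (integrand (@kl_integrand R d) hs (g, g)).
  exact: (integrand_cont cM (@open_det_pos R d) (@smooth_kl_integrand R d) uI chs).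
have E : pou_integral P (fun a y => \tr (invmx (g a y) *m h a y *m invmx
  (g a y) *m k a y) * vol g a y) =
    pou_integral P (fun a y => - 2 * integrand (@kl_integrand R d) hs (g, g) a y + 0).
  apply: pou_integral_ext => i y Ky.
  have dg : 0 < \det (g (pou_chart i) y) by apply: Met_det_gt0 => //;
    exact: pou_supp_sub Ky.
  rewrite /integrand /= [X in - 2 * X](derive2_kl_diag d0 (h (pou_chart i) y) (k
    (pou_chart i) y) dg) /vol.
  by field.
rewrite E (pou_integral_lin cM (- 2) c0 pou_cont0) pou_integral0.
by field.
Qed.

Lemma Dshape_ge0 (g0 g1 : tensor M) : Met g0 -> Met g1 -> 0 <= Dshape g0 g1.
Proof.
move=> m0 m1; rewrite (@shape_pou_integral (g0, g1)); last exact: Met_field_in.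
rewrite mulr_ge0 //; apply: pou_integral_ge0 => i y Ky; have ay := pou_supp_sub Ky.
by apply: shape_part_ge0 => //; exact: Met_posdef.
Qed.

Lemma KLMet_descended (rho0 rho1 : scalar_density M) : Dens rho0 -> Dens rho1 ->
  descended (@KLMet R d M) rho0 rho1 = (2 / d%:R * KL rho0 rho1)%:E.
Proof.
move=> r0 r1; apply/eqP; rewrite eq_le; apply/andP; split.
  apply: ereal_inf_lbound.
  (* One background metric serves both densities: within its conformal class the volumes can be
     prescribed and the shape term vanishes. *)
  have gM := Met_pou_metric P.
  have m0 := Met_conformal gM r0; have m1 := Met_conformal gM r1.
  exists (conformal (pou_metric P) rho0), (conformal (pou_metric P) rho1).
  split=> //; [exact: vol_conformal|exact: vol_conformal|].
  rewrite /KLMet !vol_conformal //.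
  suff -> : Dshape (conformal (pou_metric P) rho0) (conformal (pou_metric P) rho1) = 0.
    by rewrite addr0.
  rewrite (@shape_pou_integral (_, _)); last exact: Met_field_in.
  rewrite (_ : pou_integral P _ = 0) ?mulr0 // -pou_integral0.
  apply: pou_integral_ext => i y Ky; apply: shape_part_conformal => //.
  exact: pou_supp_sub Ky.
apply: le_ereal_inf_tmp => _ [g0 [g1 [m0 m1 <- <- ->]]].
by rewrite lee_fin /KLMet lerDl; exact: Dshape_ge0.
Qed.

End KLMetIntegral.

Theorem theorem6p5 (R : realType) (d : nat) (hd : (0 < d)%N)
    (M : smoothManifold R d) (hM : compact [set: M]) :
  [/\ divergence (@KLMet R d M),
      (forall g h k : tensor M, Met g -> sym2 h -> sym2 k ->
         induced_metric (@KLMet R d M) g h k = 2^-1 * Ebin g h k)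
    & exists2 c : R, 0 < c &
        forall rho0 rho1 : scalar_density M, Dens rho0 -> Dens rho1 ->
          descended (@KLMet R d M) rho0 rho1 = (c * KL rho0 rho1)%:E ].
Proof.
have [P densE] := dens_integral_pou hM.
split.
- exact: KLMet_divergence densE.
- exact: KLMet_induced_metric densE.
- exists (2 / d%:R); first by rewrite divr_gt0 ?ltr0n.
  exact: KLMet_descended densE.
Qed.
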